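(* Let $k$ be a subfield of $\mathbf{C}$ equipped with the Archimedean norm $|\cdot|_\infty$, and let $\mathbf{A}^{1,\mathrm{hyb}}_k$ be the hybrid analytification of the affine line over $k$, with non-Archimedean fibre $\mathbf{A}^{1,\mathrm{triv}}_k\subseteq \mathbf{A}^{1,\mathrm{hyb}}_k$. (1) If $k$ is countable, then there is a strong deformation retraction of $\mathbf{A}^{1,\mathrm{hyb}}_k$ onto $\mathbf{A}^{1,\mathrm{triv}}_k$; in particular, $\mathbf{A}^{1,\mathrm{hyb}}_k$ is contractible. (2) If $k$ is uncountable and not included in $\mathbf{R}$, then $\mathbf{A}^{1,\mathrm{hyb}}_k$ is not contractible.
   Context: $|\cdot|_\infty$ is the restriction to $k$ of the usual absolute value on $\mathbf{C}$, and $|\cdot|_0$ is the trivial norm ($|0|_0=0$, $|a|_0=1$ for $a\neq 0$). The hybrid norm on $k$ is $\|a\|_{\mathrm{hyb}}=\max\{|a|_\infty,|a|_0\}$. A multiplicative seminorm on a ring $B$ is a map $|\cdot|\colon B\to\mathbf{R}_{\ge 0}$ with $|0|=0$, $|1|=1$, $|fg|=|f||g|$, $|f+g|\le |f|+|g|$. The space $\mathbf{A}^{1,\mathrm{hyb}}_k$ is the set of multiplicative seminorms $x$ on $k[T]$ (write $|f(x)|$ for the value of $x$ at $f$) such that $|a(x)|\le \|a\|_{\mathrm{hyb}}$ for all $a\in k$, with the coarsest topology making $x\mapsto |f(x)|$ continuous for every $f\in k[T]$. The restriction of such a seminorm to $k$ is of the form $|\cdot|_\infty^\rho$ for a unique $\rho\in[0,1]$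 (with $|\cdot|_\infty^0$ meaning $|\cdot|_0$), and $\lambda\colon \mathbf{A}^{1,\mathrm{hyb}}_k\to[0,1]$ denotes the resulting continuous map $x\mapsto\rho$. Put $\mathbf{A}^{1,\mathrm{triv}}_k=\lambda^{-1}(0)$. A strong deformation retraction of a topological space $X$ onto a subspace $F$ is a continuous map $H\colon[0,1]\times X\to X$ with $H(0,x)=x$ and $H(1,x)\in F$ for all $x\in X$, and $H(t,y)=y$ for all $y\in F$, $t\in[0,1]$. *)

(* Defs.v *)
From HB Require Import structures.
From mathcomp Require Import all_boot all_order all_algebra.
From mathcomp Require Import all_classical all_reals all_analysis.
From mathcomp.real_closed Require Export complex.
From mathcomp Require Import lra.

Set Implicit Arguments.
Unset Strict Implicit.
Unset Printing Implicit Defensive.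

Import Order.TTheory GRing.Theory Num.Theory.
Import numFieldNormedType.Exports.

Local Open Scope classical_set_scope.
Local Open Scope ring_scope.

(* Only the restriction of [H] to [0, 1] x X matters. *)
Definition strong_deformation_retraction (R : realType) (X : topologicalType)
    (F : set X) (H : R * X -> X) : Prop :=
  [/\ {within `[0, 1]%classic `*` [set: X], continuous H},
      forall x, H (0, x) = x,
      forall x, F (H (1, x)) &
      forall t y, 0 <= t <= 1 -> F y -> H (t, y) = y].

Definition contractible (R : realType) (X : topologicalType) : Prop :=
  exists (x0 : X) (H : R * X -> X),
    [/\ {within `[0, 1]%classic `*` [set: X], continuous H},
        forall x, H (0, x) = x &
        forall x, H (1, x) = x0].

Record multiplicative_seminorm (R : realType) (B : nzRingType) (p : B -> R) :
    Prop := MultiplicativeSeminorm {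
  mseminorm_ge0 : forall f, 0 <= p f ;
  mseminorm0 : p 0 = 0 ;
  mseminorm1 : p 1 = 1 ;
  mseminormM : forall f g, p (f * g) = p f * p g ;
  mseminormD : forall f g, p (f + g) <= p f + p g }.

(* If [n <= max (N, 1)] away from 0, multiplicativity makes [n a] monotone in
   [N a]; comparing [a ^+ m] with powers of 2 then gives [n = N `^ rho] with
   [rho = ln (n 2) / ln 2]. *)
Section MonotoneNorm.
Variables (R : realType) (F : fieldType) (n N : F -> R).
Hypotheses (n_ge0 : forall a, 0 <= n a) (n1 : n 1 = 1).
Hypothesis nM : forall a b, n (a * b) = n a * n b.
Hypotheses (N_ge0 : forall a, 0 <= N a) (N1 : N 1 = 1).
Hypothesis NM : forall a b, N (a * b) = N a * N b.
Hypotheses (two_neq0 : 2%:R != 0 :> F) (N2 : N 2%:R = 2%:R).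
Hypothesis n_le : forall a, n a <= Num.max (N a) (a != 0)%:R.

Let nX a m : n (a ^+ m) = n a ^+ m.
Proof. by elim: m => [|m IH]; rewrite ?expr0 ?n1// !exprS nM IH. Qed.

Let n_gt0 a : a != 0 -> 0 < n a.
Proof.
move=> a0; rewrite lt_neqAle n_ge0 andbT.
apply/eqP => na; have := n1; rewrite -(divff a0) nM -na mul0r => /eqP.
by rewrite eq_sym oner_eq0.
Qed.

Let NX a m : N (a ^+ m) = N a ^+ m.
Proof. by elim: m => [|m IH]; rewrite ?expr0 ?N1// !exprS NM IH. Qed.

Let N_gt0 a : a != 0 -> 0 < N a.
Proof.
move=> a0; rewrite lt_neqAle N_ge0 andbT.
apply/eqP => na; have := N1; rewrite -(divff a0) NM -na mul0r => /eqP.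
by rewrite eq_sym oner_eq0.
Qed.

Let n_le1 a : N a <= 1 -> n a <= 1.
Proof.
move=> a1; by apply: le_trans (n_le a) _; rewrite ge_max a1 lern1 leq_b1.
Qed.

Let n_mono a b : b != 0 -> N a <= N b -> n a <= n b.
Proof.
move=> b0 ab; rewrite -(divfK b0 a) nM ler_piMl ?(ltW (n_gt0 b0))//.
apply: n_le1; rewrite -(ler_pM2r (N_gt0 b0)) -NM divfK// mul1r.
exact: ab.
Qed.

Local Notation rho := (ln (n 2%:R) / ln 2%:R).

Let ln2_gt0 : 0 < ln (2%:R : R).
Proof. by rewrite ln_gt0 ?ltr1n. Qed.

Let rhoE : rho * ln 2%:R = ln (n 2%:R).
Proof. by rewrite divfK// lt0r_neq0. Qed.

Lemma monotone_norm_exponent01 : 0 <= rho <= 1.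
Proof.
have h1 : 1 <= n 2%:R by rewrite -n1 n_mono// N1 N2 ler1n.
have h2 : n 2%:R <= 2%:R.
  by apply: le_trans (n_le _) _; rewrite ge_max N2 lexx ler_nat (leq_trans (leq_b1 _)).
rewrite divr_ge0 ?(ltW ln2_gt0) ?ln_ge0//=.
rewrite ler_pdivrMr// mul1r ler_ln ?posrE ?n_gt0//.
Qed.

Let ln_n_ge1 a : 1 <= N a -> ln (n a) = rho * ln (N a).
Proof.
move=> a1.
have a0 : a != 0.
  apply: contraTneq a1 => ->; suff -> : N 0 = 0 by rewrite -ltNge ltr01.
  have := NM 0 2%:R; rewrite mul0r N2; lra.
suff bnd m : m%:R * `|ln (n a) - rho * ln (N a)| <= ln (n 2%:R).
  apply/eqP; rewrite -subr_eq0 -normr_le0; case: leP => // d0.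
  have l0 : 0 <= ln (n 2%:R).
    by rewrite (le_trans _ (bnd 1%N))// mul1r normr_ge0.
  have := archi_boundP (divr_ge0 l0 (ltW d0)); rewrite ltr_pdivrMr//.
  by rewrite ltNge bnd.
have Na0 := N_gt0 a0.
pose q := m%:R * ln (N a) / ln 2%:R.
have q0 : 0 <= q by rewrite divr_ge0 ?(ltW ln2_gt0)// mulr_ge0// ln_ge0.
have /andP[] := truncn_itv q0; set j := Num.truncn q => jq qj.
have {}jq : j%:R * ln 2%:R <= m%:R * ln (N a) by rewrite -ler_pdivlMr.
have {}qj : m%:R * ln (N a) <= j.+1%:R * ln 2%:R by rewrite -ler_pdivrMr// ltW.
have X0 b i : b != 0 :> F -> b ^+ i != 0 by move=> b0; rewrite expf_neq0.
have lnNX b i : b != 0 -> ln (N (b ^+ i)) = i%:R * ln (N b).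
  by move=> b0; rewrite NX lnXn ?N_gt0// mulr_natl.
have lnnX b i : b != 0 -> ln (n (b ^+ i)) = i%:R * ln (n b).
  by move=> b0; rewrite nX lnXn ?n_gt0// mulr_natl.
have mono b c : b != 0 -> c != 0 -> ln (N b) <= ln (N c) -> ln (n b) <= ln (n c).
  move=> b0 c0; rewrite !ler_ln ?posrE ?N_gt0 ?n_gt0//.
  exact: n_mono.
have lo : j%:R * ln (n 2%:R) <= m%:R * ln (n a).
  by rewrite -!lnnX// mono ?X0// !lnNX// N2.
have hi : m%:R * ln (n a) <= j.+1%:R * ln (n 2%:R).
  by rewrite -!lnnX// mono ?X0// !lnNX// N2.
have /andP[r0 _] := monotone_norm_exponent01.
have lo' := ler_wpM2l r0 jq; have hi' := ler_wpM2l r0 qj.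
have arith (J M t L f g : R) : J * (t * L) <= M * f -> M * f <= (J + 1) * (t * L) ->
    t * (J * L) <= t * (M * g) -> t * (M * g) <= t * ((J + 1) * L) ->
    - (t * L) <= M * (f - t * g) <= t * L.
  by move=> *; apply/andP; split; lra.
rewrite -{1}[m%:R]ger0_norm// -normrM ler_norml.
have := arith j%:R m%:R rho (ln 2%:R) (ln (n a)) (ln (N a)).
by rewrite natr1 rhoE; apply.
Qed.

Lemma ln_monotone_norm a : a != 0 -> ln (n a) = rho * ln (N a).
Proof.
move=> a0; have [/ln_n_ge1//|a1] := leP 1 (N a).
have V0 : a^-1 != 0 by rewrite invr_eq0.
have NV : N a^-1 = (N a)^-1.
  by apply: (mulfI (lt0r_neq0 (N_gt0 a0))); rewrite -NM !divff ?N1 ?lt0r_neq0 ?N_gt0.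
have nV : n a^-1 = (n a)^-1.
  by apply: (mulfI (lt0r_neq0 (n_gt0 a0))); rewrite -nM !divff ?n1 ?lt0r_neq0 ?n_gt0.
have := @ln_n_ge1 a^-1; rewrite NV nV !lnV ?posrE ?N_gt0 ?n_gt0//.
by rewrite invf_ge1 ?N_gt0// mulrN => /(_ (ltW a1)) /oppr_inj.
Qed.

End MonotoneNorm.

(* The subfield of the complex numbers is a predicate [K] on [R[i]] together
   with its field structure [k]; [val] is the inclusion of [k] in [R[i]].
   [Normc.normc] is the [R]-valued modulus, [`|z|] being [R[i]]-valued. *)
Section HybridLine.
Variables (R : realType) (K : pred R[i]) (k : subFieldType K).

Definition norm_infty (a : k) : R := ComplexField.Normc.normc (val a).

Definition norm_triv (a : k) : R := (a != 0)%:R.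

Definition norm_hyb (a : k) : R := Num.max (norm_infty a) (norm_triv a).

(* The case split is needed because [0 `^ 0 = 1]. *)
Definition norm_infty_pow (rho : R) (a : k) : R :=
  if rho == 0 then norm_triv a else norm_infty a `^ rho.

Record A1hyb := A1Hyb {
  seminorm_at :> {poly k} -> R ;
  seminorm_atP : multiplicative_seminorm seminorm_at ;
  seminorm_at_le : forall a : k, seminorm_at a%:P <= norm_hyb a }.

HB.instance Definition _ := gen_eqMixin A1hyb.
HB.instance Definition _ := gen_choiceMixin A1hyb.

HB.instance Definition _ := Topological.copy A1hyb
  (sup_topology (fun f : {poly k} =>
     Topological.class (initial_topology (fun x : A1hyb => x f)))).

Lemma norm_infty0 : norm_infty 0 = 0.
Proof. by rewrite /norm_infty rmorph0 ComplexField.Normc.normc0. Qed.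

Lemma norm_infty1 : norm_infty 1 = 1.
Proof. by rewrite /norm_infty rmorph1 ComplexField.Normc.normc1. Qed.

Lemma norm_inftyM a b : norm_infty (a * b) = norm_infty a * norm_infty b.
Proof. by rewrite /norm_infty rmorphM ComplexField.Normc.normcM. Qed.

Lemma norm_infty_ge0 a : 0 <= norm_infty a.
Proof. by rewrite /norm_infty; case: (val a) => u v; apply: sqrtr_ge0. Qed.

Lemma norm_infty2 : norm_infty 2%:R = 2%:R.
Proof.
rewrite /norm_infty rmorph_nat.
have -> : (2%:R : R[i]) = Complex 2%:R 0.
  by apply/eqP; rewrite eq_complex /= !addr0 mulr2n !eqxx.
by rewrite /= expr0n addr0 sqrtr_sqr ger0_norm.
Qed.

Lemma subC_two_neq0 : (2%:R : k) != 0.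
Proof.
apply/eqP => /(congr1 norm_infty); rewrite norm_infty2 norm_infty0 => /eqP.
by rewrite pnatr_eq0.
Qed.

Lemma norm_infty_gt0 a : a != 0 -> 0 < norm_infty a.
Proof.
move=> a0; rewrite lt_neqAle norm_infty_ge0 andbT.
apply/eqP => na; have := norm_infty1; rewrite -(divff a0) norm_inftyM -na.
by rewrite mul0r => /eqP; rewrite eq_sym oner_eq0.
Qed.

Section Restriction.
Variable x : A1hyb.

Let n1 : x 1%:P = 1.
Proof. by rewrite polyC1 (mseminorm1 (seminorm_atP x)). Qed.

Let nM a b : x (a * b)%:P = x a%:P * x b%:P.
Proof. by rewrite polyCM (mseminormM (seminorm_atP x)). Qed.

Let n_gt0 a : a != 0 -> 0 < x a%:P.
Proof.
move=> a0; rewrite lt_neqAle (mseminorm_ge0 (seminorm_atP x)) andbT.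
apply/eqP => na; have := n1; rewrite -(divff a0) nM -na mul0r => /eqP.
by rewrite eq_sym oner_eq0.
Qed.

Lemma restriction_exists :
  exists r, 0 <= r <= 1 /\ forall a : k, x a%:P = norm_infty_pow r a.
Proof.
have n_ge0 a : 0 <= x a%:P by exact: mseminorm_ge0 (seminorm_atP x) _.
exists (ln (x 2%:R%:P) / ln 2%:R); split=> [|a].
  exact: (monotone_norm_exponent01 n_ge0 n1 nM norm_infty_ge0 norm_infty1
    norm_inftyM subC_two_neq0 norm_infty2 (seminorm_at_le x)).
rewrite /norm_infty_pow /norm_triv.
have [->|a0] := eqVneq a 0.
  rewrite polyC0 (mseminorm0 (seminorm_atP x)) norm_infty0.
  by case: ifPn => // r0; rewrite powR0.
have := ln_monotone_norm n_ge0 n1 nM norm_infty_ge0 norm_infty1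
  norm_inftyM subC_two_neq0 norm_infty2 (seminorm_at_le x) a0.
case: ifPn => [/eqP ->|r0] /(congr1 (@expR R)).
  by rewrite mul0r expR0 lnK// posrE n_gt0.
by rewrite lnK ?posrE ?n_gt0// /powR (negbTE (lt0r_neq0 (norm_infty_gt0 a0))).
Qed.

Lemma restriction_unique (r s : R) :
  (forall a : k, x a%:P = norm_infty_pow r a) ->
  (forall a : k, x a%:P = norm_infty_pow s a) -> r = s.
Proof.
have pow2 t : norm_infty_pow t (2%:R : k) = 2%:R `^ t.
  rewrite /norm_infty_pow norm_infty2 /norm_triv subC_two_neq0.
  by case: eqP => // ->; rewrite powRr0.
move=> /(_ 2%:R) hr /(_ 2%:R); rewrite hr !pow2 => /(congr1 (@ln R)).
rewrite !ln_powR => /mulIf; apply; rewrite lt0r_neq0// ln_gt0// ltr1n//.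
Qed.

End Restriction.

Definition lambda (x : A1hyb) : R := sval (cid (restriction_exists x)).

Definition A1triv : set A1hyb := [set x | lambda x = 0].

End HybridLine.

Arguments A1triv {R K} k.

(* Main.v *)
Require Import Defs.
From mathcomp Require Import all_boot all_order all_algebra.
From mathcomp Require Import all_classical all_reals all_analysis.
From mathcomp Require Import ring lra.

(** The points of the hybrid line over [lambda x > 0] are known explicitly: by an
    Ostrowski-type argument ([classification]) they are the seminorms
    [f |-> |f(z)|^r] with [r = lambda x] and [z] a complex number, unique up to
    conjugation when [k] is real. For this, [x] is extended to polynomials whose
    coefficients lie in the closure of [k]. Among the real quadratics with roots
    [z] and its conjugate, one on which the extension is smallest has value 0:
    otherwise the minimum would be attained for [z] of arbitrarily large modulus
    ([quad_min_pos_false]).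

    Let [k] be countable. Sending [r] to 0 with [z] fixed would have a
    limit where every polynomial that does not vanish at [z] has value 1, even for
    starting points close to other points of the fibre; so [z] has to move in such
    a way that [|z - al|^r] hardly changes, for every [al] algebraic over [k]. For
    finitely many [al] this is achieved near 0 by a radial expansion or
    contraction around each [al] and around infinity ([radial]), which conserves a
    power of a truncated distance exactly ([gauge_radial]) and the distance up to a constant
    factor, itself raised to the power [r] and thus harmless when [r] is small. One
    more finite set of points is taken into account each time [r] crosses a
    threshold of a rapidly decreasing sequence. Each polynomial is then evaluated
    up to a factor that tends to 1 ([flow_value_close]); the limits exist, and
    depend continuously on all parameters because the estimates are uniform
    ([flow_value_uniform], [continuous_retraction]). The non-Archimedean fibre is
    contracted by enlarging discs, that is, by Gauss norms of Taylor expansions,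
    until they contain the origin ([retract_contractible]).

    Now let [k] be uncountable with a nonreal element, so that the complex
    number [arch_coord x] under an Archimedean point [x] is well defined. The
    non-Archimedean fibre has a branch for every [a] in [k]. The orbits of the
    Archimedean points under a contraction form a continuous image of a space with
    a countable base, and the branches are disjoint open subsets of the fibre, so
    the orbits avoid the branch of some [a] ([avoided_branch]). Around that branch
    lies a sphere, made of a disc around [a] at a small level that is closed up
    along a tube whose loops shrink onto the branch and end at its root, the Gauss
    point ([shell]). During the contraction its points can come close to [a] only
    through Archimedean points, where the loops around the branch have a winding
    number about [a]. Cutting these winding numbers off at the two ends gives the
    sphere a degree, which is locally constant in time ([meridian_invariant]); it
    is 1 for the identity and 0 for a constant map. *)

Set Implicit Arguments.
Unset Strict Implicit.
Unset Printing Implicit Defensive.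

Import Order.TTheory GRing.Theory Num.Theory.
Import numFieldNormedType.Exports.

Local Open Scope classical_set_scope.
Local Open Scope ring_scope.

Local Notation normc := ComplexField.Normc.normc.
Local Notation normc0 := ComplexField.Normc.normc0.
Local Notation normc1 := ComplexField.Normc.normc1.
Local Notation normcM := ComplexField.Normc.normcM.
Local Notation Re := complex.Re.
Local Notation Im := complex.Im.

(** * Continuity of complex-valued functions and of real powers *)

Section Modulus.
Variable R : realType.
Implicit Types z w : R[i].

Lemma normcE2 z : normc z = Num.sqrt (Re z ^+ 2 + Im z ^+ 2).
Proof. by case: z. Qed.

Lemma normc_ge0 z : 0 <= normc z.
Proof. by rewrite normcE2 sqrtr_ge0. Qed.

Lemma normc_gt0 z : (0 < normc z) = (z != 0).
Proof.
rewrite lt_def normc_ge0 andbT; congr negb; apply/eqP/eqP => [|->].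
  exact: ComplexField.Normc.eq0_normc.
exact: normc0.
Qed.

Lemma normc_sqr z : normc z ^+ 2 = Re z ^+ 2 + Im z ^+ 2.
Proof. by rewrite normcE2 sqr_sqrtr// addr_ge0// sqr_ge0. Qed.

Lemma norm_Re_le z : `|Re z| <= normc z.
Proof. by rewrite normcE2 -sqrtr_sqr ler_wsqrtr// lerDl sqr_ge0. Qed.

Lemma norm_Im_le z : `|Im z| <= normc z.
Proof. by rewrite normcE2 -sqrtr_sqr ler_wsqrtr// lerDr sqr_ge0. Qed.

Lemma normc_add z w : normc (z + w) <= normc z + normc w.
Proof. exact: (@le_normcD R z w). Qed.

Lemma normc_opp z : normc (- z) = normc z.
Proof. exact: (@normcN R z). Qed.

Lemma normc_distC z w : normc (z - w) = normc (w - z).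
Proof. by rewrite -opprB normc_opp. Qed.

Lemma normc_lerB z w : normc z - normc w <= normc (z - w).
Proof. by rewrite lerBlDr -{1}(subrK w z) normc_add. Qed.

Lemma normc_real (a : R) : normc a%:C%C = `|a|.
Proof. by rewrite /= expr0n addr0 sqrtr_sqr. Qed.

Lemma normcX z n : normc (z ^+ n) = normc z ^+ n.
Proof.
elim: n => [|n IH]; first by rewrite !expr0 normc1.
by rewrite !exprS normcM IH.
Qed.

Lemma normcJ z : normc (z^*)%C = normc z.
Proof. by case: z => a b /=; rewrite sqrrN. Qed.

End Modulus.

Section ComplexContinuity.
Variables (R : realType) (T : topologicalType).
Implicit Types (p : T) (f g : T -> R[i]) (u r : T -> R).

Definition continuousC_at p f :=
  {for p, continuous (fun t => Re (f t) : R)} /\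
  {for p, continuous (fun t => Im (f t) : R)}.

Lemma continuous_cst_at p (c : R) : {for p, continuous (fun=> c : R)}.
Proof. by rewrite /prop_for /continuous_at; exact: cvg_cst. Qed.

Lemma continuousC_cst p (c : R[i]) : continuousC_at p (fun=> c).
Proof. by split; exact: continuous_cst_at. Qed.

Lemma continuousC_real p u : {for p, continuous u} ->
  continuousC_at p (fun t => (u t)%:C%C).
Proof. by move=> cu; split => //; exact: continuous_cst_at. Qed.

Lemma continuousC_D p f g : continuousC_at p f -> continuousC_at p g ->
  continuousC_at p (fun t => f t + g t).
Proof.
move=> [fr fi] [gr gi]; split.
  rewrite (_ : (fun _ => _) = (fun t => Re (f t) + Re (g t))).
    exact: continuousD.
  by apply/funext => t; case: (f t) (g t) => ? ? [].
rewrite (_ : (fun _ => _) = (fun t => Im (f t) + Im (g t))).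
  exact: continuousD.
by apply/funext => t; case: (f t) (g t) => ? ? [].
Qed.

Lemma continuousC_N p f : continuousC_at p f ->
  continuousC_at p (fun t => - f t).
Proof.
move=> [fr fi]; split.
  rewrite (_ : (fun _ => _) = (fun t => - Re (f t))); first exact: continuousN.
  by apply/funext => t; case: (f t).
rewrite (_ : (fun _ => _) = (fun t => - Im (f t))); first exact: continuousN.
by apply/funext => t; case: (f t).
Qed.

Lemma continuousC_B p f g : continuousC_at p f -> continuousC_at p g ->
  continuousC_at p (fun t => f t - g t).
Proof. by move=> cf cg; exact/continuousC_D/continuousC_N. Qed.

Lemma continuousC_M p f g : continuousC_at p f -> continuousC_at p g ->
  continuousC_at p (fun t => f t * g t).
Proof.
move=> [fr fi] [gr gi]; split.
  rewrite (_ : (fun _ => _) =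
      (fun t => Re (f t) * Re (g t) - Im (f t) * Im (g t))).
    by apply: continuousB; exact: continuousM.
  by apply/funext => t; case: (f t) (g t) => ? ? [].
rewrite (_ : (fun _ => _) =
    (fun t => Re (f t) * Im (g t) + Im (f t) * Re (g t))).
  by apply: continuousD; exact: continuousM.
by apply/funext => t; case: (f t) (g t) => ? ? [].
Qed.

Lemma continuousC_sum p (I : Type) (s : seq I) (F : I -> T -> R[i]) :
  (forall i, continuousC_at p (F i)) ->
  continuousC_at p (fun t => \sum_(i <- s) F i t).
Proof.
move=> cF; elim: s => [|i s IH].
  rewrite (_ : (fun _ => _) = (fun=> 0)); first exact: continuousC_cst.
  by apply/funext => t; rewrite big_nil.
rewrite (_ : (fun _ => _) = (fun t => F i t + \sum_(j <- s) F j t)).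
  exact: continuousC_D.
by apply/funext => t; rewrite big_cons.
Qed.

Lemma continuousC_horner p f (P : {poly R[i]}) : continuousC_at p f ->
  continuousC_at p (fun t => P.[f t]).
Proof.
move=> cf; elim/poly_ind: P => [|P c IH].
  rewrite (_ : (fun _ => _) = (fun=> 0)); first exact: continuousC_cst.
  by apply/funext => t; rewrite horner0.
rewrite (_ : (fun _ => _) = (fun t => P.[f t] * f t + c)).
  by apply: continuousC_D; [exact: continuousC_M|exact: continuousC_cst].
by apply/funext => t; rewrite hornerMXaddC.
Qed.

Lemma continuous_normc p f : continuousC_at p f ->
  {for p, continuous (fun t => normc (f t) : R)}.
Proof.
move=> [fr fi].
rewrite (_ : (fun _ => _) = (fun t => Num.sqrt (Re (f t) ^+ 2 + Im (f t) ^+ 2))).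
  apply: (@continuous_comp _ _ _ (fun t => Re (f t) ^+ 2 + Im (f t) ^+ 2)
    (@Num.sqrt R)); last exact: sqrt_continuous.
  apply: continuousD.
    apply: (@continuous_comp _ _ _ (fun t => Re (f t)) (fun x : R => x ^+ 2)) => //.
    exact: exprn_continuous.
  apply: (@continuous_comp _ _ _ (fun t => Im (f t)) (fun x : R => x ^+ 2)) => //.
  exact: exprn_continuous.
by apply/funext => t; rewrite normcE2.
Qed.

(** At a point where the base vanishes the exponent is eventually bounded
    below by a positive constant, which squeezes the power. *)
Lemma continuous_powR_at p u r : {for p, continuous u} -> {for p, continuous r} ->
  (forall t, 0 <= u t) -> (0 < u p \/ 0 < r p) ->
  {for p, continuous (fun t => u t `^ r t)}.
Proof.
move=> cu cr u0 h.
have [up0|up0] := eqVneq (u p) 0; last first.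
  have {}up0 : 0 < u p by rewrite lt_def up0 u0.
  have nu : \forall t \near p, 0 < u t.
    by apply: (cvgr_gt (u p) cu).
  rewrite /prop_for /continuous_at.
  have -> : u p `^ r p = expR (r p * ln (u p)).
    by rewrite /powR gt_eqF.
  apply: (@cvg_trans _ ((fun t => expR (r t * ln (u t))) @ p)).
    apply: near_eq_cvg; near=> t.
    by rewrite /powR gt_eqF //; near: t.
  apply: (@continuous_comp _ _ _ (fun t => r t * ln (u t)) (@expR R)).
    apply: continuousM => //.
    apply: (@continuous_comp _ _ _ u (@ln R)) => //.
    exact: continuous_ln.
  exact: continuous_expR.
have rp0 : 0 < r p by case: h => //; rewrite up0 ltxx.
rewrite /prop_for /continuous_at up0 powR0 ?gt_eqF//.
apply/cvgrPdist_lt => e e0.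
pose s := r p / 2.
have s0 : 0 < s by rewrite /s divr_gt0.
pose d := Num.min e 1 `^ s^-1.
have m0 : 0 < Num.min e 1 by rewrite lt_min e0 ltr01.
have d0 : 0 < d by rewrite powR_gt0.
have nr : \forall t \near p, s < r t.
  by apply: (cvgr_gt (r p) cr); rewrite /s; lra.
have nu : \forall t \near p, u t < Num.min d 1.
  by apply: (cvgr_lt (u p) cu); rewrite up0 lt_min d0 ltr01.
near=> t.
have str : s < r t by near: t.
have /andP[utd ut1] : (u t < d) && (u t < 1) by rewrite -lt_min; near: t.
rewrite sub0r normrN ger0_norm ?powR_ge0//.
have [ut0|ut0] := eqVneq (u t) 0.
  by rewrite ut0 powR0// gt_eqF// (lt_trans s0).
have {}ut0 : 0 < u t by rewrite lt_def ut0 u0.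
apply: (@le_lt_trans _ _ (u t `^ s)).
  by apply: ger_powR; [rewrite ut0 ltW|exact: ltW].
apply: (@lt_le_trans _ _ (d `^ s)).
  by apply: gt0_ltr_powR => //; rewrite nnegrE ltW.
rewrite /d -powRrM mulVf ?gt_eqF// powRr1; last exact: ltW.
by rewrite ge_min lexx.
Unshelve. all: by end_near. Qed.

End ComplexContinuity.

Lemma continuous_fst_at (T U V : topologicalType) (p : T) (f : T -> U * V) :
  {for p, continuous f} -> {for p, continuous (fun v => (f v).1)}.
Proof. move=> cf; exact: (cvg_comp _ _ cf cvg_fst). Qed.

Lemma continuous_snd_at (T U V : topologicalType) (p : T) (f : T -> U * V) :
  {for p, continuous f} -> {for p, continuous (fun v => (f v).2)}.
Proof. move=> cf; exact: (cvg_comp _ _ cf cvg_snd). Qed.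

Lemma continuous_pairl (T U : topologicalType) (t : T) : continuous (fun u : U => (t, u)).
Proof. by move=> u; apply: cvg_pair; [exact: cvg_cst|exact: cvg_id]. Qed.

Lemma continuous_pairr (T U : topologicalType) (u : U) : continuous (fun t : T => (t, u)).
Proof. by move=> t; apply: cvg_pair; [exact: cvg_id|exact: cvg_cst]. Qed.

Section PowR.
Variable R : realType.
Implicit Types a b r : R.

Lemma exprn_powR a n r : 0 <= a -> (a ^+ n) `^ r = (a `^ r) ^+ n.
Proof.
by move=> a0; rewrite -[in RHS]powR_mulrn ?powR_ge0// powRAC powR_mulrn.
Qed.

Lemma powR_subadd a b r : 0 <= a -> 0 <= b -> 0 < r <= 1 ->
  (a + b) `^ r <= a `^ r + b `^ r.
Proof.
move=> a0 b0 /andP[r0 r1].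
have [->|an0] := eqVneq a 0; first by rewrite add0r powR0 ?gt_eqF// add0r.
have [->|bn0] := eqVneq b 0; first by rewrite addr0 powR0 ?gt_eqF// addr0.
have {}a0 : 0 < a by rewrite lt_def an0.
have {}b0 : 0 < b by rewrite lt_def bn0.
have s0 : 0 < a + b by rewrite addr_gt0.
have split1 x : 0 < x -> x <= a + b -> x / (a + b) * (a + b) `^ r <= x `^ r.
  move=> x0 xs.
  have -> : x `^ r = (x / (a + b)) `^ r * (a + b) `^ r.
    by rewrite -powRM ?divfK ?gt_eqF// ?divr_ge0 ?ltW.
  rewrite ler_wpM2r ?powR_ge0// ger1_powR// divr_gt0//=.
  by rewrite ler_pdivrMr// mul1r.
have -> : (a + b) `^ r = a / (a + b) * (a + b) `^ r + b / (a + b) * (a + b) `^ r.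
  by rewrite -!mulrDl divff ?mul1r// gt_eqF.
by apply: lerD; apply: split1 => //; rewrite (lerDl, lerDr) ltW.
Qed.

End PowR.

(** * The hybrid line: topology, limits and Archimedean points *)

Section HybridLineBasics.
Variables (R : realType) (K : pred R[i]) (k : subFieldType K).
Local Notation X := (A1hyb k).
Implicit Types (x y : X) (f g : {poly k}).

Lemma A1hyb_eq x y : (forall f, x f = y f) -> x = y.
Proof.
case: x y => [p hp lp] [q hq lq] /= /funext pq; subst q.
by congr A1Hyb; exact: Prop_irrelevance.
Qed.

Lemma continuous_eval f : continuous (fun x : X => x f).
Proof.
move=> x.
have /cvg_sup/(_ f) h : nbhs x --> x by exact: cvg_id.
move=> A Axf; apply: h.
exact: (@initial_continuous X R (fun y => y f) x A Axf).
Qed.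

Lemma A1hyb_continuous_at (T : topologicalType) (p : T) (g : T -> X) :
  (forall f, {for p, continuous (fun t => g t f : R)}) ->
  {for p, continuous g}.
Proof.
move=> cg; apply/cvg_sup => f.
move=> A [B [[C oC <-] Cx CA]].
have := cg f C; rewrite /= => h.
have Cn : nbhs (g p f : R) C by apply: open_nbhs_nbhs; split.
by apply: (@filterS _ _ _ [set t | C (g t f)]) (h Cn) => t Ct; exact: CA.
Qed.

(** All the conditions on a point are closed, so they pass to pointwise
    limits. *)
Lemma A1hyb_limit (u : nat -> X) (v : {poly k} -> R) :
  (forall f, (u n f : R) @[n --> \oo] --> v f) ->
  exists x : X, forall f, x f = v f.
Proof.
move=> uv.
have cst c : (fun=> c : R) @ \oo --> c by exact: cvg_cst.
have lim_eq f (c : R) : (forall n, u n f = c) -> v f = c.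
  move=> h; apply: (@cvg_unique _ (@norm_hausdorff _ _) _ _ _ _ (uv f)).
  by rewrite (_ : (fun n => u n f) = fun=> c); [exact: cst|exact/funext].
have ms : multiplicative_seminorm v.
  split.
  - move=> f; apply: (cvgr_to_ge (uv f)); apply: nearW => n.
    exact: mseminorm_ge0 (seminorm_atP (u n)) _.
  - by apply: lim_eq => n; exact: mseminorm0 (seminorm_atP (u n)).
  - by apply: lim_eq => n; exact: mseminorm1 (seminorm_atP (u n)).
  - move=> f g; apply: (@cvg_unique _ (@norm_hausdorff _ _) _ _ _ _ (uv (f * g))).
    rewrite (_ : (fun n => u n (f * g)) = (fun n => u n f * u n g)).
      exact: (cvgM (uv f) (uv g)).
    by apply/funext => n; exact: mseminormM (seminorm_atP (u n)) _ _.
  - move=> f g; apply: (ler_cvg_to (uv (f + g)) (cvgD (uv f) (uv g))).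
    by apply: nearW => n; exact: mseminormD (seminorm_atP (u n)) _ _.
have le a : v a%:P <= norm_hyb a.
  by apply: (cvgr_to_le (uv a%:P)); apply: nearW => n; exact: seminorm_at_le.
by exists (A1Hyb ms le).
Qed.

Lemma seminorm_ge0 x f : 0 <= x f.
Proof. exact: mseminorm_ge0 (seminorm_atP x) _. Qed.

Lemma seminorm0 x : x 0 = 0.
Proof. exact: mseminorm0 (seminorm_atP x). Qed.

Lemma seminorm1 x : x 1 = 1.
Proof. exact: mseminorm1 (seminorm_atP x). Qed.

Lemma seminormM x f g : x (f * g) = x f * x g.
Proof. exact: mseminormM (seminorm_atP x) _ _. Qed.

Lemma seminormD x f g : x (f + g) <= x f + x g.
Proof. exact: mseminormD (seminorm_atP x) _ _. Qed.

Lemma seminormX x f n : x (f ^+ n) = x f ^+ n.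
Proof.
elim: n => [|n IH]; first by rewrite !expr0 seminorm1.
by rewrite !exprS seminormM IH.
Qed.

Lemma lambdaE x a : x a%:P = norm_infty_pow (lambda x) a.
Proof. by rewrite /lambda; case: cid => r [? h] /=; exact: h. Qed.

Lemma lambda_ge0 x : 0 <= lambda x.
Proof. by rewrite /lambda; case: cid => r h /=; case: h => /andP[]. Qed.

Lemma lambda_le1 x : lambda x <= 1.
Proof. by rewrite /lambda; case: cid => r h /=; case: h => /andP[]. Qed.

Lemma lambda_unique x r : (forall a, x a%:P = norm_infty_pow r a) ->
  lambda x = r.
Proof. by move=> h; apply: (@restriction_unique _ _ _ x) => // a; exact: lambdaE. Qed.

Lemma norm_infty_pow_pos r (a : k) : r != 0 ->
  norm_infty_pow r a = norm_infty a `^ r.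
Proof. by rewrite /norm_infty_pow => /negbTE ->. Qed.

(** The value at the constant 2 determines [lambda], which makes it
    continuous. *)
Lemma lambda_ln x : lambda x = ln (x 2%:R%:P) / ln 2%:R.
Proof.
rewrite lambdaE /norm_infty_pow norm_infty2 /norm_triv subC_two_neq0.
have l2 : ln (2%:R : R) != 0 by rewrite gt_eqF// ln_gt0// ltr1n.
case: eqP => [->|_]; first by rewrite ln1 mul0r.
by rewrite ln_powR mulfK.
Qed.

Lemma continuous_lambda : continuous (@lambda R K k : X -> R).
Proof.
move=> x.
rewrite (_ : @lambda R K k = fun y : X => ln (y 2%:R%:P) * (ln 2%:R)^-1).
  apply: (@continuousM _ _ (fun y : X => ln (y 2%:R%:P)) (fun=> (ln 2%:R)^-1)).
    apply: (@continuous_comp _ _ _ (fun y : X => y 2%:R%:P) (@ln R)).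
      exact: continuous_eval.
    apply: continuous_ln.
    have := lambdaE x 2%:R; rewrite /norm_infty_pow norm_infty2 /norm_triv.
    by rewrite subC_two_neq0 => ->; case: eqP => // _; rewrite powR_gt0.
  exact: continuous_cst_at.
by apply/funext => y; rewrite lambda_ln.
Qed.

Definition polyC_of f : {poly R[i]} := map_poly (val : k -> R[i]) f.

Definition arch_value (r : R) (z : R[i]) f : R := normc (polyC_of f).[z] `^ r.

Lemma arch_value_mseminorm r z : 0 < r <= 1 ->
  multiplicative_seminorm (arch_value r z).
Proof.
move=> r01; have /andP[r0 r1] := r01; have rn0 := lt0r_neq0 r0.
split; rewrite /arch_value /polyC_of.
- by move=> f; exact: powR_ge0.
- by rewrite rmorph0 horner0 normc0 powR0.
- by rewrite rmorph1 hornerC normc1 powR1.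
- move=> f g; rewrite rmorphM hornerM normcM powRM//;
  exact: normc_ge0.
- move=> f g; rewrite rmorphD hornerD.
  apply: le_trans (powR_subadd _ _ r01); last 2 first.
  + exact: normc_ge0.
  + exact: normc_ge0.
  apply: ge0_ler_powR; rewrite ?nnegrE ?addr_ge0 ?normc_ge0//; first exact: ltW.
  exact: normc_add.
Qed.

Lemma arch_valueC r z a : arch_value r z a%:P = norm_infty a `^ r.
Proof. by rewrite /arch_value /polyC_of map_polyC hornerC. Qed.

Lemma arch_value_le r z a : 0 < r <= 1 -> arch_value r z a%:P <= norm_hyb a.
Proof.
move=> /andP[r0 r1]; rewrite arch_valueC /norm_hyb /norm_triv.
have [->|a0] := eqVneq a 0.
  by rewrite norm_infty0 powR0 ?gt_eqF// le_max lexx.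
rewrite le_max; have [a1|a1] := leP 1 (norm_infty a).
  by rewrite ler1_powR.
apply/orP; right; rewrite -(powRr0 (norm_infty a)).
apply: ger_powR; last exact: ltW.
by rewrite norm_infty_gt0//= ltW.
Qed.

Lemma arch_exists r z : exists x : X, 0 < r <= 1 -> forall f, x f = arch_value r z f.
Proof.
have [r01|nr] := boolP (0 < r <= 1); last first.
  have h : 0 < (1 : R) <= 1 by rewrite ltr01 lexx.
  by exists (A1Hyb (arch_value_mseminorm 0 h) (fun a => arch_value_le 0 a h)).
by exists (A1Hyb (arch_value_mseminorm z r01) (fun a => arch_value_le z a r01)).
Qed.

(** The point [f |-> |f(z)|^r], with an irrelevant value for [r] outside
    of ]0, 1]. *)
Definition arch_point r z : X := sval (cid (arch_exists r z)).

Lemma arch_pointE r z f : 0 < r <= 1 -> arch_point r z f = arch_value r z f.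
Proof. by move=> r01; rewrite /arch_point; case: cid => x /= /(_ r01). Qed.

Lemma lambda_arch_point r z : 0 < r <= 1 -> lambda (arch_point r z) = r.
Proof.
move=> r01; apply: lambda_unique => a; rewrite arch_pointE// arch_valueC.
by rewrite norm_infty_pow_pos// gt_eqF//; case/andP: r01.
Qed.

Lemma continuous_arch_value (T : topologicalType) (p : T) (r : T -> R)
    (z : T -> R[i]) f :
  {for p, continuous r} -> continuousC_at p z ->
  (0 < r p \/ (polyC_of f).[z p] != 0) ->
  {for p, continuous (fun t => arch_value (r t) (z t) f : R)}.
Proof.
move=> cr cz h; apply: continuous_powR_at => //.
- by apply: continuous_normc; exact: continuousC_horner.
- by move=> t; exact: normc_ge0.
- case: h => [|h]; [by right|left].
  rewrite lt_def normc_ge0 andbT; apply: contra h => /eqP h.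
  by rewrite (ComplexField.Normc.eq0_normc h).
Qed.

Lemma continuous_arch_point (T : topologicalType) (p : T) (r : T -> R)
    (z : T -> R[i]) :
  {for p, continuous r} -> continuousC_at p z -> (forall t, 0 < r t <= 1) ->
  {for p, continuous (fun t => arch_point (r t) (z t))}.
Proof.
move=> cr cz r01; apply: A1hyb_continuous_at => f.
rewrite (_ : (fun _ => _) = fun t => arch_value (r t) (z t) f).
  by apply: continuous_arch_value => //; left; case/andP: (r01 p).
by apply/funext => t; rewrite arch_pointE.
Qed.

End HybridLineBasics.

(** * Archimedean fibres: extending a seminorm to complex coefficients *)

Section Extension.
Variables (R : realType) (K : pred R[i]) (k : subFieldType K) (x : A1hyb k).
Hypothesis r0 : 0 < lambda x.
Local Notation r := (lambda x).
Local Notation tau := (x 'X).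
Implicit Types (F G : {poly R[i]}) (f g : {poly k}).

Let r01 : 0 < r <= 1.
Proof. by rewrite r0 lambda_le1. Qed.

Let rn0 : r != 0.
Proof. by rewrite gt_eqF. Qed.

Lemma seminormC (a : k) : x a%:P = normc (val a) `^ r.
Proof. by rewrite lambdaE norm_infty_pow_pos. Qed.

(** By the triangle inequality an extension of [x] to complex polynomials is at
    most [coef_norm]. *)
Definition coef_norm F : R := \sum_(i < size F) normc F`_i `^ r * tau ^+ i.

Lemma coef_normE n F : (size F <= n)%N ->
  coef_norm F = \sum_(i < n) normc F`_i `^ r * tau ^+ i.
Proof.
move=> sF; rewrite /coef_norm (big_ord_widen n (fun i => normc F`_i `^ r * tau ^+ i))//.
rewrite big_mkcond; apply: eq_bigr => i _; case: ltnP => // si.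
by rewrite nth_default// normc0 powR0// mul0r.
Qed.

Lemma coef_norm_ge0 F : 0 <= coef_norm F.
Proof.
apply: sumr_ge0 => i _.
by rewrite mulr_ge0 ?powR_ge0// exprn_ge0// seminorm_ge0.
Qed.

Lemma coef_normN F : coef_norm (- F) = coef_norm F.
Proof.
rewrite /coef_norm size_polyN; apply: eq_bigr => i _.
by rewrite coefN normc_opp.
Qed.

Lemma coef_normD F G : coef_norm (F + G) <= coef_norm F + coef_norm G.
Proof.
set n := maxn (size F) (size G).
rewrite (@coef_normE n (F + G)) ?size_polyD// (@coef_normE n F) ?leq_maxl//.
rewrite (@coef_normE n G) ?leq_maxr// -big_split /=; apply: ler_sum => i _.
rewrite -mulrDl ler_wpM2r ?exprn_ge0 ?seminorm_ge0// coefD.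
apply: le_trans (powR_subadd (normc_ge0 _) (normc_ge0 _) r01).
apply: ge0_ler_powR; rewrite ?nnegrE ?addr_ge0 ?normc_ge0//; first exact: ltW.
exact: normc_add.
Qed.

Lemma coef_norm0 : coef_norm 0 = 0.
Proof. by rewrite /coef_norm size_poly0 big_ord0. Qed.

Lemma coef_normC c : coef_norm c%:P = normc c `^ r.
Proof.
by rewrite (@coef_normE 1) ?size_polyC_leq1// big_ord1 coefC /= expr0 mulr1.
Qed.

Lemma coef_normMXaddC F c :
  coef_norm (F * 'X + c%:P) = coef_norm F * tau + normc c `^ r.
Proof.
rewrite (@coef_normE (size F).+1); last first.
  by rewrite size_MXaddC; case: ifP.
rewrite big_ord_recl /= coefD coefMX coefC /= add0r expr0 mulr1 addrC.
congr (_ + _); rewrite /coef_norm mulr_suml; apply: eq_bigr => i _.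
by rewrite coefD coefMX coefC /= addr0 /bump /= add1n exprSr mulrA.
Qed.

Lemma coef_normM F G : coef_norm (F * G) <= coef_norm F * coef_norm G.
Proof.
elim/poly_ind: F => [|F c IH]; first by rewrite mul0r coef_norm0 mul0r.
rewrite mulrDl -mulrA (mulrC 'X) mulrA.
apply: le_trans (coef_normD _ _) _.
have := coef_normMXaddC (F * G) 0.
rewrite addr0 normc0 powR0// addr0 => ->.
rewrite coef_normMXaddC mulrDl lerD//.
  by rewrite mulrAC ler_wpM2r// seminorm_ge0.
rewrite mul_polyC (@coef_normE (size G)) ?size_scale_leq//.
rewrite /coef_norm mulr_sumr; apply: ler_sum => i _.
by rewrite coefZ normcM powRM ?normc_ge0// mulrA.
Qed.

Lemma seminorm_le_coef_norm f : x f <= coef_norm (polyC_of f).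
Proof.
elim/poly_ind: f => [|f c IH]; first by rewrite seminorm0 coef_norm_ge0.
rewrite /polyC_of rmorphD rmorphM /= map_polyX map_polyC /= coef_normMXaddC.
apply: le_trans (seminormD _ _ _) _; rewrite seminormM seminormC lerD//.
by rewrite ler_wpM2r// seminorm_ge0.
Qed.

Definition ext_values F : set R :=
  [set s | exists f, s = x f + coef_norm (polyC_of f - F)].

(** The infimal convolution of [x] and [coef_norm]: it agrees with [x] on
    polynomials over [k] and is 1-Lipschitz for [coef_norm], so it carries the
    values of [x] over to coefficients in the closure of [k]. *)
Definition ext F : R := inf (ext_values F).

Let ext_lb F : has_inf (ext_values F).
Proof.
split; first by exists (x 0 + coef_norm (polyC_of (0 : {poly k}) - F)); exists 0.
exists 0 => _ [f ->]; by rewrite addr_ge0 ?seminorm_ge0 ?coef_norm_ge0.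
Qed.

Lemma ext_le F f : ext F <= x f + coef_norm (polyC_of f - F).
Proof. by apply: ge_inf; [case: (ext_lb F)|exists f]. Qed.

Lemma ext_near F (e : R) : 0 < e ->
  exists f, x f + coef_norm (polyC_of f - F) < ext F + e.
Proof.
move=> e0; have [|_ [f ->] h] := @inf_adherent _ (ext_values F) e e0.
  exact: ext_lb.
by exists f.
Qed.

Lemma ext_ge0 F : 0 <= ext F.
Proof.
apply: lb_le_inf; first by case: (ext_lb F).
by move=> _ [f ->]; rewrite addr_ge0 ?seminorm_ge0 ?coef_norm_ge0.
Qed.

Lemma ext_le_coef_norm F : ext F <= coef_norm F.
Proof.
apply: le_trans (ext_le F 0) _.
by rewrite seminorm0 add0r /polyC_of rmorph0 sub0r coef_normN.
Qed.

Lemma ext_lip F G : ext F <= ext G + coef_norm (F - G).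
Proof.
apply/ler_addgt0Pr => e e0; have [f hf] := ext_near G e0.
apply: le_trans (ext_le F f) _.
have : coef_norm (polyC_of f - F) <=
       coef_norm (polyC_of f - G) + coef_norm (F - G).
  rewrite -(coef_normN (F - G)).
  by apply: le_trans (coef_normD _ _); rewrite opprB addrA subrK.
lra.
Qed.

Lemma ext_of f : ext (polyC_of f) = x f.
Proof.
apply/eqP; rewrite eq_le; apply/andP; split.
  by apply: le_trans (ext_le _ f) _; rewrite subrr coef_norm0 addr0.
apply: lb_le_inf; first by case: (ext_lb (polyC_of f)).
move=> _ [g ->]; rewrite -{1}(subrK g f); apply: le_trans (seminormD _ _ _) _.
rewrite addrC lerD2l; apply: le_trans (seminorm_le_coef_norm _) _.
by rewrite -coef_normN /polyC_of rmorphB opprB.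
Qed.

Lemma ext_add F G : ext (F + G) <= ext F + ext G.
Proof.
apply/ler_addgt0Pr => e e0.
have e2 : 0 < e / 2 by rewrite divr_gt0.
have [f hf] := ext_near F e2; have [g hg] := ext_near G e2.
apply: le_trans (ext_le _ (f + g)) _.
have := seminormD x f g.
have : coef_norm (polyC_of (f + g) - (F + G)) <=
   coef_norm (polyC_of f - F) + coef_norm (polyC_of g - G).
  apply: le_trans (coef_normD _ _).
  by rewrite /polyC_of rmorphD opprD addrACA.
lra.
Qed.

Lemma ext_opp F : ext (- F) = ext F.
Proof.
have half G : ext (- G) <= ext G.
  apply/ler_addgt0Pr => e e0; have [f hf] := ext_near G e0.
  apply: le_trans (ext_le _ (- f)) _.
  have -> : x (- f) = x f.
    rewrite -mulN1r seminormM -polyC1 -polyCN seminormC rmorphN rmorph1.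
    by rewrite normc_opp normc1 powR1 mul1r.
  have -> : polyC_of (- f) - - G = - (polyC_of f - G).
    by rewrite /polyC_of rmorphN opprB opprK addrC.
  by rewrite coef_normN ltW.
by apply/eqP; rewrite eq_le half /= -{1}(opprK F) half.
Qed.

Lemma ext_kill F G : ext (F - G) = 0 -> ext F = ext G.
Proof.
move=> FG; apply/eqP; rewrite eq_le; apply/andP; split.
  by rewrite -{1}(subrK G F); apply: le_trans (ext_add _ _) _; rewrite FG add0r.
rewrite -{1}(subrK F G); apply: le_trans (ext_add _ _) _.
by rewrite -(opprB F) ext_opp FG add0r.
Qed.

(** Polynomials over the topological closure of [k], on which [ext] is
    multiplicative. *)
Definition approximable F : Prop :=
  forall e : R, 0 < e -> exists f, coef_norm (polyC_of f - F) < e.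

Lemma approximable_of f : approximable (polyC_of f).
Proof. by move=> e e0; exists f; rewrite subrr coef_norm0. Qed.

Lemma approximableD F G : approximable F -> approximable G ->
  approximable (F + G).
Proof.
move=> aF aG e e0; have e2 : 0 < e / 2 by rewrite divr_gt0.
have [f hf] := aF _ e2; have [g hg] := aG _ e2.
exists (f + g); rewrite /polyC_of rmorphD opprD addrACA.
apply: le_lt_trans (coef_normD _ _) _; rewrite [ltRHS]splitr.
exact: ltrD.
Qed.

Let mul_close F G f g : coef_norm (polyC_of (f * g) - F * G) <=
  (coef_norm F + coef_norm (polyC_of f - F)) * coef_norm (polyC_of g - G)
  + coef_norm G * coef_norm (polyC_of f - F).
Proof.
have -> : polyC_of (f * g) - F * G =
   (F + (polyC_of f - F)) * (polyC_of g - G) + G * (polyC_of f - F).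
  by rewrite /polyC_of rmorphM /=; ring.
apply: le_trans (coef_normD _ _) _; apply: lerD; last exact: coef_normM.
apply: le_trans (coef_normM _ _) _.
by rewrite ler_wpM2r ?coef_norm_ge0// coef_normD.
Qed.

Lemma approximableM F G : approximable F -> approximable G ->
  approximable (F * G).
Proof.
move=> aF aG e e0.
set M := coef_norm F + coef_norm G + 1.
have M0 : 0 < M by rewrite /M; have := coef_norm_ge0 F; have := coef_norm_ge0 G; lra.
pose d := Num.min 1 (e / (2 * M)).
have d0 : 0 < d by rewrite lt_min ltr01 divr_gt0// mulr_gt0.
have d1 : d <= 1 by rewrite ge_min lexx.
have dM : d * (2 * M) <= e.
  by rewrite -ler_pdivlMr ?mulr_gt0// ge_min lexx orbT.
have [f hf] := aF _ d0; have [g hg] := aG _ d0; exists (f * g).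
apply: le_lt_trans (mul_close F G f g) _.
have := coef_norm_ge0 F; have := coef_norm_ge0 G.
have := coef_norm_ge0 (polyC_of f - F); have := coef_norm_ge0 (polyC_of g - G).
move: hf hg dM d1 d0; rewrite /M.
move: (coef_norm F) (coef_norm G) (coef_norm (_ - F)) (coef_norm (_ - G)) d.
move=> a b u v d ud vd de d1 d0 v0 u0 b0 a0.
have h1 : (a + u) * v <= (a + 1) * d by apply: ler_pM; lra.
have h2 : b * u <= b * d by rewrite ler_wpM2l// ltW.
apply: le_lt_trans (lerD h1 h2) _; apply: lt_le_trans de; nra.
Qed.

(** Both sides are Lipschitz on bounded sets, and they agree over [k]. *)
Lemma ext_mul F G : approximable F -> approximable G ->
  ext (F * G) = ext F * ext G.
Proof.
move=> aF aG; apply/eqP; rewrite -subr_eq0 -normr_le0.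
set M := 2 * (coef_norm F + coef_norm G + 1).
have M0 : 0 < M.
  by rewrite /M; have := coef_norm_ge0 F; have := coef_norm_ge0 G; lra.
apply/ler_addgt0Pr => e e0; rewrite add0r.
pose d := Num.min 1 (e / M).
have d0 : 0 < d by rewrite lt_min ltr01 divr_gt0.
have d1 : d <= 1 by rewrite ge_min lexx.
have dM : d * M <= e by rewrite -ler_pdivlMr// ge_min lexx orbT.
have [f hf] := aF _ d0; have [g hg] := aG _ d0.
have C := mul_close F G f g.
have P1 := ext_lip (F * G) (polyC_of (f * g)).
have P2 := ext_lip (polyC_of (f * g)) (F * G).
rewrite -coef_normN opprB in P1; rewrite !ext_of seminormM in P1 P2.
have F1 := ext_lip F (polyC_of f); have F2 := ext_lip (polyC_of f) F.
rewrite -coef_normN opprB ext_of in F1; rewrite ext_of in F2.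
have G1 := ext_lip G (polyC_of g); have G2 := ext_lip (polyC_of g) G.
rewrite -coef_normN opprB ext_of in G1; rewrite ext_of in G2.
have F3 := ext_le_coef_norm F; have G3 := ext_le_coef_norm G.
have := coef_norm_ge0 F; have := coef_norm_ge0 G.
have := coef_norm_ge0 (polyC_of f - F); have := coef_norm_ge0 (polyC_of g - G).
have := ext_ge0 F; have := ext_ge0 G; have := seminorm_ge0 x f; have := seminorm_ge0 x g.
move: dM d1 d0 hf hg C P1 P2 F1 F2 G1 G2 F3 G3; rewrite /M.
move: (coef_norm (_ - F * G)) (coef_norm F) (coef_norm G) (coef_norm (_ - F)) (coef_norm (_ - G)) d.
move: (ext (F * G)) (ext F) (ext G) (x f) (x g).
move=> p q s xf xg c a b u v d de d1 d0 ud vd C P1 P2 F1 F2 G1 G2 F3 G3 *.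
have h1 : (a + u) * v <= (a + 1) * d by apply: ler_pM; lra.
have h2 : b * u <= b * d by rewrite ler_wpM2l// ltW.
have h3 : xf * xg <= q * s + (a + b + 1) * d by nra.
have h4 : q * s <= xf * xg + (a + b + 1) * d by nra.
rewrite ler_norml; apply/andP; split; nra.
Qed.

Definition adherent (c : R[i]) : Prop :=
  forall e : R, 0 < e -> exists a : k, normc (val a - c) < e.

Let adherent_pow c : adherent c -> forall e : R, 0 < e ->
  exists a : k, coef_norm ((val a)%:P - c%:P) < e.
Proof.
move=> h e e0; have d0 : 0 < e `^ r^-1 by rewrite powR_gt0.
have [a ha] := h _ d0; exists a.
rewrite -polyCB coef_normC -[ltRHS]powRr1 ?(ltW e0)// -(mulVf rn0) powRrM.
by apply: gt0_ltr_powR; rewrite ?nnegrE ?normc_ge0 ?powR_ge0.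
Qed.

Lemma approximableC c : adherent c -> approximable c%:P.
Proof.
move=> /adherent_pow h e /h[a ha]; exists a%:P.
by rewrite /polyC_of map_polyC.
Qed.

Lemma approximable_poly F : (forall i, adherent F`_i) -> approximable F.
Proof.
elim/poly_ind: F => [_|F c IH h].
  by rewrite -[0](rmorph0 (map_poly (val : k -> R[i]))); exact: approximable_of.
apply: approximableD.
  apply: approximableM; last first.
    by rewrite -(map_polyX (val : k -> R[i])); exact: approximable_of.
  apply: IH => i; have := h i.+1.
  by rewrite coefD coefMX coefC /= addr0.
apply: approximableC; have := h 0%N.
by rewrite coefD coefMX coefC /= add0r.
Qed.

Lemma ext_const c : adherent c -> ext c%:P = normc c `^ r.
Proof.
move=> ac; apply/eqP; rewrite eq_le; apply/andP; split.
  by rewrite -coef_normC ext_le_coef_norm.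
apply/ler_addgt0Pr => e e0.
have e2 : 0 < e / 2 by rewrite divr_gt0.
have [a ha] := adherent_pow ac e2; rewrite -coef_normC.
have ea : ext (val a)%:P = coef_norm (val a)%:P.
  by rewrite coef_normC -seminormC -ext_of /polyC_of map_polyC.
have := coef_normD (val a)%:P (c%:P - (val a)%:P); rewrite addrC subrK.
rewrite -(coef_normN (_ - _)) opprB.
have := ext_lip (val a)%:P c%:P; lra.
Qed.

End Extension.

(** * Ostrowski's theorem for Archimedean fibres *)

Section AdherentRing.
Variables (R : realType) (K : pred R[i]) (k : subFieldType K).
Local Notation adherent := (@adherent R K k).

Lemma adherent_val (a : k) : adherent (val a).
Proof.
by move=> e e0; exists a; rewrite subrr normc0.
Qed.

(** [k] contains the rational numbers. *)
Lemma adherent_real (t : R) : adherent t%:C%C.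
Proof.
move=> e e0; have [q /itvP tq] := @rat_in_itvoo R (t - e) (t + e) ltac:(lra).
exists (ratr q); rewrite fmorph_rat.
have -> : (ratr q : R[i]) = (ratr q : R)%:C%C by rewrite fmorph_rat.
rewrite -rmorphB normc_real ltr_norml; apply/andP; split; rewrite ?tq//.
  by rewrite ltrBrDl tq.
by rewrite ltrBlDl tq.
Qed.

Lemma adherentD c d : adherent c -> adherent d -> adherent (c + d).
Proof.
move=> hc hd e e0; have e2 : 0 < e / 2 by rewrite divr_gt0.
have [a ha] := hc _ e2; have [b hb] := hd _ e2.
exists (a + b); rewrite rmorphD opprD addrACA.
apply: le_lt_trans (normc_add _ _) _; rewrite [ltRHS]splitr.
exact: ltrD.
Qed.

Lemma adherentM c d : adherent c -> adherent d -> adherent (c * d).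
Proof.
move=> hc hd e e0.
set M := normc c + normc d + 1.
have M0 : 0 < M by rewrite /M; have := normc_ge0 c; have := normc_ge0 d; lra.
pose t := Num.min 1 (e / (2 * M)).
have t0 : 0 < t by rewrite lt_min ltr01 divr_gt0// mulr_gt0.
have t1 : t <= 1 by rewrite ge_min lexx.
have tM : t * (2 * M) <= e.
  by rewrite -ler_pdivlMr ?mulr_gt0// ge_min lexx orbT.
have [a ha] := hc _ t0; have [b hb] := hd _ t0; exists (a * b).
have -> : val (a * b) - c * d =
   (c + (val a - c)) * (val b - d) + d * (val a - c).
  by rewrite rmorphM /=; ring.
apply: le_lt_trans (normc_add _ _) _; rewrite !normcM.
have := normc_add c (val a - c).
have := normc_ge0 c; have := normc_ge0 d.
have := normc_ge0 (c + (val a - c)); have := normc_ge0 (val a - c).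
have := normc_ge0 (val b - d).
move: tM t1 t0 ha hb; rewrite /M.
move: (normc (c + _)) (normc c) (normc d) (normc (_ - c)) (normc (_ - d)).
move=> s p q u v tM t1 t0 ut vt v0 u0 s0 q0 p0 spu.
have h1 : s * v <= (p + 1) * t by apply: ler_pM; lra.
have h2 : q * u <= q * t by rewrite ler_wpM2l// ltW.
apply: le_lt_trans (lerD h1 h2) _; apply: lt_le_trans tM; nra.
Qed.

End AdherentRing.

Section Ostrowski.
Variables (R : realType) (K : pred R[i]) (k : subFieldType K) (x : A1hyb k).
Hypothesis r0 : 0 < lambda x.
Local Notation r := (lambda x).
Local Notation tau := (x 'X).
Local Notation ext := (ext x).
Local Notation approx := (approximable x).
Implicit Types (F G : {poly R[i]}) (w : R[i]).

Let r1 : r <= 1. Proof. exact: lambda_le1. Qed.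

(** Linear factors need not be approximable when [k] is real; these quadratics
    always are, having real coefficients. *)
Definition conj_quad w : {poly R[i]} := ('X - w%:P) * ('X - (w^*)%C%:P).

Lemma conj_quadE w : conj_quad w =
  'X * 'X + ((- 2 * Re w)%:C%C)%:P * 'X + ((normc w ^+ 2)%:C%C)%:P.
Proof.
have e1 : ((- 2 * Re w)%:C%C) = - (w + (w^*)%C).
  by case: (w) => a b /=; simpc; congr Complex; lra.
have e2 : ((normc w ^+ 2)%:C%C) = w * (w^*)%C.
  rewrite normc_sqr; case: (w) => a b /=; simpc; congr Complex; lra.
rewrite e1 e2 /conj_quad !polyCN polyCD polyCM; ring.
Qed.

Lemma approximable_real (t : R) : approx (t%:C%C)%:P.
Proof. by apply: approximableC => //; exact: adherent_real. Qed.

Lemma approximableX : approx 'X.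
Proof. by rewrite -(map_polyX (val : k -> R[i])); exact: approximable_of. Qed.

Lemma approximable_quad w : approx (conj_quad w).
Proof.
rewrite conj_quadE.
apply: approximableD => //; last exact: approximable_real.
apply: approximableD => //; apply: approximableM => //;
  by [exact: approximableX|exact: approximable_real].
Qed.

Lemma ext_real (t : R) : ext (t%:C%C)%:P = `|t| `^ r.
Proof. by rewrite ext_const// ?normc_real//; exact: adherent_real. Qed.

Lemma ext_X : ext 'X = tau.
Proof. by have := ext_of r0 'X; rewrite /polyC_of map_polyX. Qed.

Lemma ext_1 : ext 1 = 1.
Proof. by have := ext_of r0 1; rewrite /polyC_of rmorph1 seminorm1. Qed.

Lemma approximable1 : approx 1.
Proof. by rewrite -(rmorph1 (map_poly (val : k -> R[i]))); exact: approximable_of. Qed.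

Lemma approximable_prod (I : Type) (s : seq I) (F : I -> {poly R[i]}) :
  (forall i, approx (F i)) -> approx (\prod_(i <- s) F i).
Proof.
move=> aF; elim: s => [|i s IH]; first by rewrite big_nil; exact: approximable1.
by rewrite big_cons; exact: approximableM.
Qed.

Lemma ext_prod (I : Type) (s : seq I) (F : I -> {poly R[i]}) :
  (forall i, approx (F i)) -> ext (\prod_(i <- s) F i) = \prod_(i <- s) ext (F i).
Proof.
move=> aF; elim: s => [|i s IH]; first by rewrite !big_nil ext_1.
by rewrite !big_cons ext_mul ?IH//; exact: approximable_prod.
Qed.

Lemma approximableX_n F n : approx F -> approx (F ^+ n).
Proof.
move=> aF; elim: n => [|n IH]; first by rewrite expr0; exact: approximable1.
by rewrite exprS; exact: approximableM.
Qed.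

Lemma ext_exp F n : approx F -> ext (F ^+ n) = ext F ^+ n.
Proof.
move=> aF; elim: n => [|n IH]; first by rewrite !expr0 ext_1.
by rewrite !exprS ext_mul// ?IH//; exact: approximableX_n.
Qed.

Local Notation g w := (ext (conj_quad w)).

(** Large quadratic factors are dominated by their constant term. *)
Lemma quad_coercive w :
  (normc w `^ r) ^+ 2 <= g w + 2 * normc w `^ r * tau + tau ^+ 2.
Proof.
set s := normc w `^ r.
have e : ((normc w ^+ 2)%:C%C)%:P =
  conj_quad w + ((2 * Re w)%:C%C)%:P * 'X + - ('X * 'X).
  rewrite conj_quadE; have -> : - 2 * Re w = - (2 * Re w) by lra.
  rewrite rmorphN polyCN; ring.
have h1 : ext ((normc w ^+ 2)%:C%C)%:P = s ^+ 2.
  by rewrite ext_real ger0_norm ?sqr_ge0// exprn_powR ?normc_ge0.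
have h2 : ext (((2 * Re w)%:C%C)%:P * 'X) <= 2 * s * tau.
  rewrite ext_mul//; [|exact: approximable_real|exact: approximableX].
  rewrite ext_real ext_X ler_wpM2r ?seminorm_ge0//.
  apply: (@le_trans _ _ ((2 * normc w) `^ r)).
    apply: ge0_ler_powR; rewrite ?nnegrE ?mulr_ge0 ?normc_ge0//.
      exact: ltW.
    by rewrite normrM ger0_norm// ler_wpM2l// norm_Re_le.
  rewrite powRM ?normc_ge0// ler_wpM2r ?powR_ge0//.
  by rewrite ler1_powR// ler1n.
have h3 : ext (- ('X * 'X)) = tau ^+ 2.
  by rewrite ext_opp// ext_mul ?ext_X//; exact: approximableX.
rewrite -h1 {1}e -h3; apply: le_trans (ext_add _ _ _) _ => //.
by rewrite lerD2r; apply: le_trans (ext_add _ _ _) _ => //; rewrite lerD2l.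
Qed.

Lemma quad_bounded (B : R) : exists2 D : R, 0 < D & forall w, g w <= B -> normc w <= D.
Proof.
pose E := 3 * tau + 1 + `|B|.
have t0 : 0 <= tau by exact: seminorm_ge0.
have E0 : 0 < E by rewrite /E; have := normr_ge0 B; lra.
exists (E `^ r^-1); first exact: powR_gt0.
move=> w wB; have := quad_coercive w; set s := normc w `^ r => h.
have s0 : 0 <= s by exact: powR_ge0.
have sE : s <= E.
  rewrite leNgt; apply/negP; rewrite /E => sE.
  have : B <= `|B| by exact: ler_norm.
  have : 0 <= `|B| by exact: normr_ge0.
  nra.
rewrite -[normc w]powRr1 ?normc_ge0// -(mulfV (lt0r_neq0 r0)) powRrM.
by apply: ge0_ler_powR; rewrite ?nnegrE ?invr_ge0 ?(ltW r0)// ltW.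
Qed.

Lemma quad_continuous (p : R * R) :
  {for p, continuous (fun t : R * R => g (Complex t.1 t.2) : R)}.
Proof.
pose b (t : R * R) : R :=
  `|- 2 * t.1 - (- 2 * p.1)| `^ r * tau +
  `|normc (Complex t.1 t.2) ^+ 2 - normc (Complex p.1 p.2) ^+ 2| `^ r.
have cf : {for p, continuous (fun t : R * R => t.1)} by exact: cvg_fst.
have cs : {for p, continuous (fun t : R * R => t.2)} by exact: cvg_snd.
have ccst (c : R) : {for p, continuous (fun t : R * R => c)} by exact: continuous_cst_at.
have cN (u : R * R -> R) : {for p, continuous u} -> {for p, continuous (fun t => `|u t|)}.
  by move=> cu; apply: (@continuous_comp _ _ _ u (fun y : R => `|y|)) => //; exact: norm_continuous.
have crp (u : R * R -> R) : {for p, continuous u} ->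
    {for p, continuous (fun t => `|u t| `^ r)}.
  by move=> cu; apply: continuous_powR_at => //; [exact: cN|right].
have cb : {for p, continuous b}.
  apply: continuousD.
    apply: continuousM; last exact: ccst.
    by apply: crp; apply: continuousB; [apply: continuousM|]; (exact: ccst || done).
  apply: crp; apply: continuousB; last exact: ccst.
  apply: (@continuous_comp _ _ _ (fun t : R * R => normc (Complex t.1 t.2) : R)
     (fun y : R => y ^+ 2)); last exact: exprn_continuous.
  by apply: continuous_normc; split.
have b0 : b p = 0.
  by rewrite /b !subrr normr0 powR0 ?gt_eqF// mul0r addr0.
have wn (s t : R * R) : coef_norm x (conj_quad (Complex s.1 s.2) -
     conj_quad (Complex t.1 t.2)) <= `|- 2 * s.1 - (- 2 * t.1)| `^ r * tau +
  `|normc (Complex s.1 s.2) ^+ 2 - normc (Complex t.1 t.2) ^+ 2| `^ r.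
  rewrite !conj_quadE.
  set u := (- 2 * _)%:C%C; set u' := (_ ^+ 2)%:C%C.
  set v := (- 2 * _)%:C%C; set v' := (_ ^+ 2)%:C%C.
  have -> : 'X * 'X + u%:P * 'X + u'%:P - ('X * 'X + v%:P * 'X + v'%:P) =
     (u - v)%:P * 'X + (u' - v')%:P by rewrite !polyCB; ring.
  by rewrite coef_normMXaddC// coef_normC// /u /v /u' /v' -!rmorphB !normc_real.
rewrite /prop_for /continuous_at; apply/cvgrPdist_lt => e e0.
have : \forall t \near p, b t < e.
  by apply: (cvgr_lt (b p) cb); rewrite b0.
apply: filterS => t bt.
have h1 := ext_lip r0 (conj_quad (Complex p.1 p.2)) (conj_quad (Complex t.1 t.2)).
have h2 := ext_lip r0 (conj_quad (Complex t.1 t.2)) (conj_quad (Complex p.1 p.2)).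
have h3 := wn t p; have h4 := wn p t; rewrite /b in bt.
rewrite (distrC (- 2 * p.1)) (distrC (normc (Complex p.1 p.2) ^+ 2)) in h4.
rewrite ltr_norml ltrBrDl ltrBlDl; apply/andP; split.
  apply: le_lt_trans h2 _.
  by rewrite addrC ltrD2r; exact: le_lt_trans h3 bt.
rewrite ltrBlDl; apply: le_lt_trans h1 _; rewrite ltrD2l; exact: le_lt_trans h4 bt.
Qed.

(** Coercivity confines the search to a compact square. *)
Lemma quad_min : exists w0, forall w, g w0 <= g w.
Proof.
have [D D0 hD] := quad_bounded (g 0).
pose A : set (R * R) := `[- D, D]%classic `*` `[- D, D]%classic.
have cA : compact A by apply: compact_setX; exact: segment_compact.
pose h (t : R * R) : R := g (Complex t.1 t.2).
have A0 : A (0, 0) by split; rewrite /= in_itv/= lerNl oppr0 ltW.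
have [|t _ tmin] := compact_EVT_min (ex_intro _ _ A0) cA (f := h).
  by apply: continuous_subspaceT => p; exact: quad_continuous.
exists (Complex t.1 t.2) => w.
have hw v : h (Re v, Im v) = g v by rewrite /h; case: v.
case/orP: (le_total (g w) (g 0)) => gw.
  have wD := hD _ gw.
  rewrite -[leRHS]hw; apply: tmin; rewrite inE.
  split; rewrite /= in_itv /= -ler_norml; apply: le_trans wD.
    exact: norm_Re_le.
  exact: norm_Im_le.
by apply: le_trans gw; rewrite -[leRHS]hw; apply: tmin; rewrite inE.
Qed.

End Ostrowski.

Lemma step_arith (R : realFieldType) (m u s : R) : 0 < m -> 0 <= u -> u <= 1 ->
  u * (3 * m) < s - m -> s <= (1 + u) ^+ 2 * m -> False.
Proof.
move=> m0 u0 u1 h1 h2.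
have : 0 <= m * (u * (1 - u))
  by apply: mulr_ge0; [exact: ltW|apply: mulr_ge0; rewrite ?subr_ge0].
by lra.
Qed.

Section OstrowskiStep.
Variables (R : realType) (K : pred R[i]) (k : subFieldType K) (x : A1hyb k).
Hypothesis r0 : 0 < lambda x.
Local Notation r := (lambda x).
Local Notation ext := (ext x).
Implicit Types (w : R[i]).
Local Notation g w := (ext (conj_quad w)).
Variable m : R.
Hypotheses (m0 : 0 < m) (m_min : forall w, m <= g w).

Let prod_ge (s : seq R[i]) : m ^+ size s <= \prod_(z <- s) g z.
Proof.
elim: s => [|z s IH]; first by rewrite big_nil.
by rewrite big_cons exprS ler_pM// ?exprn_ge0// ltW.
Qed.

(** Chosen so that the conjugate quadratic increases by the constant [e]. *)
Let raise w (e : R) : R[i] := Complex (Re w) (Num.sqrt (Im w ^+ 2 + e)).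

Let raise_norm w (e : R) : 0 < e -> normc (raise w e) ^+ 2 = normc w ^+ 2 + e.
Proof.
move=> e0; rewrite !normc_sqr /= sqr_sqrtr ?addrA//.
by rewrite addr_ge0 ?sqr_ge0// ltW.
Qed.

Let raise_quad w (e : R) : 0 < e -> conj_quad (raise w e) = conj_quad w + (e%:C%C)%:P.
Proof.
by move=> e0; rewrite !conj_quadE raise_norm// rmorphD polyCD addrA.
Qed.

Lemma conj_quad_root w : (conj_quad w).[w] = 0.
Proof. by rewrite /conj_quad hornerM hornerXsubC subrr mul0r. Qed.

Lemma conj_quad_monic w : conj_quad w \is monic.
Proof. by rewrite monicMl ?monicXsubC. Qed.

Lemma size_conj_quad w : size (conj_quad w) = 3%N.
Proof.
by rewrite size_monicM ?monicXsubC ?polyXsubC_eq0// !size_XsubC.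
Qed.

Lemma map_conj_quad w : map_poly (@conjc R) (conj_quad w) = conj_quad w.
Proof.
rewrite /conj_quad rmorphM /= !rmorphB /= !map_polyX !map_polyC /= conjcK.
by rewrite mulrC.
Qed.

(** Let [q] be the quadratic of [w], and [G = q ^+ N - (- e) ^+ N]. The quadratic
    of the raised point is [q + e], so the raised point is a root of [G]. Since [G]
    is real, [G * G] is the product of the conjugate quadratics of its roots, each
    of which is at least [m]; and [G] is at most [m ^+ N + (e `^ r) ^+ N]. *)
Let bound w (e : R) n : g w = m -> 0 < e ->
  g (raise w e) * m ^+ n.*2.+1 <= (m ^+ n.+1 + (e `^ r) ^+ n.+1) ^+ 2.
Proof.
move=> gw e0; set N := n.+1.
have [rs Grs] := closed_field_poly_normal (conj_quad w ^+ N - ((- e)%:C%C)%:P ^+ N).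
set G := _ - _ in Grs.
have sq : size (conj_quad w ^+ N) = N.*2.+1.
  have := size_exp (conj_quad w) N; rewrite size_conj_quad mul2n /= => <-.
  by rewrite prednK// size_poly_gt0 monic_neq0// monic_exp// conj_quad_monic.
have sc : (size (- ((- e)%:C%C)%:P ^+ N) < size (conj_quad w ^+ N))%N.
  rewrite size_polyN -rmorphXn /= sq.
  by apply: leq_ltn_trans (size_polyC_leq1 _) _.
have Gm : lead_coef G = 1.
  by rewrite /G lead_coefDl//; apply/eqP; rewrite -monicE monic_exp// conj_quad_monic.
rewrite Gm scale1r in Grs.
have srs : size rs = N.*2.
  apply/eqP; rewrite -eqSS -(size_prod_XsubC rs id) -Grs.
  by rewrite /G size_polyDl// sq.
have Gc : G = \prod_(z <- rs) ('X - (z^*)%C%:P).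
  have : map_poly (@conjc R) G = G.
    rewrite /G rmorphB !rmorphXn /= map_conj_quad map_polyC /=.
    by rewrite oppr0.
  move=> <-; rewrite Grs rmorph_prod; apply: eq_bigr => z _.
  by rewrite /= rmorphB /= map_polyX map_polyC.
have GG : G * G = \prod_(z <- rs) conj_quad z.
  by rewrite {1}Grs Gc -big_split.
have aG : approximable x G.
  rewrite /G; have aq := approximable_quad r0 w.
  have ae := approximable_real r0 (- e).
  apply: approximableD => //; first exact: approximableX_n.
  rewrite -rmorphXn /= -polyCN -rmorphXn -rmorphN; exact: approximable_real.
have rw1 : raise w e \in rs.
  rewrite -root_prod_XsubC -Grs rootE /G hornerD hornerN !horner_exp hornerC.
  have : (conj_quad (raise w e)).[raise w e] = 0 by exact: conj_quad_root.
  rewrite raise_quad// hornerD hornerC => /eqP; rewrite addr_eq0 => /eqP ->.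
  by rewrite rmorphN subrr.
have E1 : g (raise w e) * m ^+ n.*2.+1 <= ext G ^+ 2.
  rewrite expr2 -ext_mul// GG ext_prod//; last by move=> z; exact: approximable_quad.
  rewrite (big_rem _ rw1) /= ler_pM2l; last exact: lt_le_trans (m_min _).
  by have := prod_ge (rem (raise w e) rs); rewrite size_rem// srs.
apply: le_trans E1 _.
rewrite ler_pXn2r ?nnegrE ?ext_ge0 ?addr_ge0 ?exprn_ge0 ?powR_ge0//; last exact: ltW.
apply: le_trans (ext_add r0 _ _) _; rewrite ext_opp// ext_exp//; last exact: approximable_quad.
rewrite ext_exp//; last exact: approximable_real.
by rewrite gw ext_real// normrN gtr0_norm.
Qed.

(** Letting the degree go to infinity in the bound turns the minimality of [m]
    at [w] into minimality at the raised point. *)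
Let raise_min w (e : R) : g w = m -> 0 < e -> e `^ r < m -> g (raise w e) = m.
Proof.
move=> gw e0 em; apply/eqP; rewrite eq_le m_min andbT leNgt; apply/negP => lt.
set t := e `^ r / m.
have t0 : 0 <= t by rewrite /t divr_ge0 ?powR_ge0// ltW.
have t1 : t < 1 by rewrite /t ltr_pdivrMr// mul1r.
pose d := (g (raise w e) - m) / (3 * m).
have d0 : 0 < d by rewrite divr_gt0 ?subr_gt0 ?mulr_gt0.
have ct : (t ^+ n) @[n --> \oo] --> 0 by apply: cvg_expr; rewrite ger0_norm.
have [n _ hn] : \forall n \near \oo, t ^+ n < d by apply: (cvgr_lt 0 ct).
have {hn} tn : t ^+ n.+1 < d by apply: hn; rewrite /=.
have := bound n gw e0.
have -> : e `^ r = t * m by rewrite /t divfK// gt_eqF.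
have -> : (m ^+ n.+1 + (t * m) ^+ n.+1) ^+ 2 =
    (1 + t ^+ n.+1) ^+ 2 * m * m ^+ n.*2.+1.
  have -> : m ^+ n.*2.+1 = m ^+ n * m ^+ n.+1.
    by rewrite -exprD addnS addnn.
  by rewrite exprMn !exprS; ring.
rewrite ler_pM2r ?exprn_gt0//.
have tn0 : 0 <= t ^+ n.+1 by rewrite exprn_ge0.
have tn1 : t ^+ n.+1 <= 1 by rewrite exprn_ile1// ltW.
have dE : d * (3 * m) = g (raise w e) - m by rewrite divfK// gt_eqF// mulr_gt0.
move=> h; apply: (step_arith m0 tn0 tn1 _ h).
by rewrite -dE ltr_pM2r// mulr_gt0.
Qed.

(** A positive minimum would be attained at points of arbitrarily large modulus,
    which coercivity forbids. *)
Lemma quad_min_pos_false w0 : g w0 = m -> False.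
Proof.
move=> gw0; have [D D0 hD] := quad_bounded r0 m.
pose e := (m / 2) `^ r^-1.
have e0 : 0 < e by rewrite powR_gt0// divr_gt0.
have em : e `^ r < m.
  rewrite /e -powRrM mulVf ?gt_eqF// powRr1; last by rewrite divr_ge0// ltW.
  by rewrite ltr_pdivrMr// ltr_pMr// ltr1n.
have it j : exists2 w, g w = m & normc w ^+ 2 = normc w0 ^+ 2 + j%:R * e.
  elim: j => [|j [w gw nw]]; first by exists w0; rewrite ?mul0r ?addr0.
  exists (raise w e); first exact: raise_min.
  by rewrite raise_norm// nw -natr1 mulrDl mul1r addrA.
have [w gw nw] := it (Num.bound (D ^+ 2 / e)).
have : normc w <= D by apply: hD; rewrite gw.
rewrite -(@ler_pXn2r _ 2) ?nnegrE ?normc_ge0 ?(ltW D0)// nw.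
have := archi_boundP (ltac:(rewrite divr_ge0 ?sqr_ge0// ltW//) : 0 <= D ^+ 2 / e).
rewrite ltr_pdivrMr//; have := sqr_ge0 (normc w0); lra.
Qed.

End OstrowskiStep.

Section Classification.
Variables (R : realType) (K : pred R[i]) (k : subFieldType K) (x : A1hyb k).
Hypothesis r0 : 0 < lambda x.
Local Notation r := (lambda x).
Local Notation ext := (ext x).
Local Notation approx := (approximable x).
Implicit Types (w : R[i]).

Lemma quad_vanishes : exists w, ext (conj_quad w) = 0.
Proof.
have [w0 hw0] := quad_min r0; exists w0; apply/eqP.
rewrite eq_le ext_ge0// andbT leNgt; apply/negP => m0.
exact: (quad_min_pos_false r0 m0 hw0 erefl).
Qed.

Lemma linear_vanishes w (F : {poly R[i]}) : approx ('X - w%:P) ->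
  ext ('X - w%:P) = 0 -> approx F -> approx (F %/ ('X - w%:P)) ->
  ext F = ext (F.[w])%:P.
Proof.
move=> aw ew aF aQ; apply: ext_kill => //.
have -> : F - (F.[w])%:P = (F %/ ('X - w%:P)) * ('X - w%:P).
  by rewrite {1}(divp_eq F ('X - w%:P)) modp_XsubC addrK.
by rewrite ext_mul// ew mulr0.
Qed.

Lemma classification_dense : (forall c : R[i], adherent k c) ->
  exists w, forall f : {poly k}, x f = arch_value r w f.
Proof.
move=> dense; have ap F : approx F by apply: approximable_poly.
have [w] := quad_vanishes; rewrite /conj_quad ext_mul// => /eqP.
rewrite mulf_eq0 => /orP[] /eqP e0; [exists w|exists (w^*)%C] => f;
  by rewrite -ext_of// (linear_vanishes _ e0)// ext_const.
Qed.

Section RealCase.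
Local Notation rpoly P := (map_poly (real_complex R) P).
Hypothesis kreal : forall a : k, Im (val a) = 0.
Local Notation Y P := (ext (rpoly P)).

Lemma approximable_rpoly (P : {poly R}) : approx (rpoly P).
Proof.
by apply: approximable_poly => // i; rewrite coef_map /=; exact: adherent_real.
Qed.

Let YM (P Q : {poly R}) : Y (P * Q) = Y P * Y Q.
Proof. by rewrite rmorphM /= ext_mul//; exact: approximable_rpoly. Qed.

Let YX (P : {poly R}) n : Y (P ^+ n) = Y P ^+ n.
Proof. by rewrite rmorphXn /= ext_exp//; exact: approximable_rpoly. Qed.

Let YC (t : R) : Y t%:P = `|t| `^ r.
Proof. by rewrite map_polyC /= ext_real. Qed.

Lemma pow_bound (A B C : R) : 0 <= A -> 0 <= B ->
  (forall n, A ^+ n.+1 <= C * B ^+ n.+1) -> A <= B.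
Proof.
move=> A0 B0 h; rewrite leNgt; apply/negP => BA.
have {}A0 : 0 < A by exact: le_lt_trans BA.
have C0 : 0 < C.
  have := h 0%N; rewrite !expr1 => hh; rewrite ltNge; apply/negP => C0.
  by have := mulr_le0_ge0 C0 B0; lra.
have t1 : B / A < 1 by rewrite ltr_pdivrMr// mul1r.
have t0 : 0 <= B / A by rewrite divr_ge0// ltW.
have ct : ((B / A) ^+ n) @[n --> \oo] --> 0 by apply: cvg_expr; rewrite ger0_norm.
have [n _ hn] : \forall n \near \oo, (B / A) ^+ n < C^-1.
  by apply: (cvgr_lt 0 ct); rewrite invr_gt0.
have {hn} : (B / A) ^+ n.+1 < C^-1 by apply: hn; rewrite /=.
rewrite expr_div_n ltr_pdivrMr ?exprn_gt0// -(ltr_pM2l C0) mulrA divff ?gt_eqF//.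
by rewrite mul1r ltNge h.
Qed.

(** When [k] is real, [ext] is known to be multiplicative on real polynomials
    only. If [w] is not real, a real polynomial is congruent to a linear one modulo
    the quadratic of [w], which bounds [ext] by a multiple of the value at [w];
    taking powers removes the constant, and multiplication by a polynomial with
    the conjugate value at [w] turns the inequality into an equality. *)
Lemma classification_real :
  exists w, forall f : {poly k}, x f = arch_value r w f.
Proof.
have [w qw] := quad_vanishes; exists w => f.
have kr (a : k) : val a = (Re (val a))%:C%C.
  by have := kreal a; case: (val a) => u v /= ->.
suff main (P : {poly R}) : Y P = normc (rpoly P).[w] `^ r.
  have fE : polyC_of f = rpoly (map_poly (fun a : k => Re (val a)) f).
    apply/polyP => i; rewrite coef_map_id0 ?rmorph0// coef_map.
    by rewrite coef_map_id0 /= -?kr// rmorph0.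
  by rewrite -ext_of// /arch_value fE main.
have [Imw|Imw] := eqVneq (Im w) 0.
  have wr : w = (Re w)%:C%C by move: Imw; case: (w) => u v /= ->.
  have aX : approx ('X - w%:P).
    by rewrite wr -(map_polyX (real_complex R)) -map_polyC -rmorphB;
    exact: approximable_rpoly.
  have eX : ext ('X - w%:P) = 0.
    move: qw; rewrite /conj_quad.
    have -> : (w^*)%C = w by rewrite wr /= oppr0.
    by rewrite ext_mul// => /eqP; rewrite mulf_eq0 orbb => /eqP.
  rewrite (linear_vanishes aX eX).
  - rewrite ext_const//; rewrite wr horner_map; exact: adherent_real.
  - exact: approximable_rpoly.
  - have -> : 'X - w%:P = rpoly ('X - (Re w)%:P).
      by rewrite {1}wr rmorphB /= map_polyX map_polyC.
    by rewrite -map_divp; exact: approximable_rpoly.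
pose Q : {poly R} := 'X * 'X + (- 2 * Re w)%:P * 'X + (normc w ^+ 2)%:P.
have QE : rpoly Q = conj_quad w.
  by rewrite conj_quadE !rmorphD !rmorphM /= map_polyX !map_polyC.
have sQ : size Q = 3%N by rewrite -(size_map_poly (real_complex R)) QE size_conj_quad.
have linE (S : {poly R}) : (size S <= 2)%N ->
    (rpoly S).[w] = Complex (S`_0 + S`_1 * Re w) (S`_1 * Im w).
  move=> sS; rewrite (@horner_coef_wide _ 2) ?size_map_poly//.
  rewrite !big_ord_recr big_ord0 /= !coef_map /= add0r expr0 expr1.
  by case: (w) => u v; simpc.
have vanish (P1 : {poly R}) : (rpoly P1).[w] = 0 -> Y P1 = 0.
  move=> P10; have dQ := divp_eq P1 Q.
  have sM : (size (P1 %% Q)%R <= 2)%N by rewrite -ltnS -sQ ltn_modp -size_poly_gt0 sQ.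
  have : (rpoly (P1 %% Q)).[w] = 0.
    move: P10; rewrite {1}dQ rmorphD rmorphM /= hornerD hornerM QE conj_quad_root.
    by rewrite mulr0 add0r.
  rewrite linE// => -[h0 h1].
  have c1 : (P1 %% Q)`_1 = 0 by apply: (mulIf Imw); rewrite h1 mul0r.
  have c0 : (P1 %% Q)`_0 = 0 by move: h0; rewrite c1 mul0r addr0.
  have -> : P1 = P1 %/ Q * Q.
    rewrite {1}dQ -[RHS]addr0; congr (_ + _).
    apply/polyP => -[|[|i]]; rewrite ?coef0 ?c0 ?c1//.
    by rewrite nth_default// (leq_trans sM).
  by rewrite YM QE qw mulr0.
have same (P1 P2 : {poly R}) : (rpoly P1).[w] = (rpoly P2).[w] -> Y P1 = Y P2.
  move=> e; apply: ext_kill => //; rewrite -rmorphB; apply: vanish.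
  by rewrite rmorphB hornerD hornerN e subrr.
pose lin (c : R[i]) : {poly R} :=
  (Im c / Im w)%:P * 'X + (Re c - Im c / Im w * Re w)%:P.
have lin_at c : (rpoly (lin c)).[w] = c.
  rewrite /lin rmorphD rmorphM /= map_polyX !map_polyC /= !hornerE.
  by case: c => a b; case: (w) Imw => u v /= v0; simpc; rewrite divfK// subrKC.
pose C := `|Im w|^-1 `^ r * x 'X + (1 + `|Re w| / `|Im w|) `^ r.
have lin_le c : Y (lin c) <= C * normc c `^ r.
  apply: le_trans; first exact: ext_le_coef_norm.
  rewrite /lin rmorphD rmorphM /= map_polyX !map_polyC /=.
  rewrite coef_normMXaddC// coef_normC// !normc_real /C mulrDl.
  apply: lerD.
    rewrite mulrAC ler_wpM2r ?seminorm_ge0// -powRM ?invr_ge0 ?normc_ge0//.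
    apply: ge0_ler_powR; rewrite ?nnegrE ?mulr_ge0 ?invr_ge0 ?normc_ge0//.
      exact: ltW.
    by rewrite normrM normfV mulrC ler_wpM2l ?invr_ge0// norm_Im_le.
  have D0 : 0 <= 1 + `|Re w| / `|Im w| by rewrite addr_ge0// divr_ge0.
  rewrite -powRM ?normc_ge0//.
  apply: ge0_ler_powR; rewrite ?nnegrE ?mulr_ge0 ?normc_ge0//.
    exact: ltW.
  apply: le_trans (ler_normB _ _) _; rewrite mulrDl mul1r lerD ?norm_Re_le//.
  have -> : `|Im c / Im w * Re w| = `|Re w| / `|Im w| * `|Im c|.
    by rewrite !normrM normfV; ring.
  by rewrite ler_wpM2l ?norm_Im_le// divr_ge0.
have upper P1 : Y P1 <= normc (rpoly P1).[w] `^ r.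
  apply: (@pow_bound _ _ C); rewrite ?ext_ge0 ?powR_ge0// => n.
  rewrite -YX (same _ (lin ((rpoly P1).[w] ^+ n.+1))); last first.
    by rewrite lin_at rmorphXn /= horner_exp.
  apply: le_trans (lin_le _) _.
  by rewrite normcX exprn_powR ?normc_ge0.
apply/eqP; rewrite eq_le upper /=.
set c := (rpoly P).[w].
have [c0|c0] := eqVneq c 0.
  by rewrite c0 normc0 powR0 ?gt_eqF// ext_ge0.
have pc : 0 < normc c `^ r by rewrite powR_gt0// normc_gt0.
have := upper (lin (c^*)%C); rewrite lin_at normcJ => hc.
have : Y P * Y (lin (c^*)%C) = normc c `^ r * normc c `^ r.
  rewrite -YM (same _ (normc c ^+ 2)%:P); last first.
    rewrite map_polyC hornerC /= rmorphM hornerM lin_at -/c normc_sqr.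
    by case: (c) => a b /=; simpc; congr Complex; ring.
  by rewrite YC normrX (ger0_norm (normc_ge0 _)) expr2 powRM ?normc_ge0.
have : 0 <= Y P by exact: ext_ge0.
move=> YP0 YPP; rewrite leNgt; apply/negP => lt.
have : Y P * Y (lin (c^*)%C) <= Y P * normc c `^ r by rewrite ler_wpM2l.
by rewrite YPP leNgt ltr_pM2r// lt.
Qed.

End RealCase.
End Classification.

(** * A continuous coordinate on the Archimedean part *)

Section Coordinate.
Variables (R : realType) (K : pred R[i]) (k : subFieldType K).
Local Notation X := (A1hyb k).
Implicit Types (x : X) (z : R[i]).

Lemma adherent_all (a : k) : Im (val a) != 0 -> forall c : R[i], adherent k c.
Proof.
move=> a0 c.
have -> : c = (Re c - Im c / Im (val a) * Re (val a))%:C%C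
              + (Im c / Im (val a))%:C%C * val a.
  case: c (val a) a0 => u v [s t] /= t0; simpc.
  by rewrite subrK divfK.
apply: adherentD; first exact: adherent_real.
by apply: adherentM; [exact: adherent_real|exact: adherent_val].
Qed.

Lemma classification x : 0 < lambda x ->
  exists z, x = arch_point k (lambda x) z.
Proof.
move=> r0.
have [z hz] : exists z, forall f : {poly k}, x f = arch_value (lambda x) z f.
  have [[a a0]|nreal] := pselect (exists a : k, Im (val a) != 0).
    by apply: classification_dense => //; exact: adherent_all a0.
  apply: classification_real => // a; apply/eqP; apply/negP => /negP a0.
  by apply: nreal; exists a.
by exists z; apply: A1hyb_eq => f; rewrite hz arch_pointE// r0 lambda_le1.
Qed.

(** The distance from the underlying complex number to [b]. *)
Definition dist_to (b : k) x : R := x ('X - b%:P) `^ (lambda x)^-1.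

Lemma arch_value_dist r z (b : k) : arch_value r z ('X - b%:P) = normc (z - val b) `^ r.
Proof. by rewrite /arch_value /polyC_of rmorphB /= map_polyX map_polyC /= !hornerE. Qed.

Lemma dist_to_arch r z (b : k) : 0 < r <= 1 ->
  dist_to b (arch_point k r z) = normc (z - val b).
Proof.
move=> r01; have /andP[r0 _] := r01.
rewrite /dist_to lambda_arch_point// arch_pointE// arch_value_dist.
by rewrite -powRrM mulfV ?gt_eqF// powRr1// normc_ge0.
Qed.

Lemma continuous_dist_to (b : k) x : 0 < lambda x ->
  {for x, continuous (dist_to b : X -> R)}.
Proof.
move=> r0; apply: continuous_powR_at.
- exact: continuous_eval.
- by apply: continuousV; [rewrite gt_eqF|exact: continuous_lambda].
- by move=> y; exact: seminorm_ge0.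
- by right; rewrite invr_gt0.
Qed.

(** A complex number is recovered from its distances to 0, to 1, and to a third
    point off the real axis; continuity follows from that of the distances. *)
Definition coord_Re x : R := (dist_to 0 x ^+ 2 + 1 - dist_to 1 x ^+ 2) / 2.

Definition coord_Im x : R :=
  if pselect (exists a : k, Im (val a) != 0) is left h then
    let a := sval (cid h) in
    (dist_to 0 x ^+ 2 + normc (val a) ^+ 2 - dist_to a x ^+ 2
      - 2 * coord_Re x * Re (val a)) / (2 * Im (val a))
  else Num.sqrt (dist_to 0 x ^+ 2 - coord_Re x ^+ 2).

(** When [k] consists of real numbers a point only determines its complex
    number up to conjugation; the one in the upper half plane is chosen. *)
Definition arch_coord x : R[i] := Complex (coord_Re x) (coord_Im x).

Lemma coord_Re_arch r z : 0 < r <= 1 -> coord_Re (arch_point k r z) = Re z.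
Proof.
move=> r01; rewrite /coord_Re !dist_to_arch// rmorph0 rmorph1 subr0 !normc_sqr.
by case: z => u v /=; field.
Qed.

Lemma coord_arch_nonreal r z : (exists a : k, Im (val a) != 0) -> 0 < r <= 1 ->
  arch_coord (arch_point k r z) = z.
Proof.
move=> h r01; rewrite /arch_coord coord_Re_arch// /coord_Im.
case: pselect => // h'; case: cid => a /= a0.
rewrite coord_Re_arch// !dist_to_arch// rmorph0 subr0 !normc_sqr.
case: z (val a) a0 => u v [s t] /= t0.
by congr Complex; field.
Qed.

Lemma arch_coordK x : 0 < lambda x -> x = arch_point k (lambda x) (arch_coord x).
Proof.
move=> r0; have r01 : 0 < lambda x <= 1 by rewrite r0 lambda_le1.
have [z xz] := classification r0.
have [h|h] := pselect (exists a : k, Im (val a) != 0).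
  have cz : arch_coord x = z by rewrite xz coord_arch_nonreal.
  by rewrite cz.
have kr (a : k) : Im (val a) = 0.
  by apply/eqP; apply/negP => /negP a0; apply: h; exists a.
have cE : arch_coord x = z \/ arch_coord x = (z^*)%C.
  rewrite xz /arch_coord coord_Re_arch// /coord_Im; case: pselect => // _.
  rewrite coord_Re_arch// !dist_to_arch// rmorph0 subr0 normc_sqr.
  have -> : Re z ^+ 2 + Im z ^+ 2 - Re z ^+ 2 = Im z ^+ 2 by lra.
  rewrite sqrtr_sqr; case: (z) => u v /=.
  by case: (ger0P v) => _; [left|right].
case: cE => -> //.
rewrite [LHS]xz; apply: A1hyb_eq => f; rewrite !arch_pointE// /arch_value.
have fc : map_poly (@conjc R) (polyC_of f) = polyC_of f.
  apply/polyP => i; rewrite !coef_map /=.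
  by have := kr f`_i; case: (val f`_i) => u v /= ->; rewrite oppr0.
by rewrite -{2}fc horner_map /= normcJ.
Qed.

Lemma continuous_coord x : 0 < lambda x -> continuousC_at x arch_coord.
Proof.
move=> r0.
have cd (b : k) : {for x, continuous (fun y => dist_to b y ^+ 2 : R)}.
  apply: (@continuous_comp _ _ _ (dist_to b) (fun t : R => t ^+ 2)).
    exact: continuous_dist_to.
  exact: exprn_continuous.
have cc (c : R) : {for x, continuous (fun _ : X => c : R)} by exact: continuous_cst_at.
have cr : {for x, continuous (coord_Re : X -> R)}.
  apply: continuousM; last exact: cc.
  by apply: continuousB; [apply: continuousD|].
split; first exact: cr.
rewrite /arch_coord /= /coord_Im; case: pselect => [h|_].
  apply: continuousM; last exact: cc.
  apply: continuousB.
    by apply: continuousB; [apply: continuousD|].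
  by apply: continuousM; [apply: continuousM|].
apply: (@continuous_comp _ _ _ (fun y => dist_to 0 y ^+ 2 - coord_Re y ^+ 2)
   (@Num.sqrt R)); last exact: sqrt_continuous.
apply: continuousB => //.
apply: (@continuous_comp _ _ _ coord_Re (fun t : R => t ^+ 2)) => //.
exact: exprn_continuous.
Qed.

End Coordinate.

(** * The radial flow *)

Section RadialStep.
Variable R : realType.
Implicit Types (z al be : R[i]) (s : seq R[i]) (d a : R).

(** The discs of radius [d] around the points of [s] are disjoint and well
    inside the disc of radius [d^-1]. *)
Definition separating s d : Prop :=
  [/\ 0 < d, d <= 2^-1,
      {in s &, forall al be, al != be -> 2 * d <= normc (al - be)} &
      {in s, forall al, 2 * d * normc al <= 1}].

Lemma separating_le s d d' : 0 < d' -> d' <= d -> separating s d ->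
  separating s d'.
Proof.
move=> d'0 d'd [d0 d1 h1 h2]; split => //; first exact: le_trans d1.
  move=> al be als bes ab; apply: le_trans (h1 _ _ als bes ab).
  by rewrite ler_wpM2l.
move=> al als; apply: le_trans (h2 _ als).
by rewrite ler_wpM2r ?normc_ge0// ler_wpM2l.
Qed.

Lemma separating_exists s : exists d, separating s d.
Proof.
have lower (I : eqType) (l : seq I) (F : I -> R) : (forall i, 0 < F i) ->
    exists2 d, 0 < d & {in l, forall i, d <= F i}.
  move=> F0; elim: l => [|i l [d d0 hd]]; first by exists 1.
  exists (Num.min (F i) d); first by rewrite lt_min F0.
  move=> j; rewrite inE => /orP[/eqP ->|/hd jd]; first by rewrite ge_min lexx.
  by rewrite ge_min jd orbT.
have [d1 d10 h1] := lower _ [seq (al, be) | al <- s, be <- s]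
  (fun p => if p.1 == p.2 then 1 else normc (p.1 - p.2) / 2)
  ltac:(move=> [al be] /=; case: eqVneq => // ab;
        rewrite divr_gt0// normc_gt0 subr_eq0//).
have [d2 d20 h2] := lower _ s (fun al => (2 * (normc al + 1))^-1)
  ltac:(move=> al; rewrite invr_gt0 mulr_gt0// ltr_wpDl ?normc_ge0//).
exists (Num.min 2^-1 (Num.min d1 d2)); split.
- by rewrite !lt_min d10 d20 invr_gt0 ltr0n.
- by rewrite ge_min lexx.
- move=> al be als bes ab.
  have := h1 (al, be); rewrite /= (negbTE ab) => /(_ _) h.
  have {}h : d1 <= normc (al - be) / 2 by apply: h; exact: allpairs_f.
  rewrite mulrC -ler_pdivlMr//; apply: le_trans h.
  by rewrite !ge_min lexx orbT.
- move=> al als; have h := h2 _ als; rewrite /= in h.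
  have a0 := normc_ge0 al.
  apply: (@le_trans _ _ (2 * d2 * normc al)).
    rewrite ler_wpM2r// ler_wpM2l//.
    by rewrite !ge_min lexx !orbT.
  have {}h : d2 * (2 * (normc al + 1)) <= 1.
    by rewrite -ler_pdivlMr ?div1r// mulr_gt0// ltr_wpDl.
  by apply: le_trans h; lra.
Qed.

Definition pull d a al z : R[i] :=
  (z - al) * ((Num.min 1 (normc (z - al) / d) `^ (a - 1) - 1)%:C)%C.

Definition push d a z : R[i] :=
  z * ((Num.max 1 (normc z * d) `^ (a - 1) - 1)%:C)%C.

(** In logarithmic scale around each point of [s], and around infinity, the
    distance beyond the threshold [d] is multiplied by [a]. *)
Definition radial s d a z : R[i] :=
  z + \sum_(al <- undup s) pull d a al z + push d a z.

(** The truncated distance to [al] that [radial] raises to the power [a]. *)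
Definition gauge d al z : R :=
  Num.min 1 (normc (z - al) / d) * Num.max 1 (normc z * d).

Lemma radial1 s d z : radial s d 1 z = z.
Proof.
rewrite /radial /pull /push subrr.
rewrite big1 => [|al _]; last by rewrite powRr0 subrr mulr0.
by rewrite powRr0 subrr mulr0 !addr0.
Qed.

Section Separating.
Variables (s : seq R[i]) (d : R).
Hypothesis sd : separating s d.

Let d0 : 0 < d. Proof. by case: sd. Qed.
Let d12 : d <= 2^-1. Proof. by case: sd. Qed.

Let pull_far al a z : d <= normc (z - al) -> pull d a al z = 0.
Proof.
move=> h; rewrite /pull min_l ?powR1 ?subrr ?mulr0//.
by rewrite ler_pdivlMr// mul1r.
Qed.

Let push_near a z : normc z * d <= 1 -> push d a z = 0.
Proof. by move=> h; rewrite /push max_l// powR1 subrr mulr0. Qed.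

Let disc_inside al z : al \in s -> normc (z - al) <= d -> normc z * d <= 1.
Proof.
move=> als zal; have [_ _ _ h] := sd; have := h _ als.
have := normc_lerB z al; have := normc_ge0 al; have := d0; have := d12.
move=> d1 d00 al0 zl hl.
have zd : normc z <= normc al + d by lra.
have : normc z * d <= (normc al + d) * d by rewrite ler_wpM2r// ltW.
have : d * d <= 2^-1 * 2^-1 by apply: ler_pM => //; exact: ltW.
lra.
Qed.

Let discs_disjoint al be z : al \in s -> be \in s -> al != be ->
  normc (z - al) <= d -> d <= normc (z - be).
Proof.
move=> als bes ab zal; have [_ _ h _] := sd; have := h _ _ als bes ab.
have := normc_add (z - be) (al - z).
rewrite addrC addrA subrK (normc_distC al z); lra.
Qed.

Lemma radial_disc a al z : 1 <= a -> al \in s -> normc (z - al) <= d ->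
  radial s d a z = al + (z - al) * ((normc (z - al) / d) `^ (a - 1))%:C%C.
Proof.
move=> a1 als zal; rewrite /radial push_near ?addr0; last exact: disc_inside zal.
rewrite (bigD1_seq al) ?mem_undup ?undup_uniq//= big_seq_cond big1 ?addr0.
  rewrite /pull min_r; last by rewrite ler_pdivrMr// mul1r.
  by rewrite rmorphB /=; ring.
move=> be /andP[]; rewrite mem_undup => bes bal; apply: pull_far.
by apply: discs_disjoint zal => //; rewrite eq_sym.
Qed.

Let far_outside al z : al \in s -> 1 <= normc z * d -> d <= normc (z - al).
Proof.
move=> als zd; have [_ _ _ h] := sd; have := h _ als.
have := normc_lerB z al; have := normc_ge0 al; have := d0; have := d12.
move=> d1 d00 al0 zl hl.
have : d * d <= 2^-1 * 2^-1 by apply: ler_pM => //; exact: ltW.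
move=> dd; rewrite -(ler_pM2r d00); have : (normc z - normc al) * d <= normc (z - al) * d.
  by rewrite ler_wpM2r// ltW.
lra.
Qed.

Lemma radial_outside a z : 1 <= a -> 1 <= normc z * d ->
  radial s d a z = z * ((normc z * d) `^ (a - 1))%:C%C.
Proof.
move=> a1 zd; rewrite /radial big_seq big1 ?addr0.
  by rewrite /push max_r// rmorphB /=; ring.
by move=> al; rewrite mem_undup => als; apply: pull_far; exact: far_outside.
Qed.

Lemma radial_fix a z : {in s, forall al, d <= normc (z - al)} ->
  normc z * d <= 1 -> radial s d a z = z.
Proof.
move=> h zd; rewrite /radial push_near// addr0 big_seq big1 ?addr0// => al.
by rewrite mem_undup => /h; exact: pull_far.
Qed.

Lemma gauge_disc al z : al \in s -> normc (z - al) <= d ->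
  gauge d al z = normc (z - al) / d.
Proof.
move=> als zal; rewrite /gauge max_l ?mulr1; last exact: disc_inside zal.
by rewrite min_r// ler_pdivrMr// mul1r.
Qed.

Lemma gauge_outside al z : al \in s -> 1 <= normc z * d ->
  gauge d al z = normc z * d.
Proof.
move=> als zd; rewrite /gauge max_r// min_l ?mul1r//.
by rewrite ler_pdivlMr// mul1r; exact: far_outside.
Qed.

Lemma gauge_mid al z : d <= normc (z - al) -> normc z * d <= 1 ->
  gauge d al z = 1.
Proof.
by move=> zal zd; rewrite /gauge max_l// min_l ?mul1r// ler_pdivlMr// mul1r.
Qed.

(** At any point at most one of the displacements is nonzero, and that one raises
    the gauge to the power [a]. *)
Lemma gauge_radial al a z : al \in s -> 1 <= a ->
  gauge d al (radial s d a z) = gauge d al z `^ a.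
Proof.
move=> als a1; have a0 : 0 < a by exact: lt_le_trans a1.
have a10 : 0 <= a - 1 by rewrite subr_ge0.
have nr (u v : R) : 0 <= u -> normc ((u `^ v)%:C)%C = u `^ v.
  by move=> _; rewrite normc_real ger0_norm ?powR_ge0.
have [zd|zd] := boolP (1 <= normc z * d).
  rewrite (gauge_outside als zd) radial_outside//.
  have e : normc (z * ((normc z * d) `^ (a - 1))%:C%C) * d = (normc z * d) `^ a.
    rewrite normcM nr; last exact: le_trans zd.
    by rewrite mulrAC mulr_powRB1//; exact: le_trans zd.
  have zda : 1 <= (normc z * d) `^ a by rewrite -(powRr0 (normc z * d)) ler_powR// ltW.
  by rewrite gauge_outside ?e.
have {}zd : normc z * d <= 1 by rewrite ltW// ltNge.
have [/hasP[be bes zbe]|/hasPn zfar] := boolP (has (fun be => normc (z - be) <= d) s).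
  rewrite (radial_disc a1 bes zbe).
  set y := _ + _.
  have u0 : 0 <= normc (z - be) / d by rewrite divr_ge0 ?normc_ge0// ltW.
  have u1 : normc (z - be) / d <= 1 by rewrite ler_pdivrMr// mul1r.
  have e : normc (y - be) / d = (normc (z - be) / d) `^ a.
    rewrite /y addrC addKr normcM nr//.
    by rewrite mulrAC mulr_powRB1.
  have ybe : normc (y - be) <= d.
    rewrite -[leRHS]mul1r -ler_pdivrMr// e.
    have [->|un0] := eqVneq (normc (z - be) / d) 0.
      by rewrite powR0 ?gt_eqF.
    rewrite -(powRr0 (normc (z - be) / d)) ger_powR ?(ltW a0)//.
    by rewrite u1 lt_def un0 u0.
  have [ab|ab] := eqVneq al be.
    by rewrite ab !gauge_disc// -?ab.
  rewrite !gauge_mid ?powR1//.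
  - by apply: discs_disjoint zbe => //; rewrite eq_sym.
  - by apply: discs_disjoint ybe => //; rewrite eq_sym.
  - exact: disc_inside ybe.
have zf : {in s, forall be, d <= normc (z - be)}.
  by move=> be /zfar; rewrite -ltNge => /ltW.
by rewrite radial_fix// gauge_mid ?powR1// zf.
Qed.

(** The gauge is the distance up to a factor that becomes invisible once raised
    to a small power. *)
Lemma gauge_dist al z : al \in s ->
  d / 2 * gauge d al z <= normc (z - al) /\
  d / 2 * normc (z - al) <= gauge d al z.
Proof.
move=> als; have [_ _ _ h] := sd; have hl := h _ als.
have d00 := d0; have d1 := d12.
have u0 := normc_ge0 (z - al); have z0 := normc_ge0 z; have al0 := normc_ge0 al.
have t1 := normc_lerB z al.
have t2 : normc (z - al) <= normc z + normc al.
  by rewrite -(normc_opp al) normc_add.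
have [zd|zd] := boolP (1 <= normc z * d).
  rewrite (gauge_outside als zd).
  have za : 2 * normc al <= normc z.
    by rewrite -(ler_pM2r d00); lra.
  split; last by nra.
  have : d * d <= 2^-1 * 2^-1 by apply: ler_pM => //; exact: ltW.
  nra.
have {}zd : normc z * d <= 1 by rewrite ltW// ltNge.
have [zal|zal] := boolP (normc (z - al) <= d).
  rewrite gauge_disc//; split; first by rewrite mulrC mulrA divfK ?gt_eqF//; lra.
  rewrite mulrC ler_wpM2l//; apply: (@le_trans _ _ 1); first by lra.
  by rewrite invf_ge1//; lra.
have {}zal : d <= normc (z - al) by rewrite ltW// ltNge.
rewrite gauge_mid//; split; first by lra.
nra.
Qed.

End Separating.

Lemma gauge_mono d d' al z : 0 < d' -> d' <= d -> d <= 2^-1 ->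
  d' / 2 * gauge d' al z <= gauge d al z /\
  d' / 2 * gauge d al z <= gauge d' al z.
Proof.
move=> d'0 d'd d1; have d0 : 0 < d by exact: lt_le_trans d'd.
have z0 := normc_ge0 z; have u0 := normc_ge0 (z - al).
rewrite /gauge; set m := Num.min 1 (_ / d); set m' := Num.min 1 (_ / d').
set M := Num.max 1 (_ * d); set M' := Num.max 1 (_ * d').
have k0 : 0 <= d' / d by rewrite divr_ge0// ltW.
have k1 : d' / d <= 1 by rewrite ler_pdivrMr// mul1r.
have m0 : 0 <= m by rewrite /m le_min ler01 divr_ge0// ltW.
have m'0 : 0 <= m' by rewrite /m' le_min ler01 divr_ge0// ltW.
have M0 : 0 <= M by rewrite /M le_max ler01.
have M'0 : 0 <= M' by rewrite /M' le_max ler01.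
have MM : M' <= M.
  by rewrite /M /M' ge_max !le_max lexx /= (ler_wpM2l z0 d'd) orbT.
have MM' : d' / d * M <= M'.
  rewrite /M /M' maxr_pMr// ge_max !le_max mulr1 k1 /=.
  by rewrite mulrCA divfK ?gt_eqF// lexx orbT.
have mm : m <= m'.
  rewrite /m /m' le_min !ge_min lexx /=; apply/orP; right.
  by rewrite ler_wpM2l// lef_pV2.
have mm' : d' / d * m' <= m.
  rewrite /m /m' minr_pMr// le_min !ge_min mulr1 k1 /=.
  have -> : d' / d * (normc (z - al) / d') = normc (z - al) / d.
    by field; rewrite !gt_eqF.
  by rewrite lexx orbT.
have kd : d' / 2 <= d' / d.
  rewrite ler_wpM2l ?(ltW d'0)// lef_pV2 ?posrE//; lra.
split.
  apply: (@le_trans _ _ (d' / d * (m' * M'))).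
    by rewrite ler_wpM2r// mulr_ge0.
  by rewrite mulrA ler_pM// mulr_ge0.
apply: (@le_trans _ _ (d' / d * (m * M))).
  by rewrite ler_wpM2r// mulr_ge0.
by rewrite mulrCA ler_pM// mulr_ge0.
Qed.

End RadialStep.

(** * Iterating the radial steps *)

Section Close.
Variable R : realType.
Implicit Types a b c e : R.

(** Equality up to a factor [expR e]: an estimate that is multiplicative in the
    polynomial, and that needs no bound on the values compared. *)
Definition within_factor e a b : Prop := a <= expR e * b /\ b <= expR e * a.

Lemma factor_sym e a b : within_factor e a b -> within_factor e b a.
Proof. by case. Qed.

Lemma factor_refl e a : 0 <= e -> 0 <= a -> within_factor e a a.
Proof.
move=> e0 a0; have : a <= expR e * a by rewrite ler_peMl// -expR0 ler_expR.
by split.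
Qed.

Lemma factor_trans e e' a b c : within_factor e a b -> within_factor e' b c -> within_factor (e + e') a c.
Proof.
move=> [ab ba] [bc cb]; rewrite /within_factor expRD; split.
  by apply: le_trans ab _; rewrite -mulrA ler_pM2l ?expR_gt0.
by apply: le_trans cb _; rewrite (mulrC (expR e)) -mulrA ler_pM2l ?expR_gt0.
Qed.

Lemma factor_le e e' a b : 0 <= a -> 0 <= b -> e <= e' -> within_factor e a b -> within_factor e' a b.
Proof.
move=> a0 b0 ee [ab ba]; split.
  by apply: le_trans ab _; rewrite ler_wpM2r// ler_expR.
by apply: le_trans ba _; rewrite ler_wpM2r// ler_expR.
Qed.

Lemma factor_mul e e' a b a' b' : 0 <= a -> 0 <= b -> 0 <= a' -> 0 <= b' ->
  within_factor e a b -> within_factor e' a' b' -> within_factor (e + e') (a * a') (b * b').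
Proof.
move=> a0 b0 a'0 b'0 [ab ba] [ab' ba']; rewrite /within_factor expRD; split.
  by rewrite mulrACA ler_pM.
by rewrite mulrACA ler_pM.
Qed.

Lemma factor_powR (d a b r e : R) : 0 < d -> 0 <= a -> 0 <= b -> 0 <= r ->
  d * a <= b -> d * b <= a -> expR (- e) <= d `^ r -> within_factor e (a `^ r) (b `^ r).
Proof.
move=> d0 a0 b0 r0 dab dba er.
have half u v : 0 <= u -> 0 <= v -> d * u <= v -> u `^ r <= expR e * v `^ r.
  move=> u0 v0 duv; rewrite mulrC -ler_pdivrMr ?expR_gt0// mulrC -expRN.
  apply: (@le_trans _ _ (d `^ r * u `^ r)).
    by rewrite ler_wpM2r ?powR_ge0.
  rewrite -powRM//; last exact: ltW.
  by apply: ge0_ler_powR; rewrite ?nnegrE// mulr_ge0// ltW.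
by split; apply: half.
Qed.

End Close.

Section Flow.
Variables (R : realType) (A : nat -> seq R[i]).
Hypothesis A_mono : forall m n, (m <= n)%N -> {subset A m <= A n}.
Implicit Types (z al : R[i]) (r : R) (m n : nat).

Fixpoint radius n : R :=
  let d := sval (cid (separating_exists (A n))) in
  if n is n'.+1 then Num.min (radius n') d else d.

Let sepd n : separating (A n) (sval (cid (separating_exists (A n)))).
Proof. by case: cid. Qed.

Lemma radius_gt0 n : 0 < radius n.
Proof.
elim: n => [|n IH]; first by case: (sepd 0).
by rewrite /= lt_min IH; case: (sepd n.+1).
Qed.

Lemma radius_sep n : separating (A n) (radius n).
Proof.
case: n => [|n]; first exact: sepd.
by apply: (separating_le (radius_gt0 n.+1) _ (sepd n.+1)); rewrite /= ge_min lexx orbT.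
Qed.

Lemma radius_mono m n : (m <= n)%N -> radius n <= radius m.
Proof.
move=> /subnK <-; elim: (n - m)%N => [|i IH]; first by rewrite add0n.
by rewrite addSn /= ge_min IH.
Qed.

Lemma radius_half n : radius n <= 2^-1.
Proof. by case: (radius_sep n). Qed.

Definition small n : R := 2^-1 ^+ n.

Lemma small_gt0 n : 0 < small n.
Proof. by rewrite exprn_gt0// invr_gt0. Qed.

Lemma smallS n : small n.+1 = small n / 2.
Proof. by rewrite /small exprS mulrC. Qed.

Lemma small_mono m n : (m <= n)%N -> small n <= small m.
Proof.
move=> /subnK <-; elim: (n - m)%N => [|i IH]; first by rewrite add0n.
by rewrite addSn smallS; apply: le_trans IH; have := small_gt0 (i + m); lra.
Qed.

(** The thresholds are so small that raising a number between [radius n] and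
    its inverse to a power at most [threshold n] costs a factor at most
    [expR (small n)]. *)
Definition threshold n : R := small n / (1 + `|ln (radius n / 2)|).

Let den_gt0 n : 0 < 1 + `|ln (radius n / 2)|.
Proof. by rewrite ltr_wpDr. Qed.

Lemma threshold_gt0 n : 0 < threshold n.
Proof. by rewrite divr_gt0 ?small_gt0. Qed.

Lemma threshold_small n : threshold n <= small n.
Proof.
rewrite ler_pdivrMr// ler_peMr ?(ltW (small_gt0 n))//.
by rewrite lerDl.
Qed.

Let half_pos n : 0 < radius n / 2.
Proof. by rewrite divr_gt0 ?radius_gt0. Qed.

Let half_le1 n : radius n / 2 <= 1.
Proof. by have := radius_half n; lra. Qed.

Lemma threshold_mono m n : (m <= n)%N -> threshold n <= threshold m.
Proof.
move=> mn; apply: ler_pM; rewrite ?(ltW (small_gt0 n)) ?invr_ge0 ?(ltW (den_gt0 n))//.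
  exact: small_mono.
rewrite lef_pV2 ?posrE// lerD2l !ler0_norm ?ln_le0//.
rewrite lerN2 ler_ln ?posrE//.
by rewrite ler_pM2r ?invr_gt0//; exact: radius_mono.
Qed.

Lemma threshold_powR n r : 0 <= r <= threshold n ->
  expR (- small n) <= (radius n / 2) `^ r.
Proof.
move=> /andP[r0 rc]; rewrite /powR gt_eqF// ler_expR lerNl -mulrN.
rewrite -ler0_norm ?ln_le0//; apply: (@le_trans _ _ (threshold n * `|ln (radius n / 2)|)).
  by rewrite ler_wpM2r.
rewrite /threshold mulrAC ler_pdivrMr// ler_wpM2l ?(ltW (small_gt0 n))//.
by rewrite lerDr.
Qed.

Lemma gauge_ge0 n al z : 0 <= gauge (radius n) al z.
Proof.
rewrite mulr_ge0// ?le_min ?le_max ler01//= divr_ge0 ?normc_ge0//.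
exact: ltW (radius_gt0 n).
Qed.

Lemma gauge_dist_close n al z r : al \in A n -> 0 <= r <= threshold n ->
  within_factor (small n) (gauge (radius n) al z `^ r) (normc (z - al) `^ r).
Proof.
move=> an rc; have [h1 h2] := gauge_dist (radius_sep n) z an.
apply: (factor_powR (half_pos n)) => //; last exact: threshold_powR.
- exact: gauge_ge0.
- exact: normc_ge0.
- by case/andP: rc.
Qed.

Lemma gauge_gauge_close m n al z r : (m <= n)%N -> 0 <= r <= threshold n ->
  within_factor (small n) (gauge (radius n) al z `^ r) (gauge (radius m) al z `^ r).
Proof.
move=> mn rc.
have [h1 h2] := gauge_mono al z (radius_gt0 n) (radius_mono mn) (radius_half m).
apply: (factor_powR (half_pos n)) => //; last exact: threshold_powR.
- exact: gauge_ge0.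
- exact: gauge_ge0.
- by case/andP: rc.
Qed.

(** The levels decrease to the maximum of [r'] and 0, or are constantly [r] when
    [r <= r']. *)
Definition level r (r' : R) n : R := Num.min r (Num.max r' (threshold n)).

(** Each step compensates the drop in level: the gauges of the points of
    [A n], raised to the level, are preserved by the step from [n] to [n.+1]. *)
Fixpoint flow r (r' : R) z n : R[i] :=
  if n is n'.+1 then
    radial (A n') (radius n') (level r r' n' / level r r' n'.+1)
      (flow r r' z n')
  else z.

Section Trajectory.
Variables (r r' : R) (z : R[i]).
Hypothesis r0 : 0 < r.
Local Notation lev := (level r r').
Local Notation pos := (flow r r' z).

Lemma level_gt0 n : 0 < lev n.
Proof. by rewrite lt_min r0 lt_max threshold_gt0 orbT. Qed.

Lemma level_le n : lev n <= r.
Proof. by rewrite ge_min lexx. Qed.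

Lemma level_mono m n : (m <= n)%N -> lev n <= lev m.
Proof.
move=> mn; rewrite le_min !ge_min lexx /=; apply/orP; right.
by rewrite ge_max !le_max lexx /= (threshold_mono mn) orbT.
Qed.

Lemma level_stable m n : (m <= n)%N -> threshold m < lev m -> lev n = lev m.
Proof.
move=> mn; rewrite lt_min => /andP[cr]; rewrite lt_max ltxx orbF => cr'.
by rewrite /level !max_l// ltW// (le_lt_trans (threshold_mono mn)).
Qed.

Lemma flow_stable_step n : lev n.+1 = lev n -> pos n.+1 = pos n.
Proof. by move=> e; rewrite /= -/(lev _) e divff ?radial1// gt_eqF// level_gt0. Qed.

Lemma flow_stable m n : (m <= n)%N -> threshold m < lev m -> pos n = pos m.
Proof.
move=> /subnK <- cm; elim: (n - m)%N => [//|i IH].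
rewrite addSn -IH; apply: flow_stable_step.
by rewrite !(@level_stable m)// ?leq_addl// (leq_trans (leq_addl i m)).
Qed.

Lemma flow_gauge n al : al \in A n ->
  gauge (radius n) al (pos n.+1) `^ lev n.+1 = gauge (radius n) al (pos n) `^ lev n.
Proof.
move=> an; rewrite /= gauge_radial//; last first.
- by rewrite ler_pdivlMr ?level_gt0// mul1r level_mono.
- exact: radius_sep.
by rewrite -powRrM divfK// gt_eqF// level_gt0.
Qed.

(** As long as the level keeps dropping it stays below the thresholds, so the
    changes of gauge cost at most [small n - small j] in total. *)
Lemma flow_gauge_close n al m : al \in A n -> lev n <= threshold n -> (n <= m)%N ->
  exists2 j, (n <= j <= m)%N & lev m <= threshold j /\
    within_factor (small n - small j) (gauge (radius j) al (pos m) `^ lev m)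
      (gauge (radius n) al (pos n) `^ lev n).
Proof.
move=> an ln /subnK <-; elim: (m - n)%N => [|i [j /andP[nj ji] [lj cj]]].
  exists n; rewrite ?add0n ?leqnn//; split => //.
  by rewrite subrr; apply: factor_refl => //; exact: powR_ge0.
rewrite addSn; set M := (i + n)%N in ji lj cj *.
have [e|ne] := eqVneq (lev M.+1) (lev M).
  exists j; first by rewrite nj (leq_trans ji).
  by rewrite (flow_stable_step e) e.
have lM : lev M <= threshold M.
  by rewrite leNgt; apply: contra ne => h; rewrite (@level_stable M).
have nM : (n <= M)%N by rewrite leq_addl.
exists M; first by rewrite nM leqnSn.
split; first exact: le_trans (level_mono (leqnSn M)) lM.
rewrite flow_gauge; last exact: A_mono an.
have [jM|jM] := eqVneq j M; first by rewrite -jM in cj *.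
have {}jM : (j < M)%N by rewrite ltn_neqAle jM.
have lM0 : 0 <= lev M <= threshold M by rewrite lM (ltW (level_gt0 M)).
have := factor_trans (gauge_gauge_close al (pos M) ji lM0) cj.
apply: factor_le; rewrite ?powR_ge0//.
have := small_mono jM; rewrite -(ler_pM2r (ltr0n R 2)).
have -> : small j.+1 * 2 = small j by rewrite smallS divfK.
by have := small_gt0 M; lra.
Qed.

Lemma flow_dist_close n al m : al \in A n -> (n <= m)%N ->
  within_factor (2 * small n) (normc (pos m - al) `^ lev m) (normc (pos n - al) `^ lev n).
Proof.
move=> an nm; have [ln|ln] := leP (lev n) (threshold n); last first.
  rewrite (flow_stable nm ln) (level_stable nm ln); apply: factor_refl.
    by rewrite mulr_ge0// ltW// small_gt0.
  exact: powR_ge0.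
have [j /andP[nj jm] [lj cj]] := flow_gauge_close an ln nm.
have h1 := gauge_dist_close (pos m) (A_mono nj an) (ltac:(by rewrite lj ltW// level_gt0) : 0 <= lev m <= threshold j).
have h2 := gauge_dist_close (pos n) an (ltac:(by rewrite ln ltW// level_gt0) : 0 <= lev n <= threshold n).
have := factor_trans (factor_trans (factor_sym h1) cj) h2.
by apply: factor_le; rewrite ?powR_ge0//; lra.
Qed.

(** The same estimate for the modulus of a leading coefficient. *)
Lemma flow_const_close n m (a : R) : 0 < a -> (n <= m)%N ->
  within_factor (small n * `|ln a|) (a `^ lev m) (a `^ lev n).
Proof.
move=> a0 nm; have [hn|hn] := leP (lev n) (threshold n); last first.
  rewrite (level_stable nm hn); apply: factor_refl; last exact: powR_ge0.
  by rewrite mulr_ge0// ltW// small_gt0.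
have : `|(lev m - lev n) * ln a| <= small n * `|ln a|.
  rewrite normrM ler_wpM2r//; apply: (@le_trans _ _ (threshold n)); last exact: threshold_small.
  apply: le_trans hn.
  rewrite ler0_norm ?subr_le0 ?level_mono// opprB.
  by rewrite lerBlDr lerDl ltW// level_gt0.
rewrite ler_norml mulrBl => /andP[h1 h2].
rewrite /within_factor /powR gt_eqF// -!expRD !ler_expR; split; lra.
Qed.

End Trajectory.

Section Values.
Variables (K : pred R[i]) (k : subFieldType K) (r r' : R) (z : R[i]).
Hypothesis r0 : 0 < r.
Implicit Types f : {poly k}.
Local Notation lev := (level r r').
Local Notation pos := (flow r r' z).

Lemma arch_value_prod s f (c w : R[i]) (l : seq R[i]) :
  polyC_of f = c *: \prod_(al <- l) ('X - al%:P) ->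
  arch_value s w f = normc c `^ s * \prod_(al <- l) normc (w - al) `^ s.
Proof.
move=> fE; rewrite /arch_value fE hornerZ normcM.
have : 0 <= normc (\prod_(al <- l) ('X - al%:P)).[w] /\
   normc (\prod_(al <- l) ('X - al%:P)).[w] `^ s =
   \prod_(al <- l) normc (w - al) `^ s.
  split; first exact: normc_ge0.
  elim: l {fE} => [|al l IH].
    by rewrite !big_nil hornerC normc1 powR1.
  rewrite !big_cons hornerM hornerXsubC normcM.
  by rewrite powRM ?normc_ge0// IH.
by case=> h0 <-; rewrite powRM ?normc_ge0.
Qed.

Definition spread f : R :=
  2 * (size f)%:R + `|ln (normc (lead_coef (polyC_of f)))|.

Lemma spread_ge0 f : 0 <= spread f.
Proof. by rewrite addr_ge0// mulr_ge0. Qed.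

(** Up to a constant factor, the polynomial is a product of distances to points
    of [A n]. *)
Lemma flow_value_close f n m : f != 0 ->
  (forall al, root (polyC_of f) al -> al \in A n) -> (n <= m)%N ->
  within_factor (spread f * small n) (arch_value (lev m) (pos m) f)
    (arch_value (lev n) (pos n) f).
Proof.
move=> f0 fA nm.
have F0 : polyC_of f != 0 by rewrite map_poly_eq0.
have [l fE] := closed_field_poly_normal (polyC_of f).
set c := lead_coef _ in fE.
have c0 : 0 < normc c by rewrite normc_gt0 lead_coef_eq0.
have sl : (size l <= size f)%N.
  have := congr1 (fun p : {poly R[i]} => size p) fE.
  rewrite size_scale ?lead_coef_eq0// size_prod_XsubC size_map_poly => ->.
  exact: leqnSn.
have lA : {subset l <= A n}.
  move=> al al_l; apply: fA; rewrite fE rootZ ?lead_coef_eq0//.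
  by rewrite root_prod_XsubC.
rewrite !(arch_value_prod _ _ fE).
have p0 (l' : seq R[i]) s w : 0 <= \prod_(al <- l') normc (w - al) `^ s.
  by apply: prodr_ge0 => i _; exact: powR_ge0.
have prod_close : within_factor (2 * small n * (size l)%:R)
    (\prod_(al <- l) normc (pos m - al) `^ lev m)
    (\prod_(al <- l) normc (pos n - al) `^ lev n).
  elim: l lA {fE sl} => [_|al l IH lA].
    by rewrite !big_nil mulr0; exact: factor_refl.
  rewrite !big_cons.
  have -> : 2 * small n * (size (al :: l))%:R =
      2 * small n + 2 * small n * (size l)%:R by rewrite /= -natr1; ring.
  apply: factor_mul; rewrite ?powR_ge0 ?p0//.
  - by apply: flow_dist_close => //; apply: lA; rewrite inE eqxx.
  - by apply: IH => be bl; apply: lA; rewrite inE bl orbT.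
have := factor_mul _ _ _ _ (flow_const_close r' r0 c0 nm) prod_close.
move=> /(_ (powR_ge0 _ _) (powR_ge0 _ _)) h.
apply: factor_le (h _ _); rewrite ?mulr_ge0 ?powR_ge0 ?p0//.
have : (size l)%:R <= (size f)%:R :> R by rewrite ler_nat.
rewrite /spread -/c -(ler_pM2l (small_gt0 n)) => sn.
by rewrite -subr_ge0; move: sn; rewrite -subr_ge0; lra.
Qed.

End Values.
End Flow.

(** * The strong deformation retraction *)

Section CloseLimits.
Variable R : realType.
Implicit Types a b e t : R.

Lemma factor_dist t a b : 0 < t <= 1 -> 0 <= a -> 0 <= b ->
  within_factor (ln (1 + t)) a b -> `|a - b| <= 2 * t * b.
Proof.
move=> /andP[t0 t1] a0 b0; rewrite /within_factor lnK ?posrE ?addr_gt0// => -[ab ba].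
rewrite ler_norml; apply/andP; split; last by nra.
have : t * a <= t * (2 * b) by rewrite ler_wpM2l ?(ltW t0)//; nra.
by lra.
Qed.

Lemma ln1D_gt0 t : 0 < t -> 0 < ln (1 + t).
Proof. by move=> t0; rewrite ln_gt0// ltrDl. Qed.

Lemma factor_cvg (v : nat -> R) : (forall n, 0 <= v n) ->
  (forall e, 0 < e -> exists n, forall m, (n <= m)%N -> within_factor e (v m) (v n)) ->
  cvgn v.
Proof.
move=> v0 h; apply: cauchy_cvg; apply: cauchy_exP => e e0.
have [n1 h1] := h 1 ltr01.
pose B := expR 1 * v n1.
have B0 : 0 <= B by rewrite mulr_ge0 ?expR_ge0.
pose t := Num.min 1 (e / (4 * B + 1)).
have D0 : 0 < 4 * B + 1 by rewrite ltr_wpDl// mulr_ge0.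
have t0 : 0 < t by rewrite lt_min ltr01 divr_gt0.
have t1 : t <= 1 by rewrite ge_min lexx.
have te : t * (4 * B + 1) <= e by rewrite -ler_pdivlMr// ge_min lexx orbT.
have [n2 h2] := h _ (ln1D_gt0 t0); exists (v n2).
pose M := maxn n1 n2.
have vB : v n2 <= 2 * B.
  have [_] := h2 M (leq_maxr _ _); rewrite lnK ?posrE ?addr_gt0//.
  have [vM _] := h1 M (leq_maxl _ _).
  have := v0 M; rewrite -/B in vM; nra.
exists n2 => // m /= nm.
rewrite /ball /= distrC; apply: (@le_lt_trans _ _ (2 * t * v n2)).
  by apply: factor_dist; rewrite ?t0//; exact: h2.
have : t * v n2 <= t * (2 * B) by rewrite ler_wpM2l// ltW.
by lra.
Qed.

(** The multiplicative form of the continuity of locally uniform limits. *)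
Lemma factor_continuous (T : topologicalType) (p : T) (g : T -> R) :
  (forall q, 0 <= g q) ->
  (forall e, 0 < e -> exists2 h : T -> R, (forall q, 0 <= h q) /\ {for p, continuous h} &
     \forall q \near p, within_factor e (g q) (h q)) ->
  {for p, continuous g}.
Proof.
move=> g0 hh; rewrite /prop_for /continuous_at; apply/cvgrPdist_lt => e e0.
pose D := 2 * (8 * g p + 3).
have D0 : 0 < D by rewrite mulr_gt0// ltr_wpDl// mulr_ge0.
pose t := Num.min 1 (e / D).
have t0 : 0 < t by rewrite lt_min ltr01 divr_gt0.
have t1 : t <= 1 by rewrite ge_min lexx.
have te : t * D <= e by rewrite -ler_pdivlMr// ge_min lexx orbT.
have [h [h0 ch] nh] := hh _ (ln1D_gt0 t0).
have pp : within_factor (ln (1 + t)) (g p) (h p) by exact: (nbhs_singleton nh).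
have e2 : 0 < Num.min 1 (e / 2) by rewrite lt_min ltr01 divr_gt0.
have /cvgrPdist_lt /(_ _ e2) nc : h q @[q --> p] --> h p by exact: ch.
apply: filterS2 nh nc => q cq; rewrite lt_min => /andP[hq1 hq2].
have t01 : 0 < t <= 1 by rewrite t0.
have d1 := factor_dist t01 (g0 q) (h0 q) cq.
have d2 := factor_dist t01 (g0 p) (h0 p) pp.
have hp : h p <= 2 * g p.
  have [_] := pp; rewrite lnK ?posrE ?addr_gt0//; have := g0 p; nra.
have hq : h q <= 2 * g p + 1.
  by move: hq1; rewrite distrC ltr_norml => /andP[_]; lra.
have b1 : t * h q <= t * (2 * g p + 1) by rewrite ler_wpM2l// ltW.
have b2 : t * h p <= t * (2 * g p) by rewrite ler_wpM2l// ltW.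
have -> : g p - g q = (g p - h p) + (h p - h q) - (g q - h q) by ring.
apply: le_lt_trans (ler_normB _ _) _.
apply: (@le_lt_trans _ _ (2 * t * h p + `|h p - h q| + 2 * t * h q)).
  by rewrite lerD//; apply: le_trans (ler_normD _ _) _; rewrite lerD2r.
rewrite /D in te; clear - te b1 b2 hq2 t0; lra.
Qed.

End CloseLimits.

Section FlowContinuity.
Variables (R : realType) (T : topologicalType) (p : T).
Implicit Types (F : T -> R[i]) (a b : T -> R).

Lemma continuousC_squeeze F b : F p = 0 -> b p = 0 -> {for p, continuous b} ->
  (\forall t \near p, normc (F t) <= b t) -> continuousC_at p F.
Proof.
move=> Fp bp cb nF.
have sq (u : T -> R) : u p = 0 -> (forall t, `|u t| <= normc (F t)) ->
    {for p, continuous u}.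
  move=> up uF; rewrite /prop_for /continuous_at up; apply/cvgrPdist_lt => e e0.
  have nb : \forall t \near p, b t < e by apply: (cvgr_lt (b p) cb); rewrite bp.
  apply: filterS2 nF nb => t Fb be; rewrite sub0r normrN.
  exact: le_lt_trans (uF t) (le_lt_trans Fb be).
by split; apply: sq; rewrite ?Fp// => t; [exact: norm_Re_le|exact: norm_Im_le].
Qed.

Lemma continuous_cmin a (c : R) : {for p, continuous a} ->
  {for p, continuous (fun t => Num.min c (a t) : R)}.
Proof. by move=> ca; apply: (@continuous_min R T (fun=> c) a) => //; exact: continuous_cst_at. Qed.

Lemma continuous_cmax a (c : R) : {for p, continuous a} ->
  {for p, continuous (fun t => Num.max c (a t) : R)}.
Proof. by move=> ca; apply: (@continuous_max R T (fun=> c) a) => //; exact: continuous_cst_at. Qed.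

Lemma continuousC_radial s d a F : 0 < d -> {for p, continuous a} ->
  (\forall t \near p, 1 <= a t) -> continuousC_at p F ->
  continuousC_at p (fun t => radial s d (a t) (F t)).
Proof.
move=> d0 ca a1 cF.
have ca1 : {for p, continuous (fun t => a t - 1 : R)}.
  by apply: continuousB => //; exact: continuous_cst_at.
have cN G : continuousC_at p G -> {for p, continuous (fun t => normc (G t) : R)}.
  exact: continuous_normc.
apply: continuousC_D.
  apply: continuousC_D => //; apply: continuousC_sum => al.
  have cG : continuousC_at p (fun t => F t - al).
    by apply: continuousC_B => //; exact: continuousC_cst.
  have cu : {for p, continuous (fun t => Num.min 1 (normc (F t - al) / d) : R)}.
    apply: continuous_cmin; apply: continuousM; first exact: cN.
    exact: continuous_cst_at.
  have u0 t : 0 <= Num.min 1 (normc (F t - al) / d).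
    by rewrite le_min ler01 divr_ge0 ?normc_ge0// ltW.
  (* at the centre of the disc the exponent may be 0, where the power is not
     continuous in its base; it is bounded by 1, and the other factor vanishes *)
  rewrite /pull; have [Fal|Fal] := eqVneq (F p) al.
    apply: (continuousC_squeeze (b := fun t => normc (F t - al))).
    - by rewrite Fal subrr mul0r.
    - by rewrite Fal subrr normc0.
    - exact: cN.
    - apply: filterS a1 => t at1; rewrite normcM normc_real.
      rewrite ler_piMr ?normc_ge0// ler_norml.
      have h0 := powR_ge0 (Num.min 1 (normc (F t - al) / d)) (a t - 1).
      have h1 : Num.min 1 (normc (F t - al) / d) `^ (a t - 1) <= 1.
        apply: (@le_trans _ _ (1 `^ (a t - 1))); last by rewrite powR1.
        by apply: ge0_ler_powR; rewrite ?nnegrE ?subr_ge0// ge_min lexx.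
      by apply/andP; split; lra.
  apply: continuousC_M => //; apply: continuousC_real.
  apply: continuousB; last exact: continuous_cst_at.
  apply: continuous_powR_at => //; left.
  by rewrite lt_min ltr01 divr_gt0// normc_gt0 subr_eq0.
rewrite /push; apply: continuousC_M => //; apply: continuousC_real.
apply: continuousB; last exact: continuous_cst_at.
apply: continuous_powR_at => //.
- apply: continuous_cmax; apply: continuousM; first exact: cN.
  exact: continuous_cst_at.
- by move=> t; rewrite le_max ler01.
- by left; rewrite lt_max ltr01.
Qed.

Section Trajectory.
Variables (A : nat -> seq R[i]) (r r' : T -> R) (z : T -> R[i]).
Hypotheses (cr : {for p, continuous r}) (cr' : {for p, continuous r'}).
Hypotheses (cz : continuousC_at p z) (rp : 0 < r p).

Lemma continuous_level n : {for p, continuous (fun t => level A (r t) (r' t) n : R)}.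
Proof.
rewrite /level; apply: (@continuous_min R T r (fun t => Num.max (r' t) (threshold A n))) => //.
apply: (@continuous_max R T r' (fun=> threshold A n)) => //.
exact: continuous_cst_at.
Qed.

Lemma continuous_flow n : continuousC_at p (fun t => flow A (r t) (r' t) (z t) n).
Proof.
have nr : \forall t \near p, 0 < r t by exact: (cvgr_gt (r p) cr).
elim: n => [//|n IH] /=; apply: continuousC_radial => //.
- exact: radius_gt0.
- apply: continuousM; first exact: continuous_level.
  apply: continuousV; last exact: continuous_level.
  by rewrite gt_eqF// level_gt0.
- apply: filterS nr => t rt.
  by rewrite ler_pdivlMr ?level_gt0// mul1r level_mono.
Qed.

End Trajectory.
End FlowContinuity.

Section Retraction.
Variables (R : realType) (K : pred R[i]) (k : subFieldType K).
Local Notation X := (A1hyb k).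
Implicit Types (x : X) (f : {poly k}) (r : R) (z : R[i]) (n m : nat).

Lemma countable_enum (T : choiceType) (t0 : T) : countable [set: T] ->
  exists e : nat -> T, forall t, exists n, e n = t.
Proof.
move=> /countable_injP[c cinj].
have h n : exists t, forall u, c u = n -> t = u.
  have [[u cu]|no] := pselect (exists u, c u = n).
    by exists u => v cv; apply: cinj; rewrite ?in_setT// cu cv.
  by exists t0 => u cu; case: no; exists u.
exists (fun n => sval (cid (h n))) => t; exists (c t).
by case: cid => u /= /(_ t erefl).
Qed.

Lemma poly_enum : countable [set: k] ->
  exists e : nat -> {poly k}, forall f, exists n, e n = f.
Proof.
move=> /(countable_enum (0 : k))[e eP].
have /choice[c cP] : forall a : k, exists n, e n = a by exact: eP.
have cI : injective c by move=> a b ab; rewrite -(cP a) ab cP.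
apply: countable_enum (0 : {poly k}) _; apply/countable_injP.
exists (fun f : {poly k} => pickle (map c f)) => f g _ _ fg.
apply: poly_inj; apply: (inj_map cI).
exact: (pcan_inj pickleK) fg.
Qed.

Definition complex_roots f : seq R[i] :=
  sval (closed_field_poly_normal (polyC_of f)).

Lemma complex_rootsP f al : f != 0 -> root (polyC_of f) al -> al \in complex_roots f.
Proof.
move=> f0; rewrite /complex_roots; case: closed_field_poly_normal => l /= {1}->.
by rewrite rootZ ?lead_coef_eq0 ?map_poly_eq0// root_prod_XsubC.
Qed.

Variable e : nat -> {poly k}.
Hypothesis eP : forall f, exists n, e n = f.

(** The roots that the first [n] stages of the flow take into account. They
    exhaust the complex numbers algebraic over [k]: this is where countability
    is needed. *)
Fixpoint active n : seq R[i] :=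
  if n is n'.+1 then active n' ++ complex_roots (e n') else [::].

Lemma active_mono m n : (m <= n)%N -> {subset active m <= active n}.
Proof.
move=> /subnK <-; elim: (n - m)%N => [//|i IH] al alm.
by rewrite addSn /= mem_cat IH.
Qed.

Local Notation lev := (level active).
Local Notation pos := (flow active).

Let lev01 r r' n : 0 < r <= 1 -> 0 < lev r r' n <= 1.
Proof.
move=> /andP[r0 r1]; rewrite level_gt0//=.
exact: le_trans (level_le _ _ _ _) r1.
Qed.

Definition flow_value f r r' z n : R := arch_value (lev r r' n) (pos r r' z n) f.

(** The stage [n0] does not depend on the trajectory, so the limit depends
    continuously on it. *)
Lemma flow_value_uniform f (d : R) : 0 < d -> exists n0, forall r r' z m, 0 < r ->
  (n0 <= m)%N -> within_factor d (flow_value f r r' z m) (flow_value f r r' z n0).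
Proof.
move=> d0; have [->|f0] := eqVneq f 0.
  exists 0%N => r r' z m r0 _.
  rewrite /flow_value /arch_value /polyC_of rmorph0 !horner0.
  rewrite normc0 !powR0 ?gt_eqF ?level_gt0//.
have [i ei] := eP f.
have : (small R n : R) @[n --> \oo] --> 0.
  by apply: cvg_expr; rewrite ger0_norm ?invr_ge0// invf_lt1// ltr1n.
move=> cs.
have s0 : 0 < spread f + 1 by rewrite ltr_wpDl ?spread_ge0.
have [j _ hj] : \forall n \near \oo, small R n < d / (spread f + 1).
  by apply: (cvgr_lt 0 cs); rewrite divr_gt0.
set n0 := maxn i.+1 j; exists n0 => r r' z m r0 nm.
have : small R n0 < d / (spread f + 1) by apply: hj; rewrite /= leq_maxr.
rewrite ltr_pdivlMr// => sd.
have := flow_value_close active_mono r' z r0 f0 _ nm.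
move=> /(_ _) cl; apply: factor_le (cl _); rewrite ?powR_ge0//.
  have := small_gt0 R n0; lra.
move=> al al_r; apply: (active_mono (leq_maxl i.+1 j)).
by rewrite /= mem_cat ei complex_rootsP ?orbT.
Qed.

Lemma flow_limit_exists r r' z : exists x : X, 0 < r <= 1 ->
  forall f, flow_value f r r' z n @[n --> \oo] --> x f.
Proof.
have [r01|nr] := boolP (0 < r <= 1); last by exists (arch_point k 1 0).
have /andP[r0 _] := r01.
pose u n := arch_point k (lev r r' n) (pos r r' z n).
have uE n f : u n f = flow_value f r r' z n by rewrite arch_pointE// lev01.
have cv f : cvgn (flow_value f r r' z).
  apply: factor_cvg => [n|d d0]; first exact: powR_ge0.
  have [n0 h] := flow_value_uniform f d0; exists n0 => m nm; exact: h.
have [x xE] : exists x : X, forall f, x f = limn (flow_value f r r' z).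
  apply: (@A1hyb_limit _ _ _ u) => f.
  rewrite (_ : (fun n => u n f) = flow_value f r r' z); first exact: cv.
  by apply/funext => n; rewrite uE.
by exists x => _ f; rewrite xE; exact: cv.
Qed.

(** The end of the flow line through [z], travelling from level [r] down to
    level [r']. *)
Definition flow_limit r r' z : X := sval (cid (flow_limit_exists r r' z)).

Lemma flow_limitP r r' z f : 0 < r <= 1 ->
  flow_value f r r' z n @[n --> \oo] --> flow_limit r r' z f.
Proof. by move=> r01; rewrite /flow_limit; case: cid => x /= /(_ r01). Qed.

Lemma flow_limit_close f (d : R) : 0 < d -> exists n0, forall r r' z, 0 < r <= 1 ->
  within_factor d (flow_limit r r' z f) (flow_value f r r' z n0).
Proof.
move=> d0; have [n0 h] := flow_value_uniform f d0; exists n0 => r r' z r01.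
have /andP[r0 _] := r01.
have cl := @flow_limitP r r' z f r01.
have cst (c : R) : (fun=> c : R) @ \oo --> c by exact: cvg_cst.
have near_ge : \forall n \near \oo, (n0 <= n)%N by exact: nbhs_infty_ge.
split.
  apply: (ler_cvg_to cl (cst _)); apply: filterS near_ge => n nn.
  by case: (h r r' z n r0 nn).
apply: (ler_cvg_to (cst _) (cvgM (cst _) cl)); apply: filterS near_ge => n nn.
by case: (h r r' z n r0 nn).
Qed.

Definition retraction (p : R * X) : X :=
  if lambda p.2 == 0 then p.2
  else flow_limit (lambda p.2) ((1 - p.1) * lambda p.2) (arch_coord p.2).

Let lam01 x : lambda x != 0 -> 0 < lambda x <= 1.
Proof. by move=> l0; rewrite lambda_le1 andbT lt_def l0 lambda_ge0. Qed.

Lemma level_below r r' n : r <= threshold active n -> lev r r' n = r.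
Proof. by move=> rc; rewrite /level min_l// le_max rc orbT. Qed.

Lemma level_self r n : lev r r n = r.
Proof. by rewrite /level min_l// le_max lexx. Qed.

Lemma flow_below r r' z n : 0 < r -> r <= threshold active n -> pos r r' z n = z.
Proof.
move=> r0 rn; have : forall m, (m <= n)%N -> pos r r' z m = z.
  elim=> [//|m IH] mn; rewrite flow_stable_step ?IH ?(ltnW mn)//.
  by rewrite !level_below// (le_trans rn)// threshold_mono// ltnW.
by apply.
Qed.

Lemma flow_self r z n : 0 < r -> pos r r z n = z.
Proof.
move=> r0; elim: n => [//|n IH].
by rewrite flow_stable_step ?IH// !level_self.
Qed.

(** Near the non-Archimedean fibre the level is already below the first
    thresholds: the first stages do nothing, and the limit is close to the
    starting point. Elsewhere the first stages are continuous. *)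
Lemma continuous_retraction : continuous retraction.
Proof.
move=> p; apply: A1hyb_continuous_at => f.
have c1 : {for p, continuous (fun q : R * X => q.1)} by exact: cvg_fst.
have c2 : {for p, continuous (fun q : R * X => q.2)} by exact: cvg_snd.
have cl : {for p, continuous (fun q : R * X => lambda q.2 : R)}.
  by apply: (@continuous_comp _ _ _ (fun q : R * X => q.2) (@lambda R K k)) => //; exact: continuous_lambda.
have clr : {for p, continuous (fun q : R * X => (1 - q.1) * lambda q.2 : R)}.
  apply: continuousM => //; apply: continuousB => //; exact: continuous_cst_at.
apply: factor_continuous => [q|d d0]; first exact: seminorm_ge0.
have [n0 hn] := flow_limit_close f d0.
have [l0|l0] := eqVneq (lambda p.2) 0.
  exists (fun q : R * X => q.2 f).
    split; first by move=> q; exact: seminorm_ge0.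
    apply: (@continuous_comp _ _ _ (fun q : R * X => q.2) (fun y : X => y f)) => //.
    exact: continuous_eval.
  have nl : \forall q \near p, lambda q.2 < threshold active n0.
    by apply: (cvgr_lt (lambda p.2) cl); rewrite l0 threshold_gt0.
  apply: filterS nl => q ql; rewrite /retraction.
  case: eqVneq => [_|q0].
    by apply: factor_refl; [exact: ltW|exact: seminorm_ge0].
  have q01 := lam01 q0; have /andP[qp _] := q01.
  have := hn (lambda q.2) ((1 - q.1) * lambda q.2) (arch_coord q.2) q01.
  rewrite /flow_value level_below ?flow_below//; [|exact: ltW|exact: ltW].
  by rewrite -arch_pointE// -arch_coordK.
have lp := lam01 l0; have /andP[lp0 _] := lp.
exists (fun q : R * X => flow_value f (lambda q.2) ((1 - q.1) * lambda q.2) (arch_coord q.2) n0).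
  split; first by move=> q; exact: powR_ge0.
  apply: continuous_arch_value.
  - exact: continuous_level.
  - apply: continuous_flow => //.
    have [h1 h2] := continuous_coord lp0.
    split.
      exact: (@continuous_comp _ _ _ (fun q : R * X => q.2) (fun y : X => Re (arch_coord y))).
    exact: (@continuous_comp _ _ _ (fun q : R * X => q.2) (fun y : X => Im (arch_coord y))).
  - by left; exact: level_gt0.
have nl : \forall q \near p, 0 < lambda q.2 by exact: (cvgr_gt (lambda p.2) cl).
apply: filterS nl => q ql; rewrite /retraction gt_eqF//.
by apply: hn; rewrite ql lambda_le1.
Qed.

Lemma retraction0 x : retraction (0, x) = x.
Proof.
rewrite /retraction /=; case: eqVneq => // l0.
have l01 := lam01 l0; have /andP[lp0 _] := l01.
apply: A1hyb_eq => f; rewrite subr0 mul1r.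
have := @flow_limitP (lambda x) (lambda x) (arch_coord x) f l01.
rewrite (_ : (fun n => _) = fun=> x f); last first.
  apply/funext => n; rewrite /flow_value level_self flow_self//.
  by rewrite -arch_pointE// -arch_coordK.
move=> h; apply: (@cvg_unique _ (@norm_hausdorff _ _) _ _ _ _ h).
exact: cvg_cst.
Qed.

Lemma retraction1 x : A1triv k (retraction (1, x)).
Proof.
rewrite /retraction /=; case: eqVneq => // l0.
have l01 := lam01 l0; have /andP[lp0 _] := l01.
rewrite subrr mul0r; apply: lambda_unique => a.
have := @flow_limitP (lambda x) 0 (arch_coord x) a%:P l01.
rewrite /norm_infty_pow eqxx /norm_triv.
have lev0 : (lev (lambda x) 0 n : R) @[n --> \oo] --> 0.
  have cst (c : R) : (fun=> c : R) @ \oo --> c by exact: cvg_cst.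
  apply: (squeeze_cvgr _ (cst 0)); last first.
    apply: cvg_expr; first by instantiate (1 := 2^-1); rewrite ger0_norm ?invr_ge0// invf_lt1// ltr1n.
  apply: nearW => n; rewrite (ltW (level_gt0 _ _ lp0 _))/=.
  apply: le_trans (threshold_small active n).
  by rewrite /level ge_min max_r ?lexx ?orbT// ltW// threshold_gt0.
have [->|a0] := eqVneq a 0.
  rewrite (_ : (fun n => _) = fun=> 0); last first.
    apply/funext => n; rewrite /flow_value arch_valueC norm_infty0 powR0//.
    by rewrite gt_eqF// level_gt0.
  move=> h; apply: (@cvg_unique _ (@norm_hausdorff _ _) _ _ _ _ h).
  exact: cvg_cst.
move=> h; apply: (@cvg_unique _ (@norm_hausdorff _ _) _ _ _ _ h).
have na := norm_infty_gt0 a0.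
rewrite (_ : (fun n => _) = fun n => expR (lev (lambda x) 0 n * ln (norm_infty a))); last first.
  by apply/funext => n; rewrite /flow_value arch_valueC /powR gt_eqF.
have : expR (lev (lambda x) 0 n * ln (norm_infty a)) @[n --> \oo]
    --> expR (0 * ln (norm_infty a)).
  apply: continuous_cvg; first exact: continuous_expR.
  exact: (cvgM lev0 (cvg_cst _)).
by rewrite mul0r expR0.
Qed.

Lemma retraction_sdr : strong_deformation_retraction (A1triv k) retraction.
Proof.
split.
- exact: continuous_subspaceT continuous_retraction.
- exact: retraction0.
- exact: retraction1.
- by move=> t y _ yt; rewrite /retraction /= yt eqxx.
Qed.

End Retraction.

(** * Contracting the non-Archimedean fibre *)

Section GaussNorm.
Variables (R : realType) (B : comNzRingType) (p : B -> R).
Hypotheses (p_ge0 : forall a, 0 <= p a) (p0 : p 0 = 0).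
Hypothesis pM : forall a b, p (a * b) = p a * p b.
Hypothesis pD : forall a b, p (a + b) <= Num.max (p a) (p b).
Hypothesis pN : forall a, p (- a) = p a.
Variable s : R.
Hypothesis s0 : 0 <= s.
Implicit Types F G : {poly B}.

Definition gauss_norm F : R := \big[Num.max/0]_(i < size F) (p F`_i * s ^+ i).

Let term_ge0 F i : 0 <= p F`_i * s ^+ i.
Proof. by rewrite mulr_ge0// exprn_ge0. Qed.

Lemma gauss_norm_ge0 F : 0 <= gauss_norm F.
Proof. by apply: (big_ind (fun v => 0 <= v)) => // x y x0 _; rewrite le_max x0. Qed.

Lemma gauss_norm_coef F i : p F`_i * s ^+ i <= gauss_norm F.
Proof.
have [iF|iF] := ltnP i (size F); last first.
  by rewrite nth_default// p0 mul0r gauss_norm_ge0.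
rewrite /gauss_norm (bigD1 (Ordinal iF))//= le_max lexx//.
Qed.

Lemma gauss_norm_le F M : 0 <= M -> (forall i, p F`_i * s ^+ i <= M) ->
  gauss_norm F <= M.
Proof.
by move=> M0 h; apply: (big_ind (fun v => v <= M)) => // x y x0 y0; rewrite ge_max x0.
Qed.

Lemma gauss_normD F G :
  gauss_norm (F + G) <= Num.max (gauss_norm F) (gauss_norm G).
Proof.
apply: gauss_norm_le => [|i]; first by rewrite le_max gauss_norm_ge0.
rewrite coefD; apply: le_trans (ler_wpM2r (exprn_ge0 i s0) (pD _ _)) _.
have [_|_] := leP (p F`_i) (p G`_i).
  by rewrite le_max gauss_norm_coef orbT.
by rewrite le_max gauss_norm_coef.
Qed.

Let bound_sum (I : finType) (P : pred I) (a : I -> B) (c M : R) :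
  0 <= c -> 0 < M -> (forall i, P i -> p (a i) * c < M) ->
  p (\sum_(i | P i) a i) * c < M.
Proof.
move=> c0 M0 h; apply: (big_ind (fun b => p b * c < M)) => //.
  by rewrite p0 mul0r.
move=> x y xM yM; apply: le_lt_trans (ler_wpM2r c0 (pD _ _)) _.
by case: (leP (p x) (p y)).
Qed.

(** The first index where the norm is attained. *)
Let first_max F : 0 < gauss_norm F -> exists i0,
  p F`_i0 * s ^+ i0 = gauss_norm F /\
  forall i, (i < i0)%N -> p F`_i * s ^+ i < gauss_norm F.
Proof.
move=> F0.
have [i hi] : exists i, p F`_i * s ^+ i == gauss_norm F.
  have [//|no] := pselect (exists i, p F`_i * s ^+ i == gauss_norm F).
  exfalso; suff : gauss_norm F < gauss_norm F by rewrite ltxx.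
  rewrite {1}/gauss_norm; apply: (big_ind (fun v => v < gauss_norm F)) => // [x y xF yF|i _].
    by rewrite gt_max xF.
  rewrite lt_neqAle gauss_norm_coef andbT; apply/negP => hi.
  by apply: no; exists i.
have ex : exists i, p F`_i * s ^+ i == gauss_norm F by exists i.
exists (ex_minn ex); case: ex_minnP => m /eqP hm mmin; split => // j jm.
rewrite lt_neqAle gauss_norm_coef andbT; apply/negP => /mmin.
by rewrite leqNgt jm.
Qed.

(** Gauss's lemma: the terms that attain the norms with the smallest indices have
    a product that no other term of the convolution can cancel. *)
Lemma gauss_normM F G : gauss_norm (F * G) = gauss_norm F * gauss_norm G.
Proof.
apply/eqP; rewrite eq_le; apply/andP; split.
  apply: gauss_norm_le => [|n]; first by rewrite mulr_ge0 ?gauss_norm_ge0.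
  rewrite coefM; apply: (big_ind (fun b => p b * s ^+ n <= _)).
  - by rewrite p0 mul0r mulr_ge0 ?gauss_norm_ge0.
  - move=> x y xM yM; apply: le_trans (ler_wpM2r (exprn_ge0 _ s0) (pD _ _)) _.
    by case: (leP (p x) (p y)).
  - move=> [i /= iN] _.
    have -> : s ^+ n = s ^+ i * s ^+ (n - i) by rewrite -exprD subnKC.
    by rewrite pM mulrACA ler_pM// gauss_norm_coef.
have [F0|F0] := eqVneq (gauss_norm F) 0; first by rewrite F0 mul0r gauss_norm_ge0.
have [G0|G0] := eqVneq (gauss_norm G) 0; first by rewrite G0 mulr0 gauss_norm_ge0.
have {}F0 : 0 < gauss_norm F by rewrite lt_def F0 gauss_norm_ge0.
have {}G0 : 0 < gauss_norm G by rewrite lt_def G0 gauss_norm_ge0.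
have [i0 [Fi0 Fi]] := first_max F0; have [j0 [Gj0 Gj]] := first_max G0.
set n := (i0 + j0)%N; set M := _ * _.
have M0 : 0 < M by rewrite mulr_gt0.
have i0n : (i0 < n.+1)%N by rewrite ltnS leq_addr.
have c0 : 0 <= s ^+ n by rewrite exprn_ge0.
have sn i : (i <= n)%N -> s ^+ n = s ^+ i * s ^+ (n - i).
  by move=> iN; rewrite -exprD subnKC.
pose rest := \sum_(i < n.+1 | i != Ordinal i0n) F`_i * G`_(n - i).
have small_rest : p rest * s ^+ n < M.
  apply: bound_sum => // -[i /= iN]; rewrite -val_eqE /= => ne.
  rewrite pM (sn i)// mulrACA.
  have [lt|ge] := ltnP i i0.
    apply: (@le_lt_trans _ _ (p F`_i * s ^+ i * gauss_norm G)).
      by rewrite ler_wpM2l// gauss_norm_coef.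
    by rewrite ltr_pM2r// Fi.
  have {ge ne} lt : (n - i < j0)%N.
    have lti : (i0 < i)%N by rewrite ltn_neqAle eq_sym ne.
    by rewrite ltn_subLR// /n ltn_add2r.
  apply: (@le_lt_trans _ _ (gauss_norm F * (p G`_(n - i) * s ^+ (n - i)))).
    by rewrite ler_wpM2r// gauss_norm_coef.
  by rewrite ltr_pM2l// Gj.
have main : p (F`_i0 * G`_j0) * s ^+ n = M.
  by rewrite pM (sn i0) ?leq_addr// /n addKn mulrACA Fi0 Gj0.
have e : (F * G)`_n = F`_i0 * G`_j0 + rest.
  rewrite coefM (bigD1 (Ordinal i0n))//= /n addKn//.
have : M <= Num.max (p (F * G)`_n * s ^+ n) (p rest * s ^+ n).
  rewrite -main -[F`_i0 * _](addrK rest) -e.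
  apply: le_trans (ler_wpM2r c0 (pD _ _)) _; rewrite pN.
  by case: (leP (p (F * G)`_n) (p rest)) => h; rewrite le_max lexx ?orbT.
rewrite le_max => /orP[h|h]; last by have := lt_le_trans small_rest h; rewrite ltxx.
exact: le_trans h (gauss_norm_coef _ _).
Qed.

End GaussNorm.

Section TrivialFibre.
Variables (R : realType) (K : pred R[i]) (k : subFieldType K).
Local Notation X := (A1hyb k).
Implicit Types (x y : X) (f g : {poly k}) (s : R).

Lemma triv_const y (c : k) : lambda y = 0 -> y c%:P = (c != 0)%:R.
Proof. by move=> y0; rewrite lambdaE y0 /norm_infty_pow eqxx. Qed.

Lemma bernoulli (h : R) n : 0 <= h -> 1 + n%:R * h <= (1 + h) ^+ n.
Proof.
move=> h0; elim: n => [|n IH]; first by rewrite mul0r addr0.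
rewrite exprS; apply: le_trans (ler_wpM2l _ IH); last by lra.
have : 0 <= n%:R * h * h by rewrite !mulr_ge0.
by rewrite -natr1; lra.
Qed.

Lemma subexponential_bound (A M : R) : 0 <= A -> 0 <= M ->
  (forall n, A ^+ n <= n.+1%:R * M ^+ n) -> A <= M.
Proof.
move=> A0 M0 h; rewrite leNgt; apply/negP => MA.
have [M00|Mn0] := eqVneq M 0.
  by have := h 1%N; rewrite M00 !expr1 mulr0 leNgt -M00 MA.
have {Mn0}M0 : 0 < M by rewrite lt_def Mn0.
pose q := A / M - 1.
have q0 : 0 < q by rewrite subr_gt0 ltr_pdivlMr// mul1r.
have hq n : (1 + q) ^+ n <= n.+1%:R.
  by rewrite /q addrC subrK expr_div_n ler_pdivrMr ?exprn_gt0.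
have q20 : 0 <= 2 / q ^+ 2 by rewrite divr_ge0// sqr_ge0.
have := archi_boundP q20; set n := Num.bound _.
rewrite ltr_pdivrMr ?exprn_gt0// => nq.
have h0 : 0 <= 1 + n%:R * q by rewrite addr_ge0// mulr_ge0// ltW.
have h1 : (1 + n%:R * q) ^+ 2 <= ((1 + q) ^+ n) ^+ 2.
  have bn := bernoulli n (ltW q0).
  by rewrite ler_pXn2r// nnegrE; exact: le_trans bn.
rewrite -exprM in h1; have {}h1 := le_trans h1 (hq (n * 2)%N).
move: h1; rewrite -natr1 natrM => h1.
have n0 : 0 <= n%:R :> R by [].
have n1 : 0 < n%:R :> R.
  rewrite lt_def n0 andbT; apply: contraTneq nq => ->.
  by rewrite mul0r -leNgt.
have h2 : n%:R * 2 < n%:R * (n%:R * q ^+ 2) by rewrite ltr_pM2l.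
have h3 : 0 < n%:R * q by rewrite mulr_gt0.
by move: h1 h2 h3; rewrite !expr2; lra.
Qed.

(** Integers have norm at most 1 in the trivial fibre, so the triangle
    inequality for high powers becomes ultrametric. *)
Lemma triv_ultrametric y f g : lambda y = 0 -> y (f + g) <= Num.max (y f) (y g).
Proof.
move=> y0; set M := Num.max _ _.
have M0 : 0 <= M by rewrite le_max seminorm_ge0.
apply: subexponential_bound => // [|n]; first exact: seminorm_ge0.
have ynat (m : nat) h : y (h *+ m) <= y h.
  rewrite -mulr_natl -polyC_natr seminormM triv_const//.
  by rewrite ler_piMl ?seminorm_ge0// lern1 leq_b1.
have ysum (I : Type) (l : seq I) (F : I -> {poly k}) :
    y (\sum_(i <- l) F i) <= \sum_(i <- l) y (F i).
  elim: l => [|i l IH]; first by rewrite !big_nil seminorm0.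
  by rewrite !big_cons; apply: le_trans (seminormD _ _ _) _; rewrite lerD2l.
rewrite -seminormX exprDn; apply: le_trans (ysum _ _ _) _.
apply: (@le_trans _ _ (\sum_(i < n.+1) M ^+ n)); last first.
  by rewrite sumr_const card_ord mulr_natl.
apply: ler_sum => -[i /= iN] _; apply: le_trans (ynat _ _) _.
rewrite seminormM !seminormX -(subnK (iN : (i <= n)%N)) addnK exprD.
by rewrite ler_pM ?exprn_ge0 ?seminorm_ge0// lerXn2r ?nnegrE ?seminorm_ge0//
  le_max lexx ?orbT.
Qed.

Lemma triv_opp y f : lambda y = 0 -> y (- f) = y f.
Proof.
move=> y0; rewrite -mulN1r seminormM -polyC1 -polyCN triv_const//.
by rewrite oppr_eq0 oner_eq0 mul1r.
Qed.

(** Taylor expansion, as a ring morphism: [f] is sent to [f('X + U)]. *)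
Definition taylor f : {poly {poly k}} := map_poly polyC f \Po ('X + ('X)%:P).

Lemma taylorM f g : taylor (f * g) = taylor f * taylor g.
Proof. by rewrite /taylor !rmorphM. Qed.

Lemma taylorD f g : taylor (f + g) = taylor f + taylor g.
Proof. by rewrite /taylor !rmorphD. Qed.

Lemma taylorC (a : k) : taylor a%:P = a%:P%:P.
Proof. by rewrite /taylor map_polyC comp_polyC. Qed.

Lemma taylorX : taylor 'X = 'X + ('X)%:P.
Proof. by rewrite /taylor map_polyX comp_polyX. Qed.

Lemma taylor_coef0 f : (taylor f)`_0 = f.
Proof.
rewrite -horner_coef0 /taylor horner_comp hornerD hornerX hornerC add0r.
exact: comp_polyXr.
Qed.

Lemma size_taylor f : size (taylor f) = size f.
Proof.
have s2 : size ('X + ('X : {poly k})%:P) = 2%N by rewrite -['X%:P]opprK -polyCN size_XsubC.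
by rewrite /taylor size_comp_poly2// size_map_inj_poly//; exact: polyC_inj.
Qed.

Lemma lead_coef_taylor f : lead_coef (taylor f) = (lead_coef f)%:P.
Proof.
have E : 'X + ('X : {poly k})%:P = 'X - (- 'X)%:P by rewrite polyCN opprK.
rewrite /taylor lead_coef_comp; last by rewrite E size_XsubC.
rewrite E lead_coefXsubC expr1n mulr1 lead_coef_map_inj//; exact: polyC_inj.
Qed.

Definition disc_value y s f : R := gauss_norm y s (taylor f).

Lemma disc_point_exists y s : exists x, lambda y = 0 -> 0 <= s ->
  forall f, x f = disc_value y s f.
Proof.
have [[y0 s0]|no] := pselect (lambda y = 0 /\ 0 <= s); last first.
  by exists y => y0 s0; case: no.
have h0 := seminorm_ge0 y; have h1 := seminorm0 y.
have hM := seminormM y; have hD f g := triv_ultrametric f g y0.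
have hN f := triv_opp f y0.
have constE (a : k) : disc_value y s a%:P = y a%:P.
  rewrite /disc_value taylorC; apply/eqP; rewrite eq_le; apply/andP; split.
    apply: gauss_norm_le => // -[|i]; first by rewrite coefC eqxx expr0 mulr1.
    by rewrite coefC /= h1 mul0r.
  by have := gauss_norm_coef h0 h1 s0 (a%:P%:P) 0; rewrite coefC eqxx expr0 mulr1.
have ms : multiplicative_seminorm (disc_value y s).
  split.
  - by move=> f; exact: gauss_norm_ge0.
  - by rewrite -polyC0 constE.
  - by rewrite -polyC1 constE polyC1 seminorm1.
  - by move=> f g; rewrite /disc_value taylorM gauss_normM.
  - move=> f g; rewrite /disc_value taylorD.
    apply: le_trans (gauss_normD h0 h1 hD s0 _ _) _.
    by rewrite ge_max lerDl lerDr !gauss_norm_ge0.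
have le a : disc_value y s a%:P <= norm_hyb a by rewrite constE; exact: seminorm_at_le.
by exists (A1Hyb ms le).
Qed.

(** The point obtained from [y] by enlarging its disc to radius at least
    [s]. *)
Definition disc_point y s : X := sval (cid (disc_point_exists y s)).

Lemma disc_pointE y s f : lambda y = 0 -> 0 <= s ->
  disc_point y s f = disc_value y s f.
Proof. by move=> y0 s0; rewrite /disc_point; case: cid => x /= /(_ y0 s0). Qed.

Lemma disc_point0 y : lambda y = 0 -> disc_point y 0 = y.
Proof.
move=> y0; apply: A1hyb_eq => f; rewrite disc_pointE// /disc_value.
have h0 := seminorm_ge0 y; have h1 := seminorm0 y.
apply/eqP; rewrite eq_le; apply/andP; split.
  apply: gauss_norm_le => // -[|i]; first by rewrite taylor_coef0 expr0 mulr1.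
  by rewrite exprS mul0r mulr0.
have := gauss_norm_coef h0 h1 (lexx 0) (taylor f) 0.
by rewrite taylor_coef0 expr0 mulr1.
Qed.

Definition deg_value s f : R := if f == 0 then 0 else s ^+ (size f).-1.

Lemma deg_point_exists s : exists x, 1 <= s -> forall f, x f = deg_value s f.
Proof.
have [s1|no] := boolP (1 <= s); last first.
  by exists (arch_point k 1 0).
have s0 : 0 <= s by exact: le_trans s1.
have dv0 f : 0 <= deg_value s f.
  by rewrite /deg_value; case: ifP => // _; rewrite exprn_ge0.
have ms : multiplicative_seminorm (deg_value s).
  split => //.
  - by rewrite /deg_value eqxx.
  - by rewrite /deg_value oner_eq0 size_poly1.
  - move=> f g; rewrite /deg_value mulf_eq0.
    have [->|f0] /= := eqVneq f 0; first by rewrite mul0r.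
    have [g0|g0] := eqVneq g 0; first by rewrite /= mulr0.
    rewrite size_mul// -exprD; congr (_ ^+ _).
    by move: f0 g0; rewrite -!size_poly_gt0; case: (size f) (size g) => [|m] [|n]//= _ _; rewrite addnS.
  - move=> f g; rewrite {1}/deg_value; case: eqVneq => [_|fg0].
      by rewrite addr_ge0.
    have : ((size (f + g)%R).-1 <= maxn (size f).-1 (size g).-1)%N.
      rewrite -subn1 leq_subLR; apply: leq_trans (size_polyD _ _) _.
      rewrite geq_max !addn_maxr !leq_max !add1n !leqSpred /= orbT//.
    have [f0|f0] := eqVneq f 0.
      move: fg0; rewrite f0 add0r /deg_value eqxx add0r => /negbTE -> _.
      exact: lexx.
    have [g0|g0] := eqVneq g 0.
      by rewrite g0 addr0 /deg_value eqxx addr0 (negbTE f0).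
    rewrite leq_max => /orP[h|h].
      by rewrite {1}/deg_value (negbTE f0) ler_wpDr//; exact: ler_weXn2l.
    by rewrite {2}/deg_value (negbTE g0) ler_wpDl//; exact: ler_weXn2l.
have le a : deg_value s a%:P <= norm_hyb a.
  rewrite /deg_value polyC_eq0 /norm_hyb /norm_triv le_max.
  by case: eqP => a0; rewrite ?lexx ?orbT// size_polyC; case: eqP => //= _; rewrite expr0 lexx orbT.
by exists (A1Hyb ms le).
Qed.

(** The point of radius [s >= 1] on the branch towards infinity. *)
Definition deg_point s : X := sval (cid (deg_point_exists s)).

Lemma deg_pointE s f : 1 <= s -> deg_point s f = deg_value s f.
Proof. by move=> s1; rewrite /deg_point; case: cid => x /= /(_ s1). Qed.

(** A disc large enough to contain the origin and the unit disc is centred at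
    the origin. *)
Lemma disc_deg_point y s : lambda y = 0 -> 1 <= s -> y 'X <= s ->
  disc_point y s = deg_point s.
Proof.
move=> y0 s1 ys; have s0 : 0 <= s by exact: le_trans s1.
apply: A1hyb_eq => f; rewrite disc_pointE// deg_pointE// /deg_value.
have h0 := seminorm_ge0 y; have h1 := seminorm0 y.
have hM := seminormM y; have hD g h := triv_ultrametric g h y0.
have hN g := triv_opp g y0.
case: eqVneq => [->|f0]; first by rewrite -disc_pointE// seminorm0.
apply/eqP; rewrite eq_le; apply/andP; split; last first.
  have := gauss_norm_coef h0 h1 s0 (taylor f) (size f).-1.
  rewrite -{1}(size_taylor f) -lead_coefE lead_coef_taylor triv_const//.
  by rewrite lead_coef_eq0 f0 mul1r.
have pX : disc_value y s 'X <= s.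
  rewrite /disc_value taylorX; apply: gauss_norm_le => // -[|[|i]].
  - by rewrite coefD coefX coefC /= add0r expr0 mulr1.
  - by rewrite coefD coefX coefC /= addr0 seminorm1 mul1r expr1.
  - by rewrite coefD coefX coefC /= addr0 h1 mul0r.
rewrite -disc_pointE// in pX *.
have mono i : disc_point y s ((f`_i)%:P * 'X^i) <= s ^+ i.
  rewrite seminormM seminormX -[leRHS]mul1r ler_pM ?exprn_ge0 ?seminorm_ge0//.
    rewrite disc_pointE// /disc_value taylorC; apply: gauss_norm_le => // -[|j].
      by rewrite coefC eqxx expr0 mulr1 triv_const// lern1 leq_b1.
    by rewrite coefC /= h1 mul0r.
  by rewrite lerXn2r ?nnegrE ?seminorm_ge0.
have dp g h : disc_point y s (g + h) <= Num.max (disc_point y s g) (disc_point y s h).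
  by rewrite !disc_pointE// /disc_value taylorD; exact: gauss_normD.
rewrite -[leLHS]/(disc_value y s f) -disc_pointE// -{1}[f]coefK poly_def.
apply: (big_ind (fun g => disc_point y s g <= s ^+ (size f).-1)).
- by rewrite seminorm0 exprn_ge0.
- by move=> g h gs hs; apply: le_trans (dp g h) _; rewrite ge_max gs.
- move=> [i /= isz] _; rewrite -mul_polyC; apply: le_trans (mono i) _.
  by apply: ler_weXn2l => //; rewrite -ltnS prednK// (leq_ltn_trans _ isz).
Qed.

Lemma continuous_bigmax (T : topologicalType) (p : T) (n : nat) (F : nat -> T -> R) :
  (forall i, {for p, continuous (F i)}) ->
  {for p, continuous (fun t => \big[Num.max/0]_(i < n) F i t : R)}.
Proof.
elim: n F => [|n IH] F cF.
  rewrite (_ : (fun _ => _) = fun=> 0); first exact: continuous_cst_at.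
  by apply/funext => t; rewrite big_ord0.
rewrite (_ : (fun _ => _) =
    fun t => Num.max (F 0%N t) (\big[Num.max/0]_(i < n) F i.+1 t)).
  have h := IH (fun i => F i.+1) (fun i => cF i.+1).
  exact: (@continuous_max R T (F 0%N) _ p (cF 0%N) h).
by apply/funext => t; rewrite big_ord_recl.
Qed.

Lemma continuous_disc_point (T : topologicalType) (p : T) (y : T -> X) (s : T -> R) :
  {for p, continuous y} -> {for p, continuous s} ->
  (forall t, lambda (y t) = 0) -> (forall t, 0 <= s t) ->
  {for p, continuous (fun t => disc_point (y t) (s t))}.
Proof.
move=> cy cs y0 s0; apply: A1hyb_continuous_at => f.
rewrite (_ : (fun _ => _) = fun t => disc_value (y t) (s t) f); last first.
  by apply/funext => t; rewrite disc_pointE.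
apply: (@continuous_bigmax T p _ (fun i t => y t (taylor f)`_i * s t ^+ i)) => i.
apply: continuousM.
  apply: (@continuous_comp _ _ _ y (fun x : X => x (taylor f)`_i)) => //.
  exact: continuous_eval.
apply: (@continuous_comp _ _ _ s (fun v : R => v ^+ i)) => //.
exact: exprn_continuous.
Qed.

Lemma continuous_deg_point (T : topologicalType) (p : T) (s : T -> R) :
  {for p, continuous s} -> (forall t, 1 <= s t) ->
  {for p, continuous (fun t => deg_point (s t))}.
Proof.
move=> cs s1; apply: A1hyb_continuous_at => f.
rewrite (_ : (fun _ => _) = fun t => deg_value (s t) f); last first.
  by apply/funext => t; rewrite deg_pointE.
rewrite /deg_value; case: eqP => _; first exact: continuous_cst_at.
apply: (@continuous_comp _ _ _ s (fun v : R => v ^+ _)) => //.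
exact: exprn_continuous.
Qed.

End TrivialFibre.

Section Homotopy.
Variables (R : realType) (X : topologicalType).

Definition homotopic (f g : X -> X) : Prop := exists H : R * X -> X,
  [/\ continuous H, forall x, H (0, x) = f x & forall x, H (1, x) = g x].

Lemma homotopic_trans f g h : homotopic f g -> homotopic g h -> homotopic f h.
Proof.
move=> [H [cH H0 H1]] [G [cG G0 G1]].
pose L (p : R * X) := H (Num.min 1 (2 * p.1), p.2).
pose M (p : R * X) := G (Num.max 0 (2 * p.1 - 1), p.2).
have c1 p : {for p, continuous (fun q : R * X => 2 * q.1 : R)}.
  apply: continuousM; first exact: continuous_cst_at.
  exact: cvg_fst.
have cst p (c : R) : {for p, continuous (fun q : R * X => c)} by exact: continuous_cst_at.
have cL : continuous L.
  move=> p; apply: (@continuous_comp _ _ _ (fun q : R * X => (Num.min 1 (2 * q.1), q.2)) H); last exact: cH.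
  apply: (@cvg_pair _ _ _ _ (nbhs (Num.min 1 (2 * p.1))) (nbhs p.2)); last exact: cvg_snd.
  exact: (@continuous_min R _ (fun=> 1) (fun q : R * X => 2 * q.1)).
have cM : continuous M.
  move=> p; apply: (@continuous_comp _ _ _ (fun q : R * X => (Num.max 0 (2 * q.1 - 1), q.2)) G); last exact: cG.
  apply: (@cvg_pair _ _ _ _ (nbhs (Num.max 0 (2 * p.1 - 1))) (nbhs p.2)); last exact: cvg_snd.
  apply: (@continuous_max R _ (fun=> 0) (fun q : R * X => 2 * q.1 - 1)) => //.
  by apply: continuousB.
pose N (p : R * X) := if p.1 <= 2^-1 then L p else M p.
have fst_cont : continuous (fun q : R * X => q.1) by move=> q; exact: cvg_fst.
have cA : closed [set p : R * X | p.1 <= 2^-1].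
  have := @closed_le R 2^-1.
  by move/(@preimage_closed (R * X)%type R (fun q => q.1) _ (fun p _ => fst_cont p)).
have cB : closed [set p : R * X | 2^-1 <= p.1].
  have := @closed_ge R 2^-1.
  by move/(@preimage_closed (R * X)%type R (fun q => q.1) _ (fun p _ => fst_cont p)).
have cN : continuous N.
  apply/continuous_subspace_setT.
  rewrite -[setT](_ : [set p : R * X | p.1 <= 2^-1] `|` [set p : R * X | 2^-1 <= p.1] = setT).
    apply: withinU_continuous => //.
      apply: (@subspace_eq_continuous _ _ _ L); last exact: continuous_subspaceT.
      move=> p; rewrite inE /= => pA.
      by rewrite /from_subspace /N; case: ifPn => // /negP[].
    apply: (@subspace_eq_continuous _ _ _ M); last exact: continuous_subspaceT.
    move=> p; rewrite inE /= => p2; rewrite /from_subspace /N; case: ifPn => // p1.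
    have e : p.1 = 2^-1 by apply/eqP; rewrite eq_le p1.
    by rewrite /L /M e mulfV// subrr minxx maxxx H1 G0.
  by apply/seteqP; split => // p _ /=; apply/orP; exact: le_total.
exists N; split => // x; rewrite /N /=.
  by rewrite invr_ge0 ler0n /L /= mulr0 min_r.
rewrite ifF /M /=; last by apply/negbTE; rewrite -ltNge invf_lt1// ltr1n.
by rewrite mulr1 max_r; [have -> : 2 - 1 = 1 :> R by lra | lra].
Qed.

Lemma homotopic_contractible (x0 : X) : homotopic id (fun=> x0) -> contractible R X.
Proof.
move=> [H [cH H0 H1]]; exists x0, H; split => //.
exact: continuous_subspaceT.
Qed.

End Homotopy.

Section Contraction.
Variables (R : realType) (K : pred R[i]) (k : subFieldType K).
Local Notation X := (A1hyb k).
Variable F : R * X -> X.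
Hypotheses (cF : continuous F) (F0 : forall x, F (0, x) = x)
  (F1 : forall x, lambda (F (1, x)) = 0).

Let end_pt (p : R * X) : X := F (1, p.2).

Let c_end : continuous end_pt.
Proof.
move=> p; apply: (@continuous_comp _ _ _ (fun q : R * X => (1 : R, q.2)) F); last exact: cF.
by apply: (@cvg_pair _ _ _ _ (nbhs (1 : R)) (nbhs p.2)); [exact: cvg_cst|exact: cvg_snd].
Qed.

Let c_var : continuous (fun p : R * X => end_pt p 'X : R).
Proof.
move=> p; apply: (@continuous_comp _ _ _ end_pt (fun x : X => x 'X)).
  exact: c_end.
exact: continuous_eval.
Qed.

(** After reaching the non-Archimedean fibre, every disc is enlarged until it
    contains the origin, and the radius is then brought down to 1. *)
Lemma retract_contractible : contractible R X.
Proof.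
apply: (@homotopic_contractible _ _ (deg_point k 1)).
apply: (@homotopic_trans _ _ _ (fun x => F (1, x))).
  by exists F; split.
have ct p (c : R) : {for p, continuous (fun q : R * X => c)} by exact: continuous_cst_at.
have c1 p : {for p, continuous (fun q : R * X => q.1 : R)} by exact: cvg_fst.
have v0 (p : R * X) : 0 <= end_pt p 'X by exact: seminorm_ge0.
apply: (@homotopic_trans _ _ _ (fun x => deg_point k (1 + F (1, x) 'X))).
  exists (fun p => disc_point (end_pt p) (Num.max 0 p.1 * (1 + end_pt p 'X))).
  split.
  - move=> p; apply: continuous_disc_point => //; first exact: c_end.
    + apply: continuousM.
        exact: (@continuous_max R _ (fun=> 0) (fun q : R * X => q.1)).
      by apply: continuousD => //; exact: c_var.
    + by move=> q; exact: F1.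
    + by move=> q; rewrite mulr_ge0// ?le_max ?lexx// addr_ge0.
  - by move=> x; rewrite /= maxxx mul0r (disc_point0 (F1 _)).
  - move=> x; rewrite /= max_r// mul1r; apply: disc_deg_point; first exact: F1.
      by rewrite lerDl.
    by rewrite /end_pt /= lerDr.
exists (fun p : R * X => deg_point k (1 + Num.max 0 (1 - p.1) * end_pt p 'X)); split.
- move=> p; apply: (@continuous_deg_point _ _ k _ p
    (fun q : R * X => 1 + Num.max 0 (1 - q.1) * end_pt q 'X)).
  + apply: continuousD => //; apply: continuousM; last exact: c_var.
    apply: (@continuous_max R _ (fun=> 0) (fun q : R * X => 1 - q.1)) => //.
    exact: continuousB.
  + by move=> q; rewrite lerDl mulr_ge0// le_max lexx.
- by move=> x; rewrite /= subr0 max_r// mul1r.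
- by move=> x; rewrite /= subrr maxxx mul0r addr0.
Qed.

End Contraction.

(** * Winding numbers *)

Section Winding.
Variable R : realType.
Implicit Types (z w p q : R[i]) (g h : R -> R[i]) (x t : R).

Definition cis t : R[i] := Complex (cos t) (sin t).

Lemma cisD s t : cis (s + t) = cis s * cis t.
Proof. by rewrite /cis cosD sinD; simpc; congr Complex; rewrite addrC. Qed.

Lemma cis0 : cis 0 = 1.
Proof. by rewrite /cis cos0 sin0. Qed.

Lemma normc_cis t : normc (cis t) = 1.
Proof. by rewrite /= cos2Dsin2 sqrtr1. Qed.

Lemma continuous_cis (T : topologicalType) (p : T) (f : T -> R) :
  {for p, continuous f} -> continuousC_at p (fun u => cis (f u)).
Proof.
move=> cf; split.
  apply: (@continuous_comp _ _ _ f (@cos R)) => //; exact: continuous_cos.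
apply: (@continuous_comp _ _ _ f (@sin R)) => //; exact: continuous_sin.
Qed.

Lemma cis_conj t : ((cis t)^*)%C = cis (- t).
Proof. by rewrite /cis cosN sinN. Qed.

Definition dir z : R[i] := z * (((normc z)^-1)%:C)%C.

Lemma dirM z w : dir (z * w) = dir z * dir w.
Proof. by rewrite /dir normcM invfM rmorphM /=; ring. Qed.

Lemma dir_cis t : dir (cis t) = cis t.
Proof. by rewrite /dir normc_cis invr1 mulr1. Qed.

Lemma dir_pos (a : R) : 0 < a -> dir a%:C%C = 1.
Proof.
move=> a0; rewrite /dir normc_real gtr0_norm// -rmorphM /= mulfV ?gt_eqF//.
Qed.

Lemma dir_neq0 z : z != 0 -> dir z != 0.
Proof.
move=> z0; rewrite /dir mulf_neq0//; apply/eqP => /(congr1 (@normc R)).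
by rewrite normc_real normc0 => /eqP; rewrite normr_eq0 invr_eq0
  gt_eqF// normc_gt0.
Qed.

(** The principal argument on the right half plane. *)
Definition half_arg z : R := atan (Im z / Re z).

Lemma half_arg_bound z : `|half_arg z| < pi / 2.
Proof. by rewrite ltr_norml atan_gtNpi2 atan_ltpi2. Qed.

Lemma dir_half_arg z : 0 < Re z -> dir z = cis (half_arg z).
Proof.
move=> z0; rewrite /half_arg; set t := atan _.
have c0 : 0 < cos t.
  by apply: cos_gt0_pihalf; rewrite atan_gtNpi2 atan_ltpi2.
have tt : tan t = Im z / Re z by rewrite atanK.
have zE : z = (Re z / cos t)%:C%C * cis t.
  move: tt; rewrite /tan => tt; rewrite /cis; case: (z) tt z0 => a b /= tt a0; simpc.
  rewrite divfK ?gt_eqF//; congr Complex.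
  by rewrite -mulrA (mulrC _^-1) tt mulrC divfK// gt_eqF.
by rewrite {1}zE dirM dir_pos ?divr_gt0// mul1r dir_cis.
Qed.

Lemma half_arg_cont (T : topologicalType) (p : T) (f : T -> R[i]) :
  continuousC_at p f -> 0 < Re (f p) ->
  {for p, continuous (fun u => half_arg (f u) : R)}.
Proof.
move=> [fr fi] f0; apply: (@continuous_comp _ _ _ (fun u => Im (f u) / Re (f u)) (@atan R)).
  by apply: continuousM => //; apply: continuousV => //; rewrite gt_eqF.
exact: continuous_atan.
Qed.

(** Angle between two nonzero vectors at an acute angle. *)
Definition turn p q : R := half_arg (q * (p^*)%C).

Lemma conj_mul z : z * (z^*)%C = (normc z ^+ 2)%:C%C.
Proof. by rewrite normc_sqr; case: z => a b /=; simpc; congr Complex; ring. Qed.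

Lemma dir_turn p q : p != 0 -> 0 < Re (q * (p^*)%C) -> dir q = dir p * cis (turn p q).
Proof.
move=> p0 pq; rewrite /turn -dir_half_arg// -dirM.
have -> : p * (q * (p^*)%C) = q * (normc p ^+ 2)%:C%C by rewrite -conj_mul; ring.
by rewrite dirM dir_pos ?mulr1// exprn_gt0// normc_gt0.
Qed.

Definition continuousC g : Prop := forall x, continuousC_at x g.

Definition is_lift g (f : R -> R) : Prop :=
  [/\ continuous f, f 0 = 0 &
      forall x, 0 <= x <= 1 -> dir (g x) = dir (g 0) * cis (f x)].

Definition closed_curve g : Prop :=
  [/\ continuousC g, forall x, g x != 0 & g 0 = g 1].

Lemma continuousC_conj (T : topologicalType) (p : T) (f : T -> R[i]) :
  continuousC_at p f -> continuousC_at p (fun u => ((f u)^*)%C).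
Proof.
move=> [fr fi]; split.
  rewrite (_ : (fun _ => _) = (fun u => Re (f u))) //.
  by apply/funext => u; case: (f u).
rewrite (_ : (fun _ => _) = (fun u => - Im (f u))); first exact: continuousN.
by apply/funext => u; case: (f u).
Qed.

Lemma continuousC_comp (T U : topologicalType) (p : T) (f : T -> U) (h : U -> R[i]) :
  {for p, continuous f} -> continuousC_at (f p) h -> continuousC_at p (fun u => h (f u)).
Proof.
move=> cf [hr hi]; split.
  exact: (@continuous_comp _ _ _ f (fun u => Re (h u))).
exact: (@continuous_comp _ _ _ f (fun u => Im (h u))).
Qed.

Lemma Re_conj_mul_gt0 z : z != 0 -> 0 < Re (z * (z^*)%C).
Proof. by move=> z0; rewrite conj_mul /= exprn_gt0// normc_gt0. Qed.

(** Successive values along a fine enough subdivision of [[0, 1]] are at an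
    acute angle. *)
Lemma acute_subdivision g : continuousC g -> (forall x, g x != 0) ->
  exists N : nat, forall x y, 0 <= x <= 1 -> x <= y <= x + N.+1%:R^-1 ->
    0 < Re (g y * ((g x)^*)%C).
Proof.
move=> cg g0.
have cA : compact `[0, 1 : R]%classic by exact: segment_compact.
have /compact_near_coveringP cov := cA.
pose P (h x : R) : Prop := 0 < Re (g (x + h) * ((g x)^*)%C).
have {cov} : \forall h \near (0 : R), `[0, 1]%classic `<=` P h.
  apply: (cov R (nbhs (0 : R)) P (nbhs_filter _)) => x _.
  pose D (u : R * R) : R := Re (g (u.1 + u.2) * ((g u.1)^*)%C).
  have cD : {for (x, 0), continuous D}.
    have c1 : {for (x, 0 : R), continuous (fun u : R * R => u.1)} by exact: cvg_fst.
    have c2 : {for (x, 0 : R), continuous (fun u : R * R => u.2)} by exact: cvg_snd.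
    have [] // : continuousC_at (x, 0 : R) (fun u : R * R => g (u.1 + u.2) * ((g u.1)^*)%C).
    apply: continuousC_M.
      apply: (continuousC_comp (f := fun u : R * R => u.1 + u.2)) => //.
      exact: continuousD.
    apply: continuousC_conj; exact: (continuousC_comp (f := fun u : R * R => u.1)).
  have D0 : 0 < D (x, 0) by rewrite /D /= addr0 Re_conj_mul_gt0.
  exact: (cvgr_gt (D (x, 0)) cD).
move=> /nbhs_ballP[e /= e0 he].
have [N Ne] : exists N : nat, N.+1%:R^-1 < e.
  exists (Num.bound e^-1); rewrite invf_plt ?posrE//.
  apply: lt_trans (archi_boundP _) _; first by rewrite invr_ge0 ltW.
  by rewrite ltr_nat.
exists N => x y x01 /andP[xy yx].
have bh : ball (0 : R) e (y - x).
  rewrite /ball /= sub0r normrN ger0_norm ?subr_ge0//; apply: le_lt_trans Ne.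
  by rewrite lerBlDr addrC.
have xI : `[0, 1]%classic x by rewrite /= in_itv.
by have := he _ bh x xI; rewrite /P (addrC x) subrK.
Qed.

(** The lift adds up the turns along the subdivision. *)
Lemma lift_exists g : continuousC g -> (forall x, g x != 0) ->
  exists f, is_lift g f.
Proof.
move=> cg g0; have [N hN] := acute_subdivision cg g0.
pose c (n : nat) x : R := Num.min x (n%:R / N.+1%:R).
pose f (n : nat) x : R := \sum_(i < n) turn (g (c i x)) (g (c i.+1 x)).
have acute (i : nat) x : (i < N.+1)%N ->
    0 < Re (g (c i.+1 x) * ((g (c i x))^*)%C).
  move=> iN; have [xi|xi] := leP x (i%:R / N.+1%:R).
    have -> : c i.+1 x = c i x.
      rewrite /c !min_l//; apply: le_trans xi _.
      by rewrite ler_pM2r ?invr_gt0// ler_nat.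
    exact: Re_conj_mul_gt0.
  have ci : c i x = i%:R / N.+1%:R by rewrite /c min_r// ltW.
  apply: hN; rewrite ci.
    by rewrite divr_ge0//= ler_pdivrMr// mul1r ler_nat ltnW.
  rewrite /c le_min (ltW xi) ler_pM2r ?invr_gt0// ler_nat leqnSn /=.
  by rewrite ge_min -[i.+1%:R]natr1 mulrDl mul1r lexx orbT.
have cc n x : {for x, continuous (c n : R -> R)}.
  apply: (@continuous_min R R id (fun=> n%:R / N.+1%:R)) => //.
  exact: continuous_cst_at.
have cf n : (n <= N.+1)%N -> continuous (f n).
  elim: n => [_ x|n IH nN x].
    rewrite (_ : f 0%N = fun=> 0); first exact: continuous_cst_at.
    by apply/funext => y; rewrite /f big_ord0.
  rewrite (_ : f n.+1 = fun y => f n y + turn (g (c n y)) (g (c n.+1 y))); last first.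
    by apply/funext => y; rewrite /f big_ord_recr.
  apply: continuousD; first by apply: IH; exact: ltnW.
  apply: half_arg_cont; last exact: acute.
  apply: continuousC_M; first exact: (continuousC_comp (f := c n.+1)).
  by apply: continuousC_conj; exact: (continuousC_comp (f := c n)).
have fE n x : (n <= N.+1)%N -> dir (g (c n x)) = dir (g (c 0%N x)) * cis (f n x).
  elim: n => [_|n IH nN]; first by rewrite /f big_ord0 cis0 mulr1.
  rewrite /f big_ord_recr /= cisD mulrA -IH; last exact: ltnW.
  by apply: dir_turn => //; exact: acute.
have c0 x : 0 <= x -> c 0%N x = 0 by move=> x0; rewrite /c mul0r min_r.
have c1 x : x <= 1 -> c N.+1 x = x by move=> x1; rewrite /c mulfV// min_l.
exists (f N.+1); split; first exact: cf.
  rewrite /f big1// => -[i iN] _ /=.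
  have cz n : c n 0 = 0 by rewrite /c min_l// divr_ge0.
  by rewrite !cz /turn /half_arg conj_mul /= mul0r atan0.
by move=> x /andP[x0 x1]; have := fE N.+1 x (leqnn _); rewrite c1// c0.
Qed.

Lemma IVT_bound (f : R -> R) (b : R) : continuous f -> `|f 0| < b ->
  (forall x, 0 <= x <= 1 -> `|f x| != b) -> `|f 1| < b.
Proof.
move=> cf f0 fb; rewrite ltNge; apply/negP => f1.
have cn : continuous (fun x => `|f x|).
  move=> x; apply: (@continuous_comp _ _ _ f (fun y : R => `|y|)).
    exact: cf.
  exact: norm_continuous.
have [//||c c01 cb] := @IVT R (fun x => `|f x|) 0 1 b ler01.
- exact: continuous_subspaceT.
- by rewrite min_l ?max_r ?(ltW f0) ?f1//; exact: le_trans (ltW f0) f1.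
by have := fb c; rewrite cb eqxx; move: c01; rewrite in_itv /= => h /(_ h).
Qed.

Lemma cis_eq1_small t : cis t = 1 -> `|t| < pi -> t = 0.
Proof.
move=> ct tp.
have cost : cos t = 1 by case: ct.
have s2 : sin (t / 2) = 0.
  have := cosD (t / 2) (t / 2); rewrite -splitr cost -!expr2 => h.
  have := cos2Dsin2 (t / 2) => h2.
  have : sin (t / 2) ^+ 2 = 0 by lra.
  by move/eqP; rewrite sqrf_eq0 => /eqP.
have t2 : `|t / 2| < pi.
  rewrite normrM (ger0_norm (_ : 0 <= 2^-1)) ?invr_ge0//.
  by have := normr_ge0 t; lra.
move: t2; rewrite ltr_norml => /andP[tl tr].
have [t0|t0|t0] := ltgtP (t / 2) 0; last by lra.
- have : 0 < sin (- (t / 2)) by apply: sin_gt0_pi; rewrite oppr_gt0 t0 /=; lra.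
  by rewrite sinN s2 oppr0 ltxx.
- have : 0 < sin (t / 2) by apply: sin_gt0_pi; rewrite t0.
  by rewrite s2 ltxx.
Qed.

Lemma lift_end g f : closed_curve g -> is_lift g f -> cis (f 1) = 1.
Proof.
move=> [_ g0 g01] [_ _ fE]; have := fE 1; rewrite ler01 lexx => /(_ isT) e.
apply: (mulfI (dir_neq0 (g0 0))); rewrite -e mulr1 g01 //.
Qed.

(** The angle between the two curves stays below [pi / 2], while the ends of the
    lifts differ by a multiple of [pi *+ 2]. *)
Lemma lift_compare g h f1 f2 : closed_curve g -> closed_curve h ->
  is_lift g f1 -> is_lift h f2 ->
  (forall x, 0 <= x <= 1 -> 0 < Re (h x * ((g x)^*)%C)) -> f1 1 = f2 1.
Proof.
move=> cg ch lg lh acute.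
have e1 := lift_end cg lg; have e2 := lift_end ch lh.
case: lg lh cg ch => [cf1 f10 f1E] [cf2 f20 f2E] [_ g0 _] [_ h0 _].
pose d := turn (g 0) (h 0).
have dE : dir (h 0) = dir (g 0) * cis d.
  by apply: dir_turn => //; apply: acute; rewrite lexx ler01.
have db : `|d| < pi / 2 by exact: half_arg_bound.
pose psi x := d + f2 x - f1 x.
have cpsi : continuous psi.
  move=> x; apply: (@continuousB _ _ _ (fun y : R => d + f2 y) f1); last exact: cf1.
  apply: (@continuousD _ _ _ (fun=> d) f2); last exact: cf2.
  exact: continuous_cst_at.
have psi_turn x : 0 <= x <= 1 -> cis (psi x) = cis (turn (g x) (h x)).
  move=> x01; have := dir_turn (g0 x) (acute x x01).
  rewrite (f2E x)// dE (f1E x)// -!(mulrA (dir (g 0))) -!cisD => e0.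
  have e := mulfI (dir_neq0 (g0 0)) e0; have -> : psi x = - f1 x + (d + f2 x) by rewrite /psi addrC.
  by rewrite cisD e -cisD addKr.
have psi1 : `|psi 1| < pi / 2.
  apply: IVT_bound => //; first by rewrite /psi f10 f20 subr0 addr0.
  move=> x x01; apply/eqP => px.
  have : cos (psi x) = cos (turn (g x) (h x)) by have := psi_turn x x01; case.
  have : 0 < cos (turn (g x) (h x)).
    by apply: cos_gt0_pihalf; rewrite -ltr_norml half_arg_bound.
  move=> cp e; move: cp; rewrite -e.
  have : psi x = pi / 2 \/ psi x = - (pi / 2).
    by move: px; case: (ger0P (psi x)) => _ <-; [left|right; rewrite opprK].
  by case=> ->; rewrite ?cosN cos_pihalf ltxx.
suff : f2 1 - f1 1 = 0 by move/eqP; rewrite subr_eq0 => /eqP.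
apply: cis_eq1_small.
  by rewrite cisD e2 mul1r -cis_conj e1 conjc1.
have -> : f2 1 - f1 1 = psi 1 - d by rewrite /psi; ring.
by apply: le_lt_trans (ler_normB _ _) _; rewrite [ltRHS]splitr ltrD.
Qed.

(** The total variation of the argument along a closed curve, a multiple of
    [2 * pi]. *)
Definition winding g : R :=
  if pselect (exists f, is_lift g f) is left h then sval (cid h) 1 else 0.

Lemma windingE g f : closed_curve g -> is_lift g f -> winding g = f 1.
Proof.
move=> cg lg; rewrite /winding; case: pselect => [h|[]]; last by exists f.
case: cid => f' /= lf'; have [_ g0 _] := cg.
by apply: (lift_compare cg cg lf' lg) => x _; exact: Re_conj_mul_gt0.
Qed.

Lemma winding_lift g : closed_curve g -> exists2 f, is_lift g f & winding g = f 1.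
Proof.
move=> cg; have [c g0 _] := cg; have [f lf] := lift_exists c g0.
by exists f => //; exact: windingE.
Qed.

Lemma cis_winding g : closed_curve g -> cis (winding g) = 1.
Proof. by move=> cg; have [f lf ->] := winding_lift cg; exact: lift_end lf. Qed.

Lemma winding_close g h : closed_curve g -> closed_curve h ->
  (forall x, 0 <= x <= 1 -> 0 < Re (h x * ((g x)^*)%C)) -> winding g = winding h.
Proof.
move=> cg ch acute; have [f1 l1 ->] := winding_lift cg.
have [f2 l2 ->] := winding_lift ch; exact: lift_compare acute.
Qed.

Lemma winding_cis g (a f : R -> R) : closed_curve g -> continuous f ->
  (forall x, 0 < a x) -> (forall x, 0 <= x <= 1 -> g x = (a x)%:C%C * cis (f x)) ->
  winding g = f 1 - f 0.
Proof.
move=> cg cf a0 gE.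
rewrite (@windingE _ (fun x => f x - f 0))//; split; last 2 first.
- by rewrite subrr.
- move=> x x01; rewrite !gE ?lexx ?ler01// !dirM !dir_pos// !mul1r !dir_cis.
  by rewrite -cisD addrC subrK.
- by move=> x; apply: continuousB; [exact: cf|exact: continuous_cst_at].
Qed.

Lemma winding_const g : closed_curve g -> (forall x, g x = g 0) -> winding g = 0.
Proof.
move=> cg gE; rewrite (@windingE _ (fun=> 0))//; split => //.
- by move=> x; exact: continuous_cst_at.
- by move=> x _; rewrite gE cis0 mulr1.
Qed.

(** By compactness, curves with close parameters are everywhere at an acute
    angle. *)
Lemma winding_loc_const (T : topologicalType) (p : T) (G : T -> R -> R[i]) :
  (forall x, 0 <= x <= 1 ->
     continuousC_at (p, x) (fun u : T * R => G u.1 u.2)) ->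
  (\forall v \near p, closed_curve (G v)) ->
  \forall v \near p, winding (G v) = winding (G p).
Proof.
move=> cG nG; have Gp : closed_curve (G p) by exact: (nbhs_singleton nG).
have [cGp Gp0 _] := Gp.
have cA : compact `[0, 1 : R]%classic by exact: segment_compact.
have /compact_near_coveringP cov := cA.
pose P (v : T) x : Prop := 0 < Re (G v x * ((G p x)^*)%C).
have acute : \forall v \near p, `[0, 1]%classic `<=` P v.
  apply: (cov T (nbhs p) P (nbhs_filter _)) => x x01.
  have {}x01 : 0 <= x <= 1 by move: x01; rewrite /= in_itv.
  pose D (u : R * T) : R := Re (G u.2 u.1 * ((G p u.1)^*)%C).
  have cD : {for (x, p), continuous D}.
    have c1 : {for (x, p), continuous (fun u : R * T => u.1)} by exact: cvg_fst.
    have c2 : {for (x, p), continuous (fun u : R * T => u.2)} by exact: cvg_snd.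
    have [] // : continuousC_at (x, p) (fun u : R * T => G u.2 u.1 * ((G p u.1)^*)%C).
    apply: continuousC_M.
      apply: (continuousC_comp (f := fun u : R * T => (u.2, u.1))
                (h := fun u : T * R => G u.1 u.2)); last exact: cG.
      exact: (cvg_pair c2 c1).
    apply: continuousC_conj; exact: (continuousC_comp (f := fun u : R * T => u.1)).
  have D0 : 0 < D (x, p) by rewrite /D /= Re_conj_mul_gt0.
  exact: (cvgr_gt (D (x, p)) cD).
apply: filterS2 nG acute => v Gt ac; apply/esym; apply: winding_close => // x x01.
Qed.

End Winding.

(** * Tubes around the branches of the non-Archimedean fibre *)

Section Clamp.
Variable R : realType.
Implicit Types t x : R.

Definition clamp t : R := Num.max 0 (Num.min 1 t).

Lemma clamp_ge0 t : 0 <= clamp t.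
Proof. by rewrite le_max lexx. Qed.

Lemma clamp_le1 t : clamp t <= 1.
Proof. by rewrite ge_max ler01 ge_min lexx. Qed.

Lemma clamp_id t : 0 <= t <= 1 -> clamp t = t.
Proof. by move=> /andP[t0 t1]; rewrite /clamp min_r// max_r. Qed.

Lemma clamp_le0 t : t <= 0 -> clamp t = 0.
Proof. by move=> t0; rewrite /clamp min_r ?(le_trans t0)// max_l. Qed.

Lemma clamp_ge1 t : 1 <= t -> clamp t = 1.
Proof. by move=> t1; rewrite /clamp min_l// max_r. Qed.

Lemma clamp_gt0 t : 0 < t -> 0 < clamp t.
Proof. by move=> t0; rewrite lt_max lt_min ltr01 t0 orbT. Qed.

Lemma continuous_clamp (T : topologicalType) (p : T) (f : T -> R) :
  {for p, continuous f} -> {for p, continuous (fun u => clamp (f u) : R)}.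
Proof. by move=> cf; apply: continuous_cmax; exact: continuous_cmin. Qed.

End Clamp.

Section Tube.
Variables (R : realType) (K : pred R[i]) (k : subFieldType K) (a : k).
Local Notation X := (A1hyb k).
Implicit Types (f g : {poly k}) (u : R * R * R) (s : R) (m : nat).

(** Distance to [a] at tube parameters [(tau, s)]: raised to the power
    [tau ^+ 2] it is [s * expR (- tau)], and the factor [expR (- tau^-1)] makes
    it tend to 0 with [tau] uniformly in [s]. *)
Definition tube_radius u : R :=
  if clamp u.1.1 == 0 then 0
  else clamp u.1.2 `^ ((clamp u.1.1 ^+ 2)^-1) * expR (- (clamp u.1.1)^-1).

Definition tube_center u : R[i] :=
  val a + (tube_radius u)%:C%C * cis (pi *+ 2 * u.2).

Lemma tube_radius_ge0 u : 0 <= tube_radius u.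
Proof.
rewrite /tube_radius; case: eqP => // _.
by rewrite mulr_ge0 ?powR_ge0 ?expR_ge0.
Qed.

Lemma tube_radius_le u : tube_radius u <= clamp u.1.1.
Proof.
rewrite /tube_radius; case: eqVneq => [->//|t0].
have {}t0 : 0 < clamp u.1.1 by rewrite lt_def t0 clamp_ge0.
have s1 : clamp u.1.2 `^ ((clamp u.1.1 ^+ 2)^-1) <= 1.
  apply: (@le_trans _ _ (1 `^ ((clamp u.1.1 ^+ 2)^-1))); last by rewrite powR1.
  by apply: ge0_ler_powR; rewrite ?nnegrE ?clamp_ge0 ?clamp_le1 ?invr_ge0 ?sqr_ge0.
apply: (@le_trans _ _ (1 * expR (- (clamp u.1.1)^-1))).
  by rewrite ler_wpM2r ?expR_ge0.
rewrite mul1r expRN -[leRHS]invrK lef_pV2 ?posrE ?expR_gt0 ?invr_gt0//.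
by apply: le_trans (expR_ge1Dx _); rewrite lerDr.
Qed.

Let c_tau u : {for u, continuous (fun v : R * R * R => clamp v.1.1 : R)}.
Proof.
by apply: continuous_clamp; apply: continuous_fst_at; exact: cvg_fst.
Qed.

Let c_s u : {for u, continuous (fun v : R * R * R => clamp v.1.2 : R)}.
Proof.
by apply: continuous_clamp; apply: continuous_snd_at; exact: cvg_fst.
Qed.

Let c_sq (T : topologicalType) (p : T) (f : T -> R) : {for p, continuous f} ->
  {for p, continuous (fun v => f v ^+ 2 : R)}.
Proof.
move=> cf; apply: (@continuous_comp _ _ _ f (fun x : R => x ^+ 2)) => //.
exact: exprn_continuous.
Qed.

Lemma continuous_tube_radius u : {for u, continuous (tube_radius : R * R * R -> R)}.
Proof.
have [t0|t0] := eqVneq (clamp u.1.1) 0.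
  rewrite /prop_for /continuous_at {2}/tube_radius t0 eqxx.
  have cst : (fun=> 0 : R) @ u --> 0 by exact: cvg_cst.
  apply: (squeeze_cvgr _ cst (h := fun v => clamp v.1.1)); last first.
    by have := @c_tau u; rewrite /prop_for /continuous_at t0.
  by apply: nearW => v; rewrite tube_radius_ge0 tube_radius_le.
have {}t0 : 0 < clamp u.1.1 by rewrite lt_def t0 clamp_ge0.
have nt : \forall v \near u, 0 < clamp v.1.1 by exact: (cvgr_gt (clamp u.1.1) (@c_tau u)).
pose F (v : R * R * R) : R :=
  clamp v.1.2 `^ ((clamp v.1.1 ^+ 2)^-1) * expR (- (clamp v.1.1)^-1).
suff cF : {for u, continuous F}.
  rewrite /prop_for /continuous_at {2}/tube_radius gt_eqF//.
  apply: cvg_trans cF; apply: near_eq_cvg; apply: filterS nt => v vt.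
  by rewrite /F /tube_radius gt_eqF.
apply: continuousM.
  apply: (@continuous_powR_at _ _ u (fun v : R * R * R => clamp v.1.2)
     (fun v : R * R * R => (clamp v.1.1 ^+ 2)^-1)).
  - exact: c_s.
  - apply: continuousV; first by rewrite expf_eq0 gt_eqF.
    by apply: c_sq; exact: c_tau.
  - by move=> v; exact: clamp_ge0.
  - by right; rewrite invr_gt0 exprn_gt0.
apply: (@continuous_comp _ _ _ (fun v : R * R * R => - (clamp v.1.1)^-1) (@expR R));
  last exact: continuous_expR.
apply: continuousN; apply: continuousV; first by rewrite gt_eqF.
exact: c_tau.
Qed.

Lemma continuous_tube_center u : continuousC_at u tube_center.
Proof.
apply: continuousC_D; first exact: continuousC_cst.
apply: continuousC_M; first by apply: continuousC_real; exact: continuous_tube_radius.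
apply: continuous_cis; apply: continuousM; first exact: continuous_cst_at.
exact: cvg_snd.
Qed.

Definition tube_value m g u : R :=
  (clamp u.1.2 * expR (- clamp u.1.1)) ^+ m *
  arch_value (clamp u.1.1 ^+ 2) (tube_center u) g.

Lemma polyC_of_horner g (b : k) : (polyC_of g).[val b] = val g.[b].
Proof. by rewrite /polyC_of horner_map. Qed.

Lemma continuous_tube_value m g u : ~~ root g a ->
  {for u, continuous (tube_value m g : R * R * R -> R)}.
Proof.
move=> ga; apply: continuousM.
  apply: (@continuous_comp _ _ _ (fun v : R * R * R => clamp v.1.2 * expR (- clamp v.1.1))
    (fun x : R => x ^+ m)); last exact: exprn_continuous.
  apply: continuousM; first exact: c_s.
  apply: (@continuous_comp _ _ _ (fun v : R * R * R => - clamp v.1.1) (@expR R)).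
    by apply: continuousN; exact: c_tau.
  exact: continuous_expR.
apply: continuous_arch_value.
- by apply: c_sq; exact: c_tau.
- exact: continuous_tube_center.
- have [t0|t0] := eqVneq (clamp u.1.1) 0; last first.
    by left; rewrite exprn_gt0// lt_def t0 clamp_ge0.
  right; rewrite /tube_center /tube_radius t0 eqxx mul0r addr0 polyC_of_horner.
  by rewrite fmorph_eq0.
Qed.

Let sq01 u : clamp u.1.1 != 0 -> 0 < clamp u.1.1 ^+ 2 <= 1.
Proof.
move=> t0; rewrite exprn_gt0 ?lt_def ?t0 ?clamp_ge0//.
by rewrite exprn_ile1 ?clamp_ge0 ?clamp_le1.
Qed.

Lemma tube_radius_pow u : clamp u.1.1 != 0 ->
  tube_radius u `^ (clamp u.1.1 ^+ 2) = clamp u.1.2 * expR (- clamp u.1.1).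
Proof.
move=> t0; rewrite /tube_radius (negbTE t0) powRM ?powR_ge0 ?expR_ge0//.
rewrite -powRrM mulVf ?expf_neq0// powRr1 ?clamp_ge0//; congr (_ * _).
rewrite /powR gt_eqF ?expR_gt0// expRK; congr expR.
by rewrite mulrN expr2 mulfK.
Qed.

Lemma arch_value_tube m g u : clamp u.1.1 != 0 ->
  arch_value (clamp u.1.1 ^+ 2) (tube_center u) (g * ('X - a%:P) ^+ m) = tube_value m g u.
Proof.
move=> t0; rewrite -(arch_pointE _ _ (sq01 t0)) seminormM seminormX !arch_pointE ?sq01//.
rewrite mulrC /tube_value; congr (_ ^+ _ * _).
rewrite arch_value_dist /tube_center addrC addKr normcM.
rewrite normc_cis mulr1 normc_real ger0_norm ?tube_radius_ge0//.
by rewrite tube_radius_pow.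
Qed.

(** The branch is a limit of Archimedean points. *)
Lemma branch_exists s : exists x : X, 0 <= s <= 1 -> forall m g, ~~ root g a ->
  x (g * ('X - a%:P) ^+ m) = s ^+ m.
Proof.
have [s01|ns] := boolP (0 <= s <= 1); last by exists (arch_point k 1 0).
pose tn (n : nat) : R := n.+1%:R^-1.
have tn0 n : clamp (tn n) != 0 by rewrite gt_eqF// clamp_gt0// invr_gt0.
pose un n : R * R * R := (tn n, s, 0).
pose x n := arch_point k (clamp (tn n) ^+ 2) (tube_center (un n)).
have ctn : (tn n : R) @[n --> \oo] --> 0 by exact: cvg_harmonic.
have ccst (c : R) : (fun _ : nat => c) @ \oo --> c by exact: cvg_cst.
have c1 : (tn n, s) @[n --> \oo] --> ((0 : R), s) by exact: (cvg_pair ctn (ccst s)).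
have cun : un n @[n --> \oo] --> ((0 : R), s, (0 : R)) by exact: (cvg_pair c1 (ccst 0)).
have lim m g : ~~ root g a -> x n (g * ('X - a%:P) ^+ m) @[n --> \oo] --> s ^+ m.
  move=> ga.
  rewrite (_ : (fun n => _) = fun n => tube_value m g (un n)); last first.
    apply/funext => n; have tn0' : clamp (un n).1.1 != 0 by exact: tn0.
    by rewrite /x (arch_pointE _ _ (sq01 tn0')); exact: arch_value_tube.
  have -> : s ^+ m = tube_value m g ((0 : R), s, (0 : R)).
    rewrite /tube_value /= (clamp_id s01) clamp_le0// oppr0 expR0 mulr1.
    by rewrite /arch_value expr0n /= powRr0 mulr1.
  exact: (cvg_comp _ _ cun (@continuous_tube_value m g _ ga)).
have ex f : exists l : R, x n f @[n --> \oo] --> l.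
  have [->|f0] := eqVneq f 0.
    exists 0; rewrite (_ : (fun n => _) = fun=> 0); first exact: cvg_cst.
    by apply/funext => n; rewrite seminorm0.
  have [m [g]] := multiplicity_XsubC f a; rewrite f0 /= => ga ->.
  by exists (s ^+ m); exact: lim.
have [v vE] := choice ex.
have [y yE] := A1hyb_limit vE; exists y => _ m g ga; rewrite yE.
exact: (@cvg_unique _ (@norm_hausdorff _ _) _ _ _ _ (vE _) (lim m g ga)).
Qed.

(** The point at distance [s] from [a] on the branch of the trivially valued
    line that leads to [a]. *)
Definition branch s : X := sval (cid (branch_exists s)).

(** A tubular neighbourhood of the branch, which is the part [u.1.1 = 0]. The
    parameters are the square root of the level, the distance to [a], up to the
    factor [expR (- u.1.1)], and the angle around [a]. *)
Definition tube u : X :=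
  if clamp u.1.1 == 0 then branch (clamp u.1.2)
  else arch_point k (clamp u.1.1 ^+ 2) (tube_center u).

Lemma tubeE m g u : ~~ root g a -> tube u (g * ('X - a%:P) ^+ m) = tube_value m g u.
Proof.
move=> ga; rewrite /tube; case: eqVneq => [t0|t0]; last first.
  by rewrite arch_pointE ?sq01// arch_value_tube.
rewrite /branch; case: cid => x /= ->//; last by rewrite clamp_ge0 clamp_le1.
rewrite /tube_value t0 oppr0 expR0 mulr1.
by rewrite /arch_value expr0n /= powRr0 mulr1.
Qed.

Lemma continuous_tube : continuous tube.
Proof.
move=> u; apply: A1hyb_continuous_at => f; have [->|f0] := eqVneq f 0.
  rewrite (_ : (fun _ => _) = fun=> 0); first exact: continuous_cst_at.
  by apply/funext => v; rewrite seminorm0.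
have [m [g]] := multiplicity_XsubC f a; rewrite f0 /= => ga ->.
rewrite (_ : (fun _ => _) = tube_value m g); first exact: continuous_tube_value.
by apply/funext => v; rewrite tubeE.
Qed.

Lemma tube_gauss u : clamp u.1.1 = 0 -> clamp u.1.2 = 1 -> tube u = deg_point k 1.
Proof.
move=> t0 s1; apply: A1hyb_eq => f; rewrite deg_pointE// /deg_value expr1n.
have [->|f0] := eqVneq f 0; first by rewrite seminorm0.
have [m [g]] := multiplicity_XsubC f a; rewrite f0 /= => ga ->.
rewrite tubeE// /tube_value t0 s1 oppr0 expR0 mulr1 expr1n mul1r.
by rewrite /arch_value expr0n /= powRr0.
Qed.

Lemma tube_dist u : tube u ('X - a%:P) = clamp u.1.2 * expR (- clamp u.1.1).
Proof.
have r1 : ~~ root (1 : {poly k}) a by rewrite rootE hornerC oner_eq0.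
have := tubeE 1 u r1; rewrite mul1r expr1 => ->.
rewrite /tube_value expr1 /arch_value /polyC_of rmorph1 hornerC.
by rewrite normc1 powR1 mulr1.
Qed.

Lemma tube_arch u : clamp u.1.1 != 0 -> exists r, 0 < r <= 1 /\
  tube u = arch_point k r (tube_center u).
Proof.
by move=> t0; exists (clamp u.1.1 ^+ 2); rewrite sq01// /tube (negbTE t0).
Qed.

Lemma tube_const tau s th th' :
  clamp tau = 0 \/ clamp s = 0 -> tube (tau, s, th) = tube (tau, s, th').
Proof.
move=> h; rewrite /tube /=; case: eqVneq => // t0.
have s0 : clamp s = 0 by case: h => // h; rewrite h eqxx in t0.
have r0 th0 : tube_radius (tau, s, th0) = 0.
  rewrite /tube_radius /= (negbTE t0) s0 powR0 ?mul0r// invr_eq0 expf_eq0 /=.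
  exact: t0.
by rewrite /tube_center !r0 !mul0r.
Qed.

Lemma tube_periodic tau s : tube (tau, s, 0) = tube (tau, s, 1).
Proof.
rewrite /tube /=; case: eqVneq => // _; rewrite /tube_center /=.
have -> : tube_radius (tau, s, 0) = tube_radius (tau, s, 1) by [].
by rewrite mulr0 mulr1 cis0 /cis cos2pi sin2pi.
Qed.

End Tube.

(** * Branches avoided by a contraction *)

Section Avoidance.
Variables (R : realType) (K : pred R[i]) (k : subFieldType K).
Local Notation X := (A1hyb k).

Definition countable_base (T : topologicalType) : Prop :=
  exists N : nat -> set T, forall p U, nbhs p U -> exists i, N i p /\ N i `<=` U.

Lemma countable_base_real : countable_base R.
Proof.
pose N (i : nat) : set R :=
  if unpickle i is Some (q1, q2) then `](ratr q1 : R), (ratr q2 : R)[%classic else set0.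
exists N => p U /nbhs_ballP[e /= e0 eU].
have [q1 /itvP h1] := @rat_in_itvoo R (p - e) p ltac:(lra).
have [q2 /itvP h2] := @rat_in_itvoo R p (p + e) ltac:(lra).
exists (pickle (q1, q2)); rewrite /N pickleK; split.
  by rewrite /= in_itv /= h1 h2.
move=> y; rewrite /= in_itv /= => /andP[y1 y2]; apply: eU.
have q1e : p - e < ratr q1 by rewrite h1.
have q2e : ratr q2 < p + e by rewrite h2.
by rewrite /ball /= ltr_norml; apply/andP; split; lra.
Qed.

Lemma countable_base_prod (T U : topologicalType) :
  countable_base T -> countable_base U -> countable_base (T * U)%type.
Proof.
move=> [N hN] [M hM].
pose L (i : nat) : set (T * U) :=
  if unpickle i is Some (i1, i2) then N i1 `*` M i2 else set0.
exists L => -[p q] W [[A B] /= [Ap Bq] ABW].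
have [i [Ni NA]] := hN _ _ Ap; have [j [Mj MB]] := hM _ _ Bq.
exists (pickle (i, j)); rewrite /L pickleK; split => // -[x y] /= [Nx My].
by apply: ABW; split; [exact: NA|exact: MB].
Qed.

(** An open part of the branch of [a] in the non-Archimedean fibre. *)
Definition branch_zone (a : k) : set X :=
  [set x | lambda x = 0 /\ x ('X - a%:P) < 2^-1].

Lemma branch_zone_inj (a b : k) (x : X) : branch_zone a x ->
  x ('X - b%:P) < 2^-1 -> a = b.
Proof.
move=> [l0 xa] xb; apply/eqP; rewrite -subr_eq0; apply/negP => /negP ab.
have : x (a - b)%:P = 1.
  by rewrite lambdaE l0 /norm_infty_pow eqxx /norm_triv ab.
have -> : (a - b)%:P = ('X - b%:P) - ('X - a%:P) by rewrite polyCB; ring.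
have := seminormD x ('X - b%:P) (- ('X - a%:P)).
rewrite triv_opp//.
by lra.
Qed.

(** A continuous image of a space with a countable base meets only countably
    many branches: a basic set is contained in the preimage of at most one. *)
Lemma few_branches (T : topologicalType) (f : T -> X) : countable_base T ->
  continuous f -> countable [set a : k | exists p, branch_zone a (f p)].
Proof.
move=> [N hN] cf; apply/countable_injP.
pose good a i := exists p, [/\ branch_zone a (f p), N i p &
  N i `<=` [set q | f q ('X - a%:P) < 2^-1]].
have ex a : exists i, (exists p, branch_zone a (f p)) -> good a i.
  have [[p pa]|no] := pselect (exists p, branch_zone a (f p)); last by exists 0%N.
  have ce : {for p, continuous (fun q => f q ('X - a%:P) : R)}.
    apply: (@continuous_comp _ _ _ f (fun x : X => x ('X - a%:P))).
      exact: cf.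
    exact: continuous_eval.
  have nb : \forall q \near p, f q ('X - a%:P) < 2^-1.
    by apply: (cvgr_lt (f p ('X - a%:P)) ce); case: pa.
  have [i [Ni iN]] := hN _ _ nb; exists i => _; by exists p.
have [c cP] := choice ex; exists c => a b; rewrite !inE => ha hb cab.
have [p [pa Np _]] := cP a ha; have [q [qb Nq Nb]] := cP b hb.
by apply: branch_zone_inj pa _; apply: Nb; rewrite -cab.
Qed.

End Avoidance.

(** * The winding obstruction *)

Section LocallyConstant.
Variable R : realType.

Lemma locally_constant (f : R -> R) :
  (forall t, \forall u \near t, f u = f t) -> forall t u, f t = f u.
Proof.
move=> lf t u; apply: is_derive_0_is_cst => x.
apply: (@near_eq_is_derive _ _ _ (fun=> f x) f).
by apply: filterS (lf x) => v ->.
Qed.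

End LocallyConstant.

Section Obstruction.
Variables (R : realType) (K : pred R[i]) (k : subFieldType K) (a : k).
Local Notation X := (A1hyb k).
Variables (H : R * X -> X) (x1 : X).
Hypothesis cH : continuous H.
Hypothesis H0 : forall x, H (0, x) = x.
Hypothesis H1 : forall x, H (1, x) = x1.
Hypothesis nonreal : exists c : k, Im (val c) != 0.
Hypothesis avoid_arch : forall t r z, 0 < r <= 1 ->
  ~ branch_zone a (H (t, arch_point k r z)).
Hypothesis avoid_gauss : forall t, ~ branch_zone a (H (t, deg_point k 1)).
Local Notation D := ('X - a%:P).

Definition orbit (u : R * R * R * R) : X :=
  H (clamp u.1.1.1, tube a (u.2, clamp u.1.1.2, clamp u.1.2)).

Lemma continuous_orbit : continuous orbit.
Proof.
move=> u.
have c1 : {for u, continuous (fun u : R * R * R * R => u.1)} by exact: cvg_fst.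
have c2 : {for u, continuous (fun u : R * R * R * R => u.2)} by exact: cvg_snd.
have c11 := continuous_fst_at c1; have c12 := continuous_snd_at c1.
have c111 := continuous_fst_at c11; have c112 := continuous_snd_at c11.
pose P (u : R * R * R * R) : R * R * R := (u.2, clamp u.1.1.2, clamp u.1.2).
have cP : {for u, continuous P}.
  exact: (cvg_pair (cvg_pair c2 (continuous_clamp c112)) (continuous_clamp c12)).
have ct : {for u, continuous (fun u => tube a (P u))}.
  by apply: (@continuous_comp _ _ _ P (tube a)) => //; exact: continuous_tube.
apply: (@continuous_comp _ _ _ (fun u => (clamp u.1.1.1, tube a (P u))) H); last exact: cH.
exact: (cvg_pair (continuous_clamp c111) ct).
Qed.

Lemma orbit_const t s th th' : orbit (t, s, th, 0) = orbit (t, s, th', 0).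
Proof.
rewrite /orbit /=; congr (H (_, _)); apply: tube_const; left; exact: clamp_le0.
Qed.

(** At parameter [h = 0] an orbit does not depend on the angle; near 0 it
    hardly does, uniformly because the other parameters range over a cube. *)
Lemma orbit_uniform : exists tau0, 0 < tau0 /\
  (forall p h, 0 <= h <= tau0 -> `|orbit (p, h) D - orbit (p, 0) D| < 64^-1).
Proof.
have cA : compact (`[0, 1 : R] `*` `[0, 1 : R] `*` `[0, 1 : R])%classic.
  by apply: compact_setX; [apply: compact_setX|]; exact: segment_compact.
have /compact_near_coveringP cov := cA.
pose P (h : R) (p : R * R * R) : Prop := `|orbit (p, h) D - orbit (p, 0) D| < 64^-1.
have : \forall h \near (0 : R), (`[0, 1 : R] `*` `[0, 1 : R] `*` `[0, 1 : R])%classic `<=` P h.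
  apply: (cov R (nbhs (0 : R)) P (nbhs_filter _)) => p _.
  pose F (u : R * R * R * R) : R := `|orbit u D - orbit (u.1, 0) D|.
  have cF : {for (p, 0), continuous F}.
    have ce v : {for v, continuous (fun u => orbit u D : R)}.
      apply: (@continuous_comp _ _ _ orbit (fun x : X => x D)).
        exact: continuous_orbit.
      exact: continuous_eval.
    have c1 : {for (p, 0), continuous (fun u : R * R * R * R => (u.1, 0 : R))}.
      apply: (@continuous_comp _ _ _ fst (fun v : R * R * R => (v, 0 : R))).
        exact: cvg_fst.
      exact: continuous_pairr.
    apply: (@continuous_comp _ _ _ (fun u => orbit u D - orbit (u.1, 0) D)
      (fun x : R => `|x|)); last exact: norm_continuous.
    apply: continuousB; first exact: ce.
    by apply: (@continuous_comp _ _ _ (fun u : R * R * R * R => (u.1, 0 : R))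
      (fun u => orbit u D : R)) => //; exact: ce.
  have F0 : F (p, 0) < 64^-1 by rewrite /F /= subrr normr0 invr_gt0.
  exact: (cvgr_lt (F (p, 0)) cF).
move=> /nbhs_ballP[e /= e0 eP]; exists (Num.min 1 (e / 2)).
split; first by rewrite lt_min ltr01 divr_gt0.
move=> [[t s] th] h /andP[h0 hm].
have he : h < e.
  by apply: le_lt_trans hm _; rewrite gt_min ltr_pdivrMr// ltr_pMr// ltr1n orbT.
have hb : ball (0 : R) e h by rewrite /ball /= sub0r normrN ger0_norm.
have idem (x : R) : clamp (clamp x) = clamp x.
  by apply: clamp_id; rewrite clamp_ge0 clamp_le1.
have oE z : orbit (clamp t, clamp s, clamp th, z) = orbit (t, s, th, z).
  by rewrite /orbit /= !idem.
rewrite -!oE; apply: (eP h hb); rewrite /= !in_itv /=.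
by rewrite !clamp_ge0 !clamp_le1.
Qed.

Section Shell.
Variable tau0 : R.
Hypothesis tau0_gt0 : 0 < tau0.
Hypothesis tau0P : forall p h, 0 <= h <= tau0 ->
  `|orbit (p, h) D - orbit (p, 0) D| < 64^-1.

Definition height (s : R) : R := tau0 * clamp (2 - s).

(** For fixed time [p.1], the points of parameters [(p.2, th)] with
    [0 <= p.2 <= 2] form the image of a sphere: a disc around the branch point
    over [tau0] that is closed up along the branch to the Gauss point. *)
Definition shell (p : R * R) (th : R) : X := orbit (p, th, height p.2).

Definition shell_dist (p : R * R) : R := shell p 0 D.

Definition shell_loop (p : R * R) (th : R) : R[i] := arch_coord (shell p th) - val a.

(** Where the distance to [a] is neither close to 0 nor to [2^-1], the loop at
    [p] lies in the Archimedean part and does not meet [a]. *)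
Definition middle (p : R * R) : bool := 16^-1 < shell_dist p < 7 / 16.

Definition loop_winding (p : R * R) : R :=
  if middle p then winding (shell_loop p) else 0.

Definition cutoff (p : R * R) : R := clamp (4 * (shell_dist p - 8^-1)).

(** The cutoff turns the winding numbers into a closed curve in [p.2], which
    winds as many times as the loops of the shell do while the cutoff rises from
    0 to 1: its winding number is the degree of the shell. *)
Definition sphere_map (p : R * R) : R[i] := cis (loop_winding p * cutoff p).

Lemma height01 s : 0 <= height s <= tau0.
Proof.
by rewrite mulr_ge0 ?clamp_ge0 ?(ltW tau0_gt0)// ler_piMr ?clamp_le1// ltW.
Qed.

Lemma height_eq0 s : clamp (height s) = 0 -> 2 <= s.
Proof.
move=> h0; rewrite leNgt; apply/negP => sl.
have : 0 < clamp (height s) by apply: clamp_gt0; rewrite mulr_gt0// clamp_gt0// subr_gt0.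
by rewrite h0 ltxx.
Qed.

Lemma shell_close p th : `|shell p th D - shell_dist p| < 32^-1.
Proof.
have h1 := tau0P (p, th) (height01 p.2).
have h2 := tau0P (p, 0) (height01 p.2).
have e : orbit (p, th, 0) = orbit (p, 0, 0) by case: (p) => t s; exact: orbit_const.
rewrite e in h1; rewrite distrC in h2; apply: le_lt_trans (ler_distD _ _ _) _.
have -> : 32^-1 = 64^-1 + 64^-1 :> R by field.
exact: ltrD h1 h2.
Qed.

(** The shell consists of Archimedean points and the Gauss point, whose orbits
    avoid the zone of [a]. *)
Lemma shell_avoid p th : ~ branch_zone a (shell p th).
Proof.
rewrite /shell /orbit /=; set u := (_, _, _).
have [h0|h0] := eqVneq (clamp u.1.1) 0.
  have s2 : 2 <= p.2 by exact: height_eq0.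
  have s1 : clamp u.1.2 = 1 by rewrite /u /= !clamp_ge1//; apply: le_trans s2; rewrite ler1n.
  by rewrite (tube_gauss a h0 s1); exact: avoid_gauss.
by have [r [r01 ->]] := tube_arch a h0; exact: avoid_arch.
Qed.

Lemma shell_lambda p th : shell p th D < 2^-1 -> 0 < lambda (shell p th).
Proof.
move=> h; rewrite lt_def lambda_ge0 andbT; apply/negP => /eqP l0.
exact: (@shell_avoid p th).
Qed.

Lemma shell_loop_neq0 p th : 0 < shell p th D < 2^-1 -> shell_loop p th != 0.
Proof.
move=> /andP[d0 /shell_lambda l0]; rewrite /shell_loop subr_eq0; apply/negP => /eqP c.
move: d0; rewrite (arch_coordK l0) arch_pointE ?l0 ?lambda_le1//.
by rewrite arch_value_dist c subrr normc0 powR0 ?ltxx// gt_eqF.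
Qed.

Lemma middle_bound p th : middle p -> 0 < shell p th D < 2^-1.
Proof.
move=> /andP[]; have := shell_close p th.
move: (shell p th D) (shell_dist p) => x y.
by rewrite ltr_norml => /andP[h1 h2] h3 h4; apply/andP; split; lra.
Qed.

Lemma continuous_height s : {for s, continuous (height : R -> R)}.
Proof.
apply: continuousM; first exact: continuous_cst_at.
apply: continuous_clamp; apply: continuousB; first exact: continuous_cst_at.
exact: cvg_id.
Qed.

Lemma continuous_shell (u : R * R * R) :
  {for u, continuous (fun v : R * R * R => shell v.1 v.2)}.
Proof.
apply: (@continuous_comp _ _ _ (fun v : R * R * R => (v, height v.1.2)) orbit);
  last exact: continuous_orbit.
have ci : {for u, continuous (fun v : R * R * R => v)} by exact: cvg_id.
have c12 : {for u, continuous (fun v : R * R * R => v.1.2)}.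
  by apply: continuous_snd_at; exact: cvg_fst.
have ch : {for u, continuous (fun v : R * R * R => height v.1.2)}.
  by apply: (@continuous_comp _ _ _ (fun v : R * R * R => v.1.2) height) => //;
     exact: continuous_height.
exact: (cvg_pair ci ch).
Qed.

Lemma continuous_shell_dist p : {for p, continuous (shell_dist : R * R -> R)}.
Proof.
apply: (@continuous_comp _ _ _ (fun v : R * R => shell v 0) (fun x : X => x D));
  last exact: continuous_eval.
apply: (@continuous_comp _ _ _ (fun v : R * R => (v, 0 : R))
  (fun v : R * R * R => shell v.1 v.2)); last exact: continuous_shell.
exact: continuous_pairr.
Qed.

Lemma continuous_shell_loop p th : middle p ->
  continuousC_at (p, th) (fun u : R * R * R => shell_loop u.1 u.2).
Proof.
move=> /(middle_bound th) /andP[_ /shell_lambda l0].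
apply: continuousC_B; last exact: continuousC_cst.
apply: (continuousC_comp (f := fun u : R * R * R => shell u.1 u.2)).
  exact: continuous_shell.
exact: continuous_coord.
Qed.

Lemma shell_periodic p : shell p 0 = shell p 1.
Proof.
have e := tube_periodic a (height p.2) (clamp p.2).
rewrite -[X in tube a (_, X)](clamp_le0 (lexx 0)) in e.
rewrite -[X in _ = tube a (_, X)](clamp_ge1 (lexx 1)) in e.
exact: (f_equal (fun x => H (clamp p.1, x)) e).
Qed.

Lemma middle_curve p : middle p -> closed_curve (shell_loop p).
Proof.
move=> mp; split.
- move=> th; apply: (continuousC_comp (f := fun x : R => (p, x))
    (h := fun u : R * R * R => shell_loop u.1 u.2)); last exact: continuous_shell_loop.
  exact: continuous_pairl.
- by move=> th; apply: shell_loop_neq0; exact: middle_bound.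
- by rewrite /shell_loop shell_periodic.
Qed.

Lemma near_middle p : middle p -> \forall v \near p, middle v.
Proof.
move=> /andP[m1 m2]; have c := @continuous_shell_dist p.
have n1 : \forall v \near p, 16^-1 < shell_dist v by exact: (cvgr_gt (shell_dist p) c).
have n2 : \forall v \near p, shell_dist v < 7 / 16 by exact: (cvgr_lt (shell_dist p) c).
by apply: filterS2 n1 n2 => v v1 v2; rewrite /middle v1 v2.
Qed.

Lemma near_loop_winding p : middle p ->
  \forall v \near p, loop_winding v = loop_winding p.
Proof.
move=> mp; have nm := near_middle mp.
have : \forall v \near p, winding (shell_loop v) = winding (shell_loop p).
  apply: winding_loc_const; first by move=> x _; exact: continuous_shell_loop.
  by apply: filterS nm => v; exact: middle_curve.
by apply: filterS2 nm => v mv; rewrite /loop_winding mv mp.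
Qed.

Lemma cis_loop_winding p : cis (loop_winding p) = 1.
Proof.
rewrite /loop_winding; case: ifP => [mp|_]; last exact: cis0.
by apply: cis_winding; exact: middle_curve.
Qed.

Lemma cutoff0 p : shell_dist p <= 8^-1 -> cutoff p = 0.
Proof. by move=> h; apply: clamp_le0; lra. Qed.

Lemma cutoff1 p : 3 / 8 <= shell_dist p -> cutoff p = 1.
Proof. by move=> h; apply: clamp_ge1; lra. Qed.

Lemma continuous_cutoff p : {for p, continuous (cutoff : R * R -> R)}.
Proof.
apply: continuous_clamp; apply: continuousM; first exact: continuous_cst_at.
apply: continuousB; last exact: continuous_cst_at.
exact: continuous_shell_dist.
Qed.

Lemma sphere_map_out p : shell_dist p <= 8^-1 \/ 3 / 8 <= shell_dist p ->
  sphere_map p = 1.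
Proof.
case=> h; rewrite /sphere_map; first by rewrite cutoff0// mulr0 cis0.
by rewrite cutoff1// mulr1 cis_loop_winding.
Qed.

Lemma continuousC_near (T : topologicalType) (p : T) (f g : T -> R[i]) :
  (\forall v \near p, f v = g v) -> continuousC_at p f -> continuousC_at p g.
Proof.
move=> fg [cr ci]; have e := nbhs_singleton fg.
split; rewrite /prop_for /continuous_at -e.
  by apply: cvg_trans cr; apply: near_eq_cvg; apply: filterS fg => v ->.
by apply: cvg_trans ci; apply: near_eq_cvg; apply: filterS fg => v ->.
Qed.

(** Where the winding number is not locally constant the cutoff takes it to an
    integral multiple of a full turn. *)
Lemma continuous_sphere_map p : continuousC_at p sphere_map.
Proof.
have c := @continuous_shell_dist p.
have out : shell_dist p < 8^-1 \/ 3 / 8 < shell_dist p -> continuousC_at p sphere_map.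
  move=> h; apply: (@continuousC_near _ _ (fun=> 1)); last exact: continuousC_cst.
  case: h => h.
    have n : \forall v \near p, shell_dist v < 8^-1 by exact: (cvgr_lt (shell_dist p) c).
    by apply: filterS n => v vh; rewrite sphere_map_out//; left; exact: ltW.
  have n : \forall v \near p, 3 / 8 < shell_dist v by exact: (cvgr_gt (shell_dist p) c).
  by apply: filterS n => v vh; rewrite sphere_map_out//; right; exact: ltW.
have [mp|mp] := boolP (middle p); last first.
  apply: out; move: mp; rewrite /middle negb_and -!leNgt.
  by move=> /orP[] h; [left|right]; lra.
apply: (@continuousC_near _ _ (fun v => cis (loop_winding p * cutoff v))).
  by apply: filterS (near_loop_winding mp) => v e; rewrite /sphere_map e.
apply: continuous_cis; apply: continuousM; first exact: continuous_cst_at.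
exact: continuous_cutoff.
Qed.

Lemma loop_winding_const p : (forall th, shell p th = shell p 0) -> loop_winding p = 0.
Proof.
move=> h; rewrite /loop_winding; case: ifP => // mp.
by apply: winding_const; [exact: middle_curve|move=> x; rewrite /shell_loop h].
Qed.

Lemma sphere_map_const p : (forall th, shell p th = shell p 0) -> sphere_map p = 1.
Proof. by move=> h; rewrite /sphere_map loop_winding_const// mul0r cis0. Qed.

Lemma sphere_map_south t : sphere_map (t, 0) = 1.
Proof.
apply: sphere_map_const => th.
have c0 : clamp (0 : R) = 0 by exact: clamp_le0.
have e : clamp (clamp (0 : R)) = 0 by rewrite !c0.
have h := @tube_const _ _ _ a (height 0) _ (clamp th) (clamp 0) (or_intror e).
exact: (f_equal (fun x => H (clamp t, x)) h).
Qed.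

Lemma sphere_map_north t : sphere_map (t, 2) = 1.
Proof.
have h2 : height 2 = 0 by rewrite /height subrr (clamp_le0 (lexx 0)) mulr0.
by apply: sphere_map_const => th; rewrite /shell h2; exact: orbit_const.
Qed.

Definition meridian (t x : R) : R[i] := sphere_map (t, 2 * x).

Lemma continuous_meridian (u : R * R) :
  continuousC_at u (fun v : R * R => meridian v.1 v.2).
Proof.
apply: (continuousC_comp (f := fun v : R * R => (v.1, 2 * v.2)) (h := sphere_map));
  last exact: continuous_sphere_map.
have c1 : {for u, continuous (fun v : R * R => v.1 : R)} by exact: cvg_fst.
have c2 : {for u, continuous (fun v : R * R => 2 * v.2 : R)}.
  by apply: continuousM; [exact: continuous_cst_at|exact: cvg_snd].
exact: (cvg_pair c1 c2).
Qed.

Lemma cis_neq0 (x : R) : cis x != 0.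
Proof.
apply/eqP => /(congr1 (@normc R)).
by rewrite normc_cis normc0 => /eqP; rewrite oner_eq0.
Qed.

Lemma meridian_closed t : closed_curve (meridian t).
Proof.
split.
- move=> x; apply: (continuousC_comp (f := fun x : R => (t, x))
    (h := fun v : R * R => meridian v.1 v.2)); last exact: continuous_meridian.
  exact: continuous_pairl.
- by move=> x; exact: cis_neq0.
- by rewrite /meridian mulr0 mulr1 sphere_map_south sphere_map_north.
Qed.

Lemma meridian_invariant : winding (meridian 0) = winding (meridian 1).
Proof.
apply: (@locally_constant R (fun t => winding (meridian t))) => t.
apply: winding_loc_const; first by move=> x _; exact: continuous_meridian.
by apply: (@filterE _ (nbhs t) (nbhs_filter t)); exact: meridian_closed.
Qed.

Lemma meridian_end : winding (meridian 1) = 0.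
Proof.
have E s th : shell (1, s) th = x1 by rewrite /shell /orbit /= clamp_ge1// H1.
have S s : sphere_map (1, s) = 1 by apply: sphere_map_const => th; rewrite E E.
by apply: winding_const; [exact: meridian_closed|move=> x; rewrite /meridian S S].
Qed.

Lemma shell_start s th : shell (0, s) th = tube a (height s, clamp s, clamp th).
Proof. by rewrite /shell /orbit /= clamp_le0// H0. Qed.

Lemma loop_winding_start s : middle (0, s) -> loop_winding (0, s) = pi *+ 2.
Proof.
move=> ms; rewrite /loop_winding ms.
pose u th : R * R * R := (height s, clamp s, clamp th).
have hs : clamp (height s) != 0.
  apply/eqP => h0; have [_] := andP ms.
  have s2 := height_eq0 h0.
  rewrite /shell_dist shell_start tube_dist /= h0 oppr0 expR0 mulr1.
  by rewrite !clamp_ge1//; [lra|apply: le_trans s2; rewrite ler1n].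
have E th : shell_loop (0, s) th = (tube_radius (u 0))%:C%C * cis (pi *+ 2 * clamp th).
  rewrite /shell_loop shell_start; have [r [r01 ->]] := @tube_arch _ _ k a (u th) hs.
  by rewrite coord_arch_nonreal// /tube_center addrC addKr.
have r0 : 0 < tube_radius (u 0).
  rewrite lt_def tube_radius_ge0 andbT; apply/eqP => z.
  have [_ /(_ 0)] := middle_curve ms.
  by rewrite E z mul0r eqxx.
have cf x : {for x, continuous (fun x : R => pi *+ 2 * clamp x : R)}.
  apply: continuousM; first exact: continuous_cst_at.
  by apply: continuous_clamp; exact: cvg_id.
rewrite (@winding_cis _ _ (fun=> tube_radius (u 0)) (fun x => pi *+ 2 * clamp x)).
- by rewrite clamp_ge1// clamp_le0// mulr1 mulr0 subr0.
- exact: middle_curve.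
- exact: cf.
- by [].
- by move=> x _; exact: E.
Qed.

(** The identity takes the sphere to itself with degree one. *)
Lemma meridian_start : winding (meridian 0) = pi *+ 2.
Proof.
have E x : meridian 0 x = cis (pi *+ 2 * cutoff (0, 2 * x)).
  have [m|m] := boolP (middle (0, 2 * x)).
    by rewrite /meridian /sphere_map loop_winding_start.
  have cis2 : cis (pi *+ 2 : R) = 1 by rewrite /cis cos2pi sin2pi.
  have [h|h] : shell_dist (0, 2 * x) <= 8^-1 \/ 3 / 8 <= shell_dist (0, 2 * x).
    move: m; rewrite /middle negb_and -!leNgt.
    by move=> /orP[] h; [left|right]; lra.
  - by rewrite /meridian sphere_map_out ?cutoff0 ?mulr0 ?cis0//; left.
  by rewrite /meridian sphere_map_out ?cutoff1 ?mulr1 ?cis2//; right.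
have d s : shell_dist (0, s) = clamp (clamp s) * expR (- clamp (height s)).
  by rewrite /shell_dist shell_start tube_dist.
have cf x : {for x, continuous (fun x : R => pi *+ 2 * cutoff (0, 2 * x) : R)}.
  apply: continuousM; first exact: continuous_cst_at.
  apply: (@continuous_comp _ _ _ (fun x : R => ((0 : R), 2 * x)) cutoff);
    last exact: continuous_cutoff.
  have cz : {for x, continuous (fun _ : R => 0 : R)} by exact: cvg_cst.
  have ci : {for x, continuous (fun x : R => 2 * x : R)}.
    by apply: continuousM; [exact: continuous_cst_at|exact: cvg_id].
  exact: (cvg_pair cz ci).
rewrite (@winding_cis _ _ (fun=> 1) (fun x => pi *+ 2 * cutoff (0, 2 * x))).
- have -> : cutoff (0, 2 * 1) = 1.
    rewrite cutoff1// mulr1 d /height subrr (clamp_le0 (lexx 0)) mulr0.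
    rewrite (clamp_le0 (lexx 0)) oppr0 expR0 mulr1 (@clamp_ge1 _ 2) ?ler1n//.
    by rewrite clamp_ge1//; lra.
  have -> : cutoff (0, 2 * 0) = 0.
    by rewrite cutoff0// mulr0 d (clamp_le0 (lexx 0)) (clamp_le0 (lexx 0)) mul0r invr_ge0.
  by rewrite mulr1 mulr0 subr0.
- exact: meridian_closed.
- exact: cf.
- by [].
- by move=> x _; rewrite E mul1r.
Qed.

Lemma shell_obstruction : False.
Proof.
have := meridian_invariant; rewrite meridian_start meridian_end => /eqP.
by rewrite mulrn_eq0 /= gt_eqF// pi_gt0.
Qed.

End Shell.

Lemma obstruction : False.
Proof.
have [tau0 [t0 tP]] := orbit_uniform; exact: (shell_obstruction t0 tP).
Qed.

End Obstruction.

(** * Existence and non-existence of contractions *)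

Lemma within_comp (T U V : topologicalType) (A : set U) (f : U -> V) (g : T -> U) :
  {within A, continuous f} -> continuous g -> (forall q, A (g q)) ->
  continuous (fun q => f (g q)).
Proof.
move=> cf cg Ag q W hW; have := cf (g q) W hW.
rewrite /= -[nbhs (_ : subspace A)]/(nbhs_subspace (g q : subspace A)).
rewrite -(nbhs_subspace_in (Ag q)) => h.
have h' : nbhs q (fun p => A (g p) -> W (f (g p))) by exact: (cg q _ h).
by apply: filterS h' => p; apply.
Qed.

Section NotContractible.
Variables (R : realType) (K : pred R[i]) (k : subFieldType K).
Local Notation X := (A1hyb k).

(** The orbits of the Archimedean points form the image of a space with a
    countable base, so they enter countably many branches only; so does the orbit
    of the Gauss point. *)
Lemma avoided_branch (H : R * X -> X) : continuous H -> ~ countable [set: k] ->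
  exists a : k, (forall t r z, 0 < r <= 1 -> ~ branch_zone a (H (t, arch_point k r z))) /\
    (forall t, ~ branch_zone a (H (t, deg_point k 1))).
Proof.
move=> cH nc.
pose r (p : R * R * (R * R)) : R := expR (- `|p.1.2|).
pose z (p : R * R * (R * R)) : R[i] := Complex p.2.1 p.2.2.
pose F p := H (p.1.1, arch_point k (r p) (z p)).
have cF : continuous F.
  move=> p.
  have c1 : {for p, continuous (fun p : R * R * (R * R) => p.1)} by exact: cvg_fst.
  have c2 : {for p, continuous (fun p : R * R * (R * R) => p.2)} by exact: cvg_snd.
  have c11 := continuous_fst_at c1; have c12 := continuous_snd_at c1.
  have c21 := continuous_fst_at c2; have c22 := continuous_snd_at c2.
  have cr : {for p, continuous r}.
    apply: (@continuous_comp _ _ _ (fun p : R * R * (R * R) => - `|p.1.2|) (@expR R));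
      last exact: continuous_expR.
    apply: continuousN.
    apply: (@continuous_comp _ _ _ (fun p : R * R * (R * R) => p.1.2) (fun x : R => `|x|)).
      exact: c12.
    exact: norm_continuous.
  have ca : {for p, continuous (fun p => arch_point k (r p) (z p))}.
    apply: continuous_arch_point => // q; rewrite expR_gt0 /=.
    by rewrite -expR0 ler_expR oppr_le0.
  apply: (@continuous_comp _ _ _ (fun p => (p.1.1, arch_point k (r p) (z p))) H);
    last exact: cH.
  exact: (cvg_pair c11 ca).
pose G (t : R) := H (t, deg_point k 1).
have cG : continuous G.
  move=> t; apply: (@continuous_comp _ _ _ (fun t : R => (t, deg_point k 1)) H);
    last exact: cH.
  exact: continuous_pairr.
have bR := @countable_base_real R.
have b4 := countable_base_prod (countable_base_prod bR bR) (countable_base_prod bR bR).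
have b1 := few_branches b4 cF; have b2 := few_branches bR cG.
pose B (i : bool) : set k := if i then [set a | exists p, branch_zone a (F p)]
  else [set a | exists t, branch_zone a (G t)].
have cB : countable (\bigcup_i B i) by apply: bigcup_countable => // -[].
have [a nBa] : exists a, ~ (\bigcup_i B i) a.
  apply: contrapT => h; apply: nc; apply: sub_countable cB; apply: subset_card_le => a _.
  by apply: contrapT => nBa; apply: h; exists a.
exists a; split => [t s w /andP[s0 s1] hz|t hz]; apply: nBa; last first.
  by exists false => //; exists t.
exists true => //; exists ((t, ln s), (Re w, Im w)).
rewrite /F /r /z /= ler0_norm ?ln_le0// opprK lnK ?posrE//.
by case: w hz.
Qed.

Lemma not_contractible : (exists c : k, Im (val c) != 0) -> ~ countable [set: k] ->
  ~ contractible R X.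
Proof.
move=> nr nc [x1 [H0 [cH H00 H01]]].
pose H (p : R * X) := H0 (clamp p.1, p.2).
have cH' : continuous H.
  apply: (@within_comp _ _ _ _ H0 (fun p : R * X => (clamp p.1, p.2)) cH); last first.
    by move=> p; split => //=; rewrite in_itv /= clamp_ge0 clamp_le1.
  move=> p.
  have c1 : {for p, continuous (fun p : R * X => p.1)} by exact: cvg_fst.
  have c2 : {for p, continuous (fun p : R * X => p.2)} by exact: cvg_snd.
  exact: (cvg_pair (continuous_clamp c1) c2).
have [a [a1 a2]] := avoided_branch cH' nc.
apply: (obstruction cH' _ _ nr a1 a2).
  by move=> x; rewrite /H /= clamp_le0.
by move=> x; rewrite /H /= clamp_ge1// H01.
Qed.

End NotContractible.

Theorem theoremA (R : realType) (K : pred R[i]) (k : subFieldType K) :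
  (countable [set: k] ->
     (exists H : R * A1hyb k -> A1hyb k,
        strong_deformation_retraction (A1triv k) H) /\
     contractible R (A1hyb k)) /\
  (~ countable [set: k] ->
   ~ ([set z | K z] `<=` range (fun r : R => r%:C%C)) ->
     ~ contractible R (A1hyb k)).
Proof.
split=> [ck|nc nr].
  have [e eP] := poly_enum ck.
  split; first by exists (retraction eP); exact: retraction_sdr.
  apply: (@retract_contractible _ _ _ (retraction eP)).
  - exact: continuous_retraction.
  - exact: retraction0.
  - exact: retraction1.
apply: not_contractible => //; apply: contrapT => h; apply: nr => z Kz.
exists (Re z) => //.
have Iz : Im z = 0.
  apply: contrapT => /eqP i0; apply: h; exists (Sub z Kz : k).
  by rewrite SubK.
by move: Iz; case: z {Kz} => u v /= ->.
Qed.
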